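(* Let $\mathcal D$ denote either of the graph complexes $\mathcal D_o$, $\mathcal D_e$ of graphs on an oriented circle, with coboundary operator $\delta$, shuffle product $\bullet$ and grading $|\cdot|$. Then $(\mathcal D,\delta,\bullet)$ is a differential graded commutative algebra. It also has a unit $\mathbf 1$ consisting of the graph without edges. It follows that its cohomology $H(\mathcal D)$ is a graded commutative algebra with unit.
   Context: **Graphs.** A graph consists of an oriented circle and edges joining vertices. Vertices lying on the circle are called external; those lying off the circle are called internal and are required to be at least trivalent. With $e$, $v_i$, $v_e$ the numbers of edges, internal vertices and external vertices, the order is $k=e-v_i\ge 0$ and the degree is $m=2e-v_e-3v_i\ge0$. An arc is a piece of the oriented circle between two consecutive vertices; a regular edge is an edge with at least one internal end-point. **Decorations and relations.** $\mathcal D_o^{k,m}$ is the real vector space generated by graphs of order $k$ and degree $m$ decorated by numbering all the vertices (first the external ones, then the internal ones) and orienting the edges, modulo the relations: a cyclic permutation of the external vertices or a permutation of the internal vertices multiplies the graph by the sign of the permutation; reversing the orientation of an edge produces a minus sign. Edges connecting an external vertex to itself carry in addition an ordering of their two half-edges. $\mathcal D_e^{k,m}$ is generated by graphs decorated by numbering the external vertices and numbering the edges, modulo: a cyclic permutation of the external vertices or a permutation of the edges multiplies the graph by the sign of the permutation. In both cases one also quotients by the subspace generated by graphs containing two edges joining the same pair of vertices and graphs containing an edge whose end-points are the same internal vertex. $\mathcal D=\bigoplus_{k,m}\mathcal D^{k,m}$ in each case. **Coboundary.** $\delta\colon\mathcal D^{k,m}\to\mathcal D^{k,m+1}$ sends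 $\Gamma$ to the signed sum of all graphs obtained from $\Gamma$ by contracting, one at a time, all the regular edges and arcs. Contracting an arc or edge connecting vertex $i$ with vertex $j$ and oriented from $i$ to $j$ has sign $(-1)^j$ if $j>i$ and $(-1)^{i+1}$ if $j<i$; contracting an edge labeled by $\alpha$ has sign $(-1)^{\alpha+1+v_e}$. Contracting the edge between $i$ and $j$ produces a vertex labeled $\min(i,j)$, and vertex labels greater than $\max(i,j)$ are rescaled by one; when the edge labeled $\alpha$ is collapsed, edge labels greater than $\alpha$ are rescaled by one. **Grading.** $|\Gamma|=e(\Gamma)+v_e(\Gamma)$ in the even case and $|\Gamma|=v(\Gamma)$, the total number of vertices, in the odd case. With respect to it $\delta$ has degree $-1$ and $\bullet$ has degree $0$; graded commutativity means $\Gamma_1\bullet\Gamma_2=(-1)^{|\Gamma_1|\,|\Gamma_2|}\Gamma_2\bullet\Gamma_1$. **Shuffle product.** For graphs $\Gamma_1,\Gamma_2$ with (cyclically ordered) sets of external vertices $V_e^1,V_e^2$, a $(V_e^1,V_e^2)$-shuffle is a permutation $\sigma$ of $V_e^1\cup V_e^2$ respecting the cyclic orders of $V_e^1$ and $V_e^2$; $\Gamma_1\bullet_\sigma\Gamma_2$ is the graph obtained by placing the legs of $\Gamma_1$ and $\Gamma_2$ into distinct external vertices on one oriented circle according to $\sigma$. Vertices and edges coming from $\Gamma_1$ keep their labels; to vertex (edge) labels of $\Gamma_2$ one adds the number of labeled vertices (the number of edges) of $\Gamma_1$; unlabeled items stay unlabeled. Then $\Gamma_1\bullet\Gamma_2=(-1)^{\lambda(\Gamma_1,\Gamma_2)}\sum_\sigma\Gamma_1\bullet_\sigma\Gamma_2$,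 summed over all shuffles and extended linearly, with $\lambda(\Gamma_1,\Gamma_2)=v_e(\Gamma_2)\,e(\Gamma_1)$ in the even case and $0$ in the odd case. *)

(* Defs.v *)
From HB Require Import structures.
From mathcomp Require Import all_boot all_order all_algebra.
From mathcomp Require Import finmap.
From mathcomp Require Import boolp reals.
From mathcomp.multinomials Require Import monalg.

Set Implicit Arguments.
Unset Strict Implicit.
Unset Printing Implicit Defensive.

Import GRing.Theory.
Local Open Scope ring_scope.
Local Open Scope quotient_scope.

Section Span.
Context (R : nzRingType) (V : lmodType R) (G : V -> Prop).

Definition span : {pred V} := fun v =>
  `[< exists s : seq (R * V),
        (forall x, x \in s -> G x.2) /\ v = \sum_(x <- s) x.1 *: x.2 >].

Lemma spanP v : reflect
  (exists s : seq (R * V),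
     (forall x, x \in s -> G x.2) /\ v = \sum_(x <- s) x.1 *: x.2)
  (v \in span).
Proof. exact: asboolP. Qed.

Lemma span_scale a v : v \in span -> a *: v \in span.
Proof.
move=> /spanP [s [Gs ->]]; apply/spanP.
exists [seq (a * x.1, x.2) | x <- s]; split.
  by move=> y /mapP [x /Gs Gx ->].
by rewrite scaler_sumr big_map; apply: eq_bigr => x _; rewrite scalerA.
Qed.

Lemma span_zmod_closed : zmod_closed span.
Proof.
split; first by apply/spanP; exists [::]; rewrite big_nil.
move=> u v /spanP [s [Gs ->]] /(span_scale (-1)) /spanP [t [Gt e]].
rewrite scaleN1r in e; rewrite e; apply/spanP; exists (s ++ t).
split; last by rewrite big_cat.
by move=> x; rewrite mem_cat => /orP [/Gs|/Gt].
Qed.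

HB.instance Definition _ := GRing.isZmodClosed.Build V span span_zmod_closed.

Definition quot_span : Type := Quotient.quot span.
HB.instance Definition _ := Choice.on quot_span.
HB.instance Definition _ := GRing.Zmodule.on quot_span.

Definition quot_pi (v : V) : quot_span := \pi_(Quotient.quot span) v.
Definition quot_repr (x : quot_span) : V :=
  repr (x : Quotient.quot span).

Lemma quot_reprK x : quot_pi (quot_repr x) = x.
Proof. exact: reprK. Qed.

Lemma quot_piP u v : quot_pi u = quot_pi v <-> u - v \in span.
Proof.
rewrite Quotient.idealrBE; split=> [/eqP|/eqP]; first by [].
by [].
Qed.

Lemma quot_piB u v : quot_pi (u - v) = quot_pi u - quot_pi v.
Proof. by rewrite /quot_pi; rewrite !piE. Qed.

Lemma quot_piD u v : quot_pi (u + v) = quot_pi u + quot_pi v.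
Proof. by rewrite /quot_pi; rewrite !piE. Qed.

Definition quot_scale (a : R) (x : quot_span) : quot_span :=
  quot_pi (a *: quot_repr x).

Lemma quot_scale_pi a v : quot_scale a (quot_pi v) = quot_pi (a *: v).
Proof.
apply/quot_piP; rewrite -scalerBr span_scale //.
by apply/quot_piP; rewrite quot_reprK.
Qed.

Fact quot_scaleA a b x : quot_scale a (quot_scale b x) = quot_scale (a * b) x.
Proof. by rewrite -(quot_reprK x) !quot_scale_pi scalerA. Qed.
Fact quot_scale1 : left_id 1 quot_scale.
Proof. by move=> x; rewrite -(quot_reprK x) quot_scale_pi scale1r. Qed.
Fact quot_scaleDr : right_distributive quot_scale +%R.
Proof.
move=> a x y; rewrite -(quot_reprK x) -(quot_reprK y).
by rewrite -quot_piD !quot_scale_pi scalerDr quot_piD.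
Qed.
Fact quot_scaleDl x : {morph quot_scale^~ x : a b / a + b}.
Proof.
move=> a b; rewrite -(quot_reprK x) !quot_scale_pi.
by rewrite scalerDl quot_piD.
Qed.

HB.instance Definition _ := GRing.Zmodule_isLmodule.Build R quot_span
  quot_scaleA quot_scale1 quot_scaleDr quot_scaleDl.

Lemma quot_pi_linear : linear quot_pi.
Proof. by move=> a u v; rewrite quot_piD -quot_scale_pi. Qed.
HB.instance Definition _ := GRing.isLinear.Build R V quot_span _ quot_pi
  quot_pi_linear.

(* The linear map induced on the quotient by a linear map that kills G; it is
   set to 0 when f does not kill G. *)
Context (W : lmodType R) (f : {linear V -> W}).

Definition quot_lift (x : quot_span) : W :=
  if `[< forall v, G v -> f v = 0 >] then f (quot_repr x) else 0.

Lemma quot_lift_linear : linear quot_lift.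
Proof.
move=> a x y; rewrite /quot_lift; case: asboolP => [fG|_]; last first.
  by rewrite scaler0 addr0.
rewrite -linearP; apply/eqP; rewrite -subr_eq0 -linearB; apply/eqP.
have /spanP [s [Gs ->]] :
    quot_repr (a *: x + y) - (a *: quot_repr x + quot_repr y) \in span.
  by apply/quot_piP; rewrite linearP /= !quot_reprK.
rewrite linear_sum big_seq big1 // => z /Gs /fG fz.
by rewrite linearZ /= fz scaler0.
Qed.
HB.instance Definition _ := GRing.isLinear.Build R quot_span W _ quot_lift
  quot_lift_linear.
End Span.

Section LinearExtension.
Context (R : nzRingType) (K : choiceType) (W : lmodType R) (f : K -> W).

Definition lextend (v : {malg R[K]}) : W := \sum_(k <- msupp v) v@_k *: f k.

Lemma lextendEw (d : {fset K}) v : (msupp v `<=` d)%fset ->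
  lextend v = \sum_(k <- d) v@_k *: f k.
Proof.
move=> le; rewrite /lextend (big_fset_incl _ le) // => x _ /mcoeff_outdom ->.
by rewrite scale0r.
Qed.

Lemma lextend_linear : linear lextend.
Proof.
move=> a u v.
set w := a *: u + v; set d := (msupp u `|` msupp v `|` msupp w)%fset.
have ud : (msupp u `<=` d)%fset by rewrite /d -fsetUA fsubsetUl.
have vd : (msupp v `<=` d)%fset by rewrite /d fsetUAC fsubsetUr.
have wd : (msupp w `<=` d)%fset by rewrite /d fsubsetUr.
rewrite (lextendEw ud) (lextendEw vd) (lextendEw wd).
rewrite scaler_sumr -big_split; apply: eq_bigr => k _ /=.
by rewrite mcoeffD mcoeffZ scalerDl scalerA.
Qed.
HB.instance Definition _ := GRing.isLinear.Build R {malg R[K]} W _ lextend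
  lextend_linear.
End LinearExtension.

Section Cohomology.
Context (R : nzRingType) (A : lmodType R) (d : {linear A -> A}).

Definition is_cocycle : {pred A} := fun x => d x == 0.

Fact is_cocycle_submod : submod_closed is_cocycle.
Proof.
split=> [|a x y]; rewrite !unfold_in; first by rewrite linear0.
by move=> /eqP dx /eqP dy; rewrite linearP dx dy scaler0 addr0.
Qed.
HB.instance Definition _ := GRing.isSubmodClosed.Build R A is_cocycle
  is_cocycle_submod.

Definition cocycle : Type := {x : A | is_cocycle x}.
HB.instance Definition _ := SubChoice.on cocycle.
HB.instance Definition _ := [SubChoice_isSubLmodule of cocycle by <:].

Definition is_coboundary (z : cocycle) : Prop := exists y, val z = d y.

Definition cohomology : Type := quot_span is_coboundary.
HB.instance Definition _ := GRing.Lmodule.on cohomology.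

Definition coh_class (z : cocycle) : cohomology := quot_pi is_coboundary z.
Definition coh_repr (h : cohomology) : cocycle := quot_repr h.
End Cohomology.

Section CohomologyProduct.
Context (R : nzRingType) (A : lmodType R) (d : {linear A -> A}).
Context (mul : A -> A -> A).

(* Product of representing cocycles; the default value 0 of insubd is only
   reached when mul does not preserve cocycles. *)
Definition coh_mul (h1 h2 : cohomology d) : cohomology d :=
  coh_class (insubd (0 : cocycle d)
    (mul (val (coh_repr h1)) (val (coh_repr h2)))).

Definition coh_gr (I : Type) (gr : I -> A -> Prop) (i : I)
    (h : cohomology d) : Prop :=
  exists2 z : cocycle d, gr i (val z) & h = coh_class z.
End CohomologyProduct.

Section GradedAlgebra.
Context (R : realType) (A : lmodType R).

Record direct_sum (I : eqType) (gr : I -> A -> Prop) : Prop := DirectSum {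
  ds_zero : forall i, gr i 0;
  ds_linear : forall i a x y, gr i x -> gr i y -> gr i (a *: x + y);
  ds_generate : forall x, exists (s : seq I) (f : I -> A),
    [/\ uniq s, forall i, gr i (f i) & x = \sum_(i <- s) f i];
  ds_independent : forall (s : seq I) (f : I -> A),
    uniq s -> (forall i, gr i (f i)) -> \sum_(i <- s) f i = 0 ->
    {in s, forall i, f i = 0} }.

Context (gr : int -> A -> Prop) (mul : A -> A -> A).

Record graded_commutative_algebra : Prop := GradedCommutativeAlgebra {
  gca_graded : direct_sum gr;
  gca_linear_l : forall y, linear (mul^~ y);
  gca_linear_r : forall x, linear (mul x);
  gca_degree : forall i j x y, gr i x -> gr j y -> gr (i + j) (mul x y);
  gca_assoc : associative mul;
  gca_comm : forall i j x y, gr i x -> gr j y ->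
    mul x y = (-1) ^ (i * j) *: mul y x }.

Record algebra_unit (one : A) : Prop := AlgebraUnit {
  unit_degree : gr 0 one;
  unit_l : left_id one mul;
  unit_r : right_id one mul }.

Record dg_commutative_algebra (d : {linear A -> A}) : Prop :=
  DGCommutativeAlgebra {
  dgca_gca : graded_commutative_algebra;
  dgca_degree : forall i x, gr i x -> gr (i - 1) (d x);
  dgca_square : forall x, d (d x) = 0;
  dgca_leibniz : forall i x y, gr i x ->
    d (mul x y) = mul (d x) y + (-1) ^ i *: mul x (d y) }.
End GradedAlgebra.

(* D_o is the Odd case, D_e the Even case. *)
Variant parity := Odd | Even.
Definition is_odd (c : parity) : bool := if c is Odd then true else false.
Definition is_even (c : parity) : bool := ~~ is_odd c.

(* ((i, j), b): an edge oriented from vertex i to vertex j.  The bit b is only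
   significant for a loop (i = j): it tells that the edge is oriented from the
   second to the first of its two ordered half-edges. *)
Definition edge : Type := (nat * nat * bool)%type.
Definition tail (e : edge) : nat := e.1.1.
Definition head (e : edge) : nat := e.1.2.
Definition flipped (e : edge) : bool := e.2.
Definition is_loop (e : edge) : bool := tail e == head e.
Definition ends (e : edge) : nat * nat :=
  (minn (tail e) (head e), maxn (tail e) (head e)).
Definition reverse (e : edge) : edge :=
  (head e, tail e, is_loop e && ~~ flipped e).
Definition map_ends (f : nat -> nat) (e : edge) : edge :=
  (f (tail e), f (head e), flipped e).

(* External vertices are 1, ..., vext in the order in which they occur on the
   oriented circle, internal vertices are vext + 1, ..., vext + vint, and the
   edge labelled k is the k-th element of the list (counting from 1).  A graph
   thus always carries all the decorations: those that are absent in one of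
   the two cases are removed by the sign-free instances of graph_rel below. *)
Record predgraph := PreDGraph {
  vext : nat;
  vint : nat;
  edges : seq edge }.

Definition predgraph_code (g : predgraph) := (vext g, vint g, edges g).
Definition predgraph_decode (x : nat * nat * seq edge) :=
  PreDGraph x.1.1 x.1.2 x.2.
Fact predgraph_codeK : cancel predgraph_code predgraph_decode.
Proof. by case. Qed.
HB.instance Definition _ := Countable.copy predgraph (can_type predgraph_codeK).

Definition nvert (g : predgraph) : nat := (vext g + vint g)%N.
Definition nedge (g : predgraph) : nat := size (edges g).
Definition ext_vertices (g : predgraph) : seq nat := iota 1 (vext g).
Definition int_vertices (g : predgraph) : seq nat := iota (vext g).+1 (vint g).
Definition is_internal (g : predgraph) (i : nat) : bool :=
  i \in int_vertices g.
Definition valence (g : predgraph) (i : nat) : nat :=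
  (count (fun e => tail e == i) (edges g)
   + count (fun e => head e == i) (edges g))%N.

Definition is_graph (g : predgraph) : bool :=
  [&& all (fun e => [&& 0 < tail e <= nvert g, 0 < head e <= nvert g
                      & flipped e ==> is_loop e])%N (edges g),
      all (fun i => 0 < valence g i)%N (ext_vertices g)
    & all (fun i => 3 <= valence g i)%N (int_vertices g)].

Definition dgraph : Type := {g : predgraph | is_graph g}.
HB.instance Definition _ := SubChoice.on dgraph.

Definition order (g : predgraph) : int := (nedge g)%:Z - (vint g)%:Z.
Definition degree (g : predgraph) : int :=
  2 * (nedge g)%:Z - (vext g)%:Z - 3 * (vint g)%:Z.
Definition grading (c : parity) (g : predgraph) : int :=
  match c with
  | Odd => (nvert g)%:Z
  | Even => (nedge g)%:Z + (vext g)%:Z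
  end.

(* Two edges with the same ends (possibly two loops at one vertex), or a loop
   at an internal vertex. *)
Definition degenerate (g : predgraph) : bool :=
  ~~ uniq [seq ends e | e <- edges g]
  || has (fun e => is_loop e && is_internal g (tail e)) (edges g).

(* (-1) ^ inversions s is the sign of the permutation sorting s. *)
Fixpoint inversions (s : seq nat) : nat :=
  if s is x :: s' then (count (fun y => y < x) s' + inversions s')%N else 0%N.

(* The new label of x when the labels, listed in their new order, are s. *)
Definition new_label (s : seq nat) (x : nat) : nat := (index x s).+1.
Definition relabel (s : seq nat) (g : predgraph) : predgraph :=
  PreDGraph (vext g) (vint g) (map (map_ends (new_label s)) (edges g)).
Definition set_edges (g : predgraph) (es : seq edge) : predgraph :=
  PreDGraph (vext g) (vint g) es.
Definition no_edge : edge := (0%N, 0%N, false).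

Section GraphComplex.
Context (R : realType) (c : parity).

Definition sgn (n : nat) : R := (-1) ^+ n.

(* The generator g; all the pre-graphs to which it is applied below satisfy
   is_graph. *)
Definition gen (g : predgraph) : {malg R[dgraph]} :=
  if insub g is Some g' then << g' >> else 0.

Variant graph_rel : {malg R[dgraph]} -> Prop :=
| RelExternal (g : dgraph) (n : nat) :
    let s := rot n (ext_vertices (val g)) in
    graph_rel (gen (relabel (s ++ int_vertices (val g)) (val g))
               - sgn (inversions s) *: gen (val g))
| RelInternal (g : dgraph) (s : seq nat) of
    perm_eq s (int_vertices (val g)) :
    graph_rel (gen (relabel (ext_vertices (val g) ++ s) (val g))
               - sgn (is_odd c * inversions s) *: gen (val g))
| RelEdges (g : dgraph) (s : seq nat) of perm_eq s (iota 0 (nedge (val g))) :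
    graph_rel (gen (set_edges (val g)
                      [seq nth no_edge (edges (val g)) k | k <- s])
               - sgn (is_even c * inversions s) *: gen (val g))
| RelOrientation (g : dgraph) (es1 es2 : seq edge) (e : edge) of
    edges (val g) = es1 ++ e :: es2 :
    graph_rel (gen (set_edges (val g) (es1 ++ reverse e :: es2))
               - sgn (is_odd c) *: gen (val g))
| RelDegenerate (g : dgraph) of degenerate (val g) :
    graph_rel (gen (val g)).

Definition graph_complex : Type := quot_span graph_rel.
HB.instance Definition _ := GRing.Lmodule.on graph_complex.

Definition cls (g : predgraph) : graph_complex := quot_pi graph_rel (gen g).

(* The classes of linear combinations of graphs satisfying P. *)
Definition graph_span (P : predgraph -> Prop) (x : graph_complex) : Prop :=
  exists2 v : {malg R[dgraph]},
    (forall g : dgraph, g \in msupp v -> P (val g)) & x = quot_pi graph_rel v.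

Definition bigraded_part (km : nat * nat) : graph_complex -> Prop :=
  graph_span (fun g => order g = km.1%:Z /\ degree g = km.2%:Z).
Definition graded_part (n : int) : graph_complex -> Prop :=
  graph_span (fun g => grading c g = n).
End GraphComplex.

(* The arcs (i, j), from i to the next external vertex j on the circle. *)
Definition arcs (g : predgraph) : seq (nat * nat) :=
  if (1 < vext g)%N then zip (ext_vertices g) (rot 1 (ext_vertices g))
  else [::].

Definition merge_label (i j x : nat) : nat :=
  if (x == i) || (x == j) then minn i j
  else if (maxn i j < x)%N then x.-1 else x.

(* An edge joining the end-points of the arc from i to j becomes a loop, whose
   first half-edge is the one that was attached to i. *)
Definition contract_arc (a : nat * nat) (g : predgraph) : predgraph :=
  let: (i, j) := a in
  PreDGraph (vext g).-1 (vint g)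
    [seq if ((tail e, head e) == (i, j)) || ((tail e, head e) == (j, i))
         then (minn i j, minn i j, tail e == j)
         else map_ends (merge_label i j) e | e <- edges g].

Definition contract_edge (k : nat) (g : predgraph) : predgraph :=
  let e := nth no_edge (edges g) k.-1 in
  PreDGraph (vext g) (vint g).-1
    [seq map_ends (merge_label (tail e) (head e)) e'
        | e' <- take k.-1 (edges g) ++ drop k (edges g)].

Definition regular_edge (g : predgraph) (k : nat) : bool :=
  let e := nth no_edge (edges g) k.-1 in
  is_internal g (tail e) || is_internal g (head e).

Definition oriented_exponent (i j : nat) : nat :=
  if (i < j)%N then j else i.+1.

Definition edge_exponent (c : parity) (g : predgraph) (k : nat) : nat :=
  match c with
  | Odd => let e := nth no_edge (edges g) k.-1 in
           oriented_exponent (tail e) (head e)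
  | Even => (k + 1 + vext g)%N
  end.

Definition is_rotation (s t : seq nat) : bool :=
  s \in [seq rot n t | n <- iota 0 (size t).+1].

(* The arrangements on the circle of the disjoint cyclically ordered sets s
   and t.  An arrangement is read from the first element of s ++ t, so that
   each of them is listed once and not once for each starting point. *)
Definition cyclic_shuffles (s t : seq nat) : seq (seq nat) :=
  [seq w <- permutations (s ++ t)
     | [&& ohead w == ohead (s ++ t),
           is_rotation [seq x <- w | x \in s] s
         & is_rotation [seq x <- w | x \in t] t]].

Section ShuffleOfGraphs.
Context (g1 g2 : predgraph).

Definition shift_label (x : nat) : nat := (nvert g1 + x)%N.
Definition both_ext : seq (seq nat) :=
  cyclic_shuffles (ext_vertices g1) (map shift_label (ext_vertices g2)).
Definition both_int : seq nat :=
  int_vertices g1 ++ map shift_label (int_vertices g2).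

(* The labels i of g1 and shift_label i of g2 do not list first the external
   vertices along the circle, then the internal ones: the vertices are
   renumbered in this order, with the sign shuffle_exponent of the permutation
   of the labelled vertices (only the external ones in the even case). *)
Definition shuffle_graph (w : seq nat) : predgraph :=
  PreDGraph (vext g1 + vext g2) (vint g1 + vint g2)
    (map (map_ends (new_label (w ++ both_int)))
       (edges g1 ++ map (map_ends shift_label) (edges g2))).

Definition shuffle_exponent (c : parity) (w : seq nat) : nat :=
  match c with
  | Odd => inversions (w ++ both_int)
  | Even => inversions w
  end.

Definition lambda (c : parity) : nat :=
  match c with
  | Odd => 0%N
  | Even => (vext g2 * nedge g1)%N
  end.
End ShuffleOfGraphs.

Definition empty_graph : predgraph := PreDGraph 0 0 [::].

Section Operations.
Context (R : realType) (c : parity).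
Local Notation D := (graph_complex R c).

(* Degenerate graphs vanish in D, so their coboundary has to be 0; the signed
   sum is only meaningful on the other graphs.  If an internal vertex with a
   loop is adjacent to an external vertex, for instance, contraction would turn
   this loop into one at the external vertex, which need not vanish in D. *)
Definition coboundary_graph (g : predgraph) : D :=
  if degenerate g then 0 else
    \sum_(a <- arcs g) sgn R (oriented_exponent a.1 a.2)
      *: cls R c (contract_arc a g)
    + \sum_(1 <= k < (nedge g).+1 | regular_edge g k)
        sgn R (edge_exponent c g k) *: cls R c (contract_edge k g).

Definition coboundary : D -> D :=
  quot_lift (lextend (fun g : dgraph => coboundary_graph (val g))).
HB.instance Definition _ := GRing.Linear.on coboundary.

Definition shuffle_graphs (g1 g2 : predgraph) : D :=
  sgn R (lambda g1 g2 c) *: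
    \sum_(w <- both_ext g1 g2)
      sgn R (shuffle_exponent g1 g2 c w) *: cls R c (shuffle_graph g1 g2 w).

Definition shuffle (x y : D) : D :=
  lextend (fun g1 : dgraph =>
    lextend (fun g2 : dgraph => shuffle_graphs (val g1) (val g2))
      (quot_repr y))
    (quot_repr x).

Definition unit_class : D := cls R c empty_graph.
End Operations.

Arguments bigraded_part R c km x : clear implicits.
Arguments graded_part R c n x : clear implicits.
Arguments coboundary R c x : clear implicits.
Arguments shuffle R c x y : clear implicits.
Arguments coh_gr {R A} d {I} gr i h.

(* Main.v *)
(** Graphs are handled with arbitrary distinct vertex labels, so that
    contractions and products need no renumbering: a graph is a circular word W
    of external vertices, a list I of internal vertices and a list E of edges,
    and every sign is the parity of a rearrangement of these lists.  By the
    relations of the complex, its linear maps are the alternating functions of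
    (W, I, E).

    After moving an arc or an edge to the front, contracting it has a fixed
    sign; hence the coboundary is alternating.  Its square vanishes because
    contracting two arcs or edges in the two orders gives opposite terms; when
    one of the orders meets a degenerate graph, the contracted pieces lie in a
    triangle, whose two remaining sides give opposite terms.

    In the Leibniz rule, the arcs of a shuffle that join the two factors cancel:
    exchanging the ends of such an arc gives another shuffle, of opposite sign
    and with the same contraction.  The product is associative because both
    triple products sum over the circular words restricting to the three given
    ones.  The projections onto the homogeneous parts are induced by
    alternating functions.  Finally the homogeneous components of a cocycle are
    cocycles, so that the Leibniz rule applies to cocycles which are not
    homogeneous and the product descends to cohomology. *)
Require Import Defs.
From HB Require Import structures.
From mathcomp Require Import all_boot all_order all_algebra.
From mathcomp Require Import finmap.
From mathcomp Require Import boolp reals.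
From mathcomp.multinomials Require Import monalg.
From mathcomp Require Import zify.
Import Defs.

Set Implicit Arguments.
Unset Strict Implicit.
Unset Printing Implicit Defensive.

Import GRing.Theory.

(** * Parity of rearrangements and rotations *)

(** Contraction signs are prescribed through consecutive labels, which every contraction renumbers;
    as parities of rearrangements they compose without renumbering. In both cases all edges share
    the factor (-1)^v_e. It is kept outside the edge sum: it changes sign when an arc is contracted,
    and this alone makes arc and edge contractions anticommute. Since the coboundary of a degenerate
    graph is set to 0, a double contraction may be lost in one order only. For two edges the
    surviving order then has class 0. For an arc and an edge it need not: two edges from one
    internal vertex to the ends of the arc produce a loop at an external vertex in two ways. These
    loops differ in the ordering of their half-edges, which gives the opposite sign in the odd case;
    in the even case the exchange of the two edges does. A labelled configuration violating the
    valence conditions has class 0, so the sign rules for classes need no valence checks. In the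
    Leibniz rule only contractions inside the left factor are computed; those inside the right one
    follow from graded commutativity. *)

Lemma inversions_swap (a b : seq nat) (x y : nat) : x != y ->
  odd (inversions (a ++ x :: y :: b)) = ~~ odd (inversions (a ++ y :: x :: b)).
Proof.
move=> xy; elim: a => [|z a IH] /=.
  by rewrite !oddD; case: ltngtP xy => //= _ _; rewrite ?oddD /=; case: (odd _); case: (odd _); case: (odd _).
rewrite !oddD IH !count_cat /= !oddD.
by do 5 case: (odd _).
Qed.

Lemma inversions_mono (h : nat -> nat) (s : seq nat) :
  {in s &, {mono h : x y / x < y}} -> inversions (map h s) = inversions s.
Proof.
elim: s => //= x s IH mh; rewrite IH; last first.
  by move=> y z ys zs; apply: mh; rewrite inE ?ys ?zs orbT.
congr (_ + _); rewrite count_map; apply: eq_in_count => y ys /=.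
by apply: mh; rewrite inE ?eqxx ?ys ?orbT.
Qed.

Lemma inversions_iota m n : inversions (iota m n) = 0.
Proof.
elim: n m => //= n IH m; rewrite IH addn0; apply/eqP.
rewrite -leqn0 leqNgt -has_count; apply/hasPn => y.
by rewrite mem_iota -leqNgt => /andP [/ltnW].
Qed.

Section PermOdd.
Context (T : eqType).
Implicit Types (s t u : seq T) (x y : T).

Lemma perm_swap_ind (P : seq T -> Prop) t :
  P t -> (forall a x y b, P (a ++ x :: y :: b) -> P (a ++ y :: x :: b)) ->
  forall s, perm_eq s t -> P s.
Proof.
move=> Pt Psw s; rewrite perm_sym => st.
suff H : forall a, P (a ++ t) -> P (a ++ s) by exact: (H [::]).
elim: t s st {Pt} => [|x t IH] s st a Pa.
  by move: st; rewrite perm_sym => /perm_nilP ->.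
have xs : x \in s by rewrite -(perm_mem st) mem_head.
case/splitPr: xs st => s1 s2.
rewrite perm_sym -cat1s perm_catCA perm_cons perm_sym => ts.
have {}Pa : P (a ++ x :: s1 ++ s2).
  by rewrite -cat_rcons; apply: IH => //; rewrite cat_rcons.
elim/last_ind: s1 s2 {ts} Pa => [|s1 z IH1] s2 // Pa.
rewrite cat_rcons catA; apply: Psw; rewrite -catA; apply: IH1.
by rewrite cat_rcons in Pa.
Qed.

Lemma perm_adjacent a x y b : perm_eq (a ++ x :: y :: b) (a ++ y :: x :: b).
Proof. by rewrite perm_cat2l -(cat1s x) -(cat1s y) perm_catCA. Qed.

Lemma uniq_adjacent a x y b : uniq (a ++ x :: y :: b) -> x != y.
Proof.
rewrite cat_uniq => /and3P [_ _] /=; rewrite inE negb_or.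
by case/andP => /andP [xy _] _.
Qed.

(* The parity of the permutation carrying the order of s to that of t. *)
Definition perm_odd s t : bool := odd (inversions [seq index x t | x <- s]).

Lemma map_index_self s : uniq s -> [seq index x s | x <- s] = iota 0 (size s).
Proof.
move=> us; apply: (@eq_from_nth _ 0) => [|i]; rewrite size_map ?size_iota // => lt_i.
case: s us lt_i => // x0 s us lt_i.
by rewrite (nth_map x0) // index_uniq // nth_iota.
Qed.

Lemma perm_oddss s : uniq s -> perm_odd s s = false.
Proof. by move=> us; rewrite /perm_odd map_index_self // inversions_iota. Qed.

Lemma perm_odd_swap a b x y t : x != y -> x \in t ->
  perm_odd (a ++ x :: y :: b) t = ~~ perm_odd (a ++ y :: x :: b) t.
Proof.
move=> xy xt; rewrite /perm_odd !map_cat /= inversions_swap //.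
(* A letter outside [t] has index [size t], so equal indices put [y] in [t] as well. *)
apply: contra xy => /eqP e; have yt : y \in t by rewrite -index_mem -e index_mem.
by rewrite -(nth_index x xt) e nth_index.
Qed.

Lemma perm_odd_cat a b s t : uniq (a ++ t ++ b) -> perm_eq s t ->
  perm_odd (a ++ s ++ b) (a ++ t ++ b) = perm_odd s t.
Proof.
move=> utb st; have ut : uniq t by move: utb; rewrite !cat_uniq => /and3P [_ _ /andP []].
pose P s := perm_eq s t -> perm_odd (a ++ s ++ b) (a ++ t ++ b) = perm_odd s t.
apply: (_ : P s) => //; apply: (@perm_swap_ind P t) => //; rewrite /P.
  by move=> _; rewrite !perm_oddss.
move=> c x y d IH e; have e' : perm_eq (c ++ x :: y :: d) t.
  by apply: perm_trans e; apply: perm_adjacent.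
have uc : uniq (c ++ x :: y :: d) by rewrite (perm_uniq e').
have xy : y != x by rewrite eq_sym; apply: uniq_adjacent uc.
have yt : y \in t by rewrite -(perm_mem e') mem_cat !inE eqxx !orbT.
have swapE p q : a ++ (c ++ p :: q :: d) ++ b = (a ++ c) ++ p :: q :: (d ++ b).
  by rewrite -!catA.
rewrite swapE perm_odd_swap //; last by rewrite !mem_cat yt orbT.
by rewrite -swapE IH // [RHS]perm_odd_swap.
Qed.

Lemma perm_odd_trans t s u : uniq u -> perm_eq s t -> perm_eq t u ->
  perm_odd s u = perm_odd s t (+) perm_odd t u.
Proof.
move=> uu st tu; have ut : uniq t by rewrite (perm_uniq tu).
pose P s := perm_eq s t -> perm_odd s u = perm_odd s t (+) perm_odd t u.
apply: (_ : P s) => //; apply: (@perm_swap_ind P t) => //; rewrite /P.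
  by move=> _; rewrite perm_oddss.
move=> c x y d IH e; have e' : perm_eq (c ++ x :: y :: d) t.
  by apply: perm_trans e; apply: perm_adjacent.
have uc : uniq (c ++ x :: y :: d) by rewrite (perm_uniq e').
have xy : y != x by rewrite eq_sym; apply: uniq_adjacent uc.
have yt : y \in t by rewrite -(perm_mem e') mem_cat !inE eqxx !orbT.
rewrite perm_odd_swap // -?(perm_mem tu) // IH // [in RHS]perm_odd_swap //.
by rewrite addNb.
Qed.

Lemma perm_oddC s t : uniq s -> perm_eq s t -> perm_odd s t = perm_odd t s.
Proof.
move=> us st; have ts : perm_eq t s by rewrite perm_sym.
by have := perm_odd_trans us st ts; rewrite perm_oddss //; case: perm_odd; case: perm_odd.
Qed.

Lemma perm_odd_cons x s t : uniq (x :: t) -> perm_eq s t ->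
  perm_odd (x :: s) (x :: t) = perm_odd s t.
Proof.
by move=> ut st; have := @perm_odd_cat [:: x] [::] s t; rewrite /= !cats0; apply.
Qed.

(** Moving [x] to the front takes [size s] adjacent exchanges. *)
Lemma perm_odd_pivot x s t : uniq (s ++ x :: t) ->
  perm_odd (x :: s ++ t) (s ++ x :: t) = odd (size s).
Proof.
elim: s => [|y s IH] /= us; first by rewrite perm_oddss.
have pe : perm_eq (x :: s ++ t) (s ++ x :: t).
  by rewrite -cat1s -[x :: t]cat1s perm_catCA.
rewrite (@perm_odd_trans (y :: x :: s ++ t)) //; last first.
- by rewrite perm_cons.
- by rewrite -(cat1s x) -(cat1s y) perm_catCA.
rewrite perm_odd_cons // IH; last by case/andP: us.
rewrite -[x :: y :: _]cat0s -[y :: x :: _]cat0s perm_odd_swap /=; last first.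
- by rewrite !inE eqxx orbT.
- by move: us; rewrite mem_cat inE => /andP [/norP [_ /norP [+ _]] _]; rewrite eq_sym.
rewrite perm_oddss // cons_uniq -(perm_uniq (_ : perm_eq (s ++ x :: t) _)); last by rewrite perm_sym.
by case/andP: us => + ->; rewrite (perm_mem pe) andbT.
Qed.

Lemma perm_odd_rem x s : uniq s -> x \in s ->
  perm_odd (x :: rem x s) s = odd (index x s).
Proof.
move=> us xs; case/splitPr: xs us => s1 s2 us.
have xs1 : x \notin s1.
  by move: us; rewrite cat_uniq /= negb_or => /and3P [_ /andP [? _] _].
have -> : rem x (s1 ++ x :: s2) = s1 ++ s2.
  by elim: s1 xs1 {us} => [|y s1 IH] /=; rewrite ?eqxx // inE eq_sym negb_or => /andP [/negbTE -> /IH ->].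
by rewrite index_pivot // perm_odd_pivot.
Qed.

(** Every letter of [s] crosses every letter of [t] once. *)
Lemma perm_odd_catC s t : uniq (s ++ t) ->
  perm_odd (s ++ t) (t ++ s) = odd (size s * size t).
Proof.
elim: s => [|x s IH] ust; first by rewrite cats0 perm_oddss.
have p1 : perm_eq (x :: t ++ s) (t ++ x :: s).
  by rewrite -cat1s -[x :: s]cat1s perm_catCA.
have u2 : uniq (t ++ x :: s) by rewrite uniq_catC.
have p2 : perm_eq (s ++ t) (t ++ s) by rewrite perm_catC.
have u3 : uniq (x :: t ++ s) by rewrite (perm_uniq p1).
have -> : perm_odd ((x :: s) ++ t) (t ++ x :: s) =
    perm_odd (x :: s ++ t) (x :: t ++ s) (+) perm_odd (x :: t ++ s) (t ++ x :: s).
  by apply: perm_odd_trans => //=; rewrite perm_cons.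
rewrite (perm_odd_pivot u2) (perm_odd_cons u3 p2) IH /=; last by case/andP: ust.
by rewrite mulSn oddD addbC.
Qed.

End PermOdd.

Lemma perm_odd_map (T T' : eqType) (h : T -> T') (s t : seq T) :
  {in t &, injective h} -> perm_eq s t -> perm_odd (map h s) (map h t) = perm_odd s t.
Proof.
move=> hi st; rewrite /perm_odd -map_comp; congr (odd (inversions _)).
apply/eq_in_map => x; rewrite (perm_mem st) => xt /=.
elim: t hi xt {st} => //= y t IH hi; rewrite inE => /predU1P [->|xt]; first by rewrite !eqxx.
rewrite (inj_in_eq hi) ?inE ?eqxx ?xt ?orbT // IH //.
by move=> a b ha hb; apply: hi; rewrite inE ?ha ?hb orbT.
Qed.

(** The index in an increasing list is an increasing function of the label. This is the passage from
    [perm_odd] to the [inversions] of raw labels that occur in the relations and in the product. *)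
Lemma perm_odd_sorted (s t : seq nat) : sorted ltn t -> {subset s <= t} ->
  perm_odd s t = odd (inversions s).
Proof.
move=> st sub; rewrite /perm_odd inversions_mono // => x y /sub xt /sub yt.
move: st; rewrite ltn_sorted_uniq_leq => /andP [ut st].
apply/idP/idP; last first.
  move=> xy; rewrite ltnNge; apply/negP => le.
  have := @sorted_leq_nth _ leq leq_trans leqnn 0 _ st (index y t) (index x t).
  by rewrite !inE !index_mem !nth_index // => /(_ yt xt le); lia.
move=> lt; have := @sorted_leq_nth _ leq leq_trans leqnn 0 _ st (index x t) (index y t).
rewrite !inE !index_mem !nth_index // => /(_ xt yt (ltnW lt)).
by rewrite leq_eqVlt => /predU1P [e|//]; rewrite e ltnn in lt.
Qed.

(** The body is that of [is_rotation], for any type with equality, so that the two are convertible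
    on words of labels. *)
Definition rotation (T : eqType) (s t : seq T) : bool := s \in [seq rot n t | n <- iota 0 (size t).+1].

Section Rotations.
Context (T : eqType).
Implicit Types (s t u : seq T) (x y : T).

Lemma rotationP s t : reflect (exists n, s = rot n t) (rotation s t).
Proof.
apply: (iffP mapP) => [[n _ ->]|[n ->]]; first by exists n.
case: (leqP n (size t)) => le; first by exists n => //; rewrite mem_iota.
by exists 0; rewrite ?mem_iota // rot_oversize ?rot0 // ltnW.
Qed.

Lemma rotation_split s t : reflect (exists a b, t = a ++ b /\ s = b ++ a) (rotation s t).
Proof.
apply: (iffP (rotationP _ _)) => [[n ->]|[a [b [-> ->]]]]; last by exists (size a); rewrite rot_size_cat.
by exists (take n t), (drop n t); rewrite cat_take_drop.
Qed.

Lemma rotation_refl s : rotation s s.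
Proof. by apply/rotationP; exists 0; rewrite rot0. Qed.

Lemma rotation_perm s t : rotation s t -> perm_eq s t.
Proof. by case/rotationP => n ->; rewrite perm_rot. Qed.

Lemma rotationC s t : rotation s t = rotation t s.
Proof.
by apply/idP/idP => /rotation_split [a [b [-> ->]]]; apply/rotation_split; exists b, a.
Qed.

Lemma rotation_trans t s u : rotation s t -> rotation t u -> rotation s u.
Proof.
move=> /rotationP [n ->] /rotationP [m ->]; apply/rotationP.
by exists (rot_add u m n); rewrite rot_rot_add.
Qed.

Lemma rotation_eqr s t u : rotation t u -> rotation s t = rotation s u.
Proof.
move=> tu; apply/idP/idP => st; first exact: rotation_trans tu.
by apply: rotation_trans st _; rewrite rotationC.
Qed.

Lemma rotation_eql s t u : rotation s t -> rotation s u = rotation t u.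
Proof. by move=> st; rewrite rotationC (rotation_eqr _ st) rotationC. Qed.

Lemma rotation_cat (a b : seq T) : rotation (b ++ a) (a ++ b).
Proof. by apply/rotation_split; exists a, b. Qed.

Lemma rotation_filter (p : pred T) s t :
  rotation s t -> rotation (filter p s) (filter p t).
Proof.
by case/rotation_split => a [b [-> ->]]; rewrite !filter_cat rotation_cat.
Qed.

(** When the letters are distinct, only the trivial rotation keeps the first one. Circular words are
    therefore compared through their representatives beginning at a common letter. *)
Lemma rotation_head x s t : uniq (x :: t) -> rotation (x :: s) (x :: t) -> s = t.
Proof.
move=> ut /rotation_split [[|y a] [b /= [e1 e2]]]; first by move: e1 e2; rewrite cats0 => <- [].
case: e1 e2 => <- e1; case: b e1 => [|z b] e1; first by rewrite e1 cats0 => -[].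
by case=> xz _; move: ut; rewrite e1 xz cons_uniq mem_cat mem_head orbT.
Qed.


(** The representative of a circular word that begins at [x]. If [x] does not occur, the index is
    [size s] and the word is left as it is. *)
Definition from x s := rot (index x s) s.

Lemma from_rotation x s : rotation (from x s) s.
Proof. by apply/rotationP; exists (index x s). Qed.

Lemma perm_from x s : perm_eq (from x s) s.
Proof. exact: rotation_perm (from_rotation x s). Qed.

Definition after x s := drop (index x s).+1 s ++ take (index x s) s.

Lemma fromE x s : x \in s -> from x s = x :: after x s.
Proof. exact: rot_index. Qed.

Lemma perm_after x s : x \in s -> perm_eq (x :: after x s) s.
Proof. by move=> xs; rewrite -fromE // perm_from. Qed.

Lemma from_eq x s t : uniq t -> x \in t -> rotation s t -> from x s = from x t.
Proof.
move=> ut xt st; have xs : x \in s by rewrite (perm_mem (rotation_perm st)).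
rewrite !fromE //; congr cons; apply: (@rotation_head x).
  by rewrite (perm_uniq (perm_after xt)).
rewrite -!fromE // (rotation_eql _ (from_rotation _ _)).
by rewrite (rotation_eqr _ (from_rotation _ _)).
Qed.

Lemma from_head x s t : uniq t -> rotation (x :: s) t -> from x t = x :: s.
Proof.
move=> ut st; have xt : x \in t by rewrite -(perm_mem (rotation_perm st)) mem_head.
by rewrite -(from_eq ut xt st) /from /= eqxx rot0.
Qed.

Lemma from_from x y s : uniq s -> x \in s -> from x (from y s) = from x s.
Proof. by move=> us xs; rewrite (from_eq us xs) // from_rotation. Qed.

End Rotations.

Lemma rotation_map (T T' : eqType) (h : T -> T') (s t : seq T) :
  rotation s t -> rotation (map h s) (map h t).
Proof.
by case/rotation_split => a [b [-> ->]]; rewrite !map_cat rotation_cat.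
Qed.

(** * Labelled graphs *)

Lemma new_label_inj (s : seq nat) : {in s &, injective (new_label s)}.
Proof. by move=> x y xs ys [] e; rewrite -(nth_index 0 xs) e nth_index. Qed.

Lemma new_label_range (s : seq nat) x : (0 < new_label s x <= size s) = (x \in s).
Proof. by rewrite /new_label /= index_mem. Qed.

Lemma map_new_label (s : seq nat) : uniq s -> map (new_label s) s = iota 1 (size s).
Proof.
move=> us; have -> : map (new_label s) s = map S [seq index x s | x <- s] by rewrite -map_comp.
by rewrite map_index_self // -[1]/(1 + 0) iotaDl.
Qed.

Lemma new_label_iota n x : 0 < x <= n -> new_label (iota 1 n) x = x.
Proof.
move=> /andP [x0 xn]; have -> : x = nth 0 (iota 1 n) x.-1 by rewrite nth_iota; lia.
by rewrite /new_label index_uniq ?iota_uniq ?size_iota ?nth_iota; lia.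
Qed.

Lemma index_map_in (T T' : eqType) (h : T -> T') (D : {pred T}) s x :
  {in D &, injective h} -> {subset s <= D} -> x \in D ->
  index (h x) (map h s) = index x s.
Proof.
move=> hi sD xD; elim: s sD => //= y s IH sD.
rewrite (inj_in_eq hi) ?IH // ?sD ?mem_head // => z zs.
by apply: sD; rewrite inE zs orbT.
Qed.

Lemma new_label_map (h : nat -> nat) (s : seq nat) (D : {pred nat}) x :
  {in D &, injective h} -> {subset s <= D} -> x \in D ->
  new_label (map h s) (h x) = new_label s x.
Proof. by move=> hi sD xD; rewrite /new_label (index_map_in hi). Qed.

Definition ends_in (V : seq nat) : pred edge :=
  fun e => (tail e \in V) && (head e \in V).
Definition edge_valence (E : seq edge) (x : nat) : nat :=
  count (fun e => tail e == x) E + count (fun e => head e == x) E.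
Definition graph_ok (W I : seq nat) (E : seq edge) : bool :=
  [&& all (ends_in (W ++ I)) E, all (fun e => flipped e ==> is_loop e) E,
      all (fun x => 0 < edge_valence E x) W
    & all (fun x => 3 <= edge_valence E x) I].
Definition lgraph (W I : seq nat) (E : seq edge) : bool :=
  uniq (W ++ I) && graph_ok W I E.
Definition degen (I : seq nat) (E : seq edge) : bool :=
  ~~ uniq [seq ends e | e <- E] || has (fun e => is_loop e && (tail e \in I)) E.

(* The vertices of W, I and E carry arbitrary distinct labels, W listing the
   external ones in the order of the circle; std replaces each label by its
   position in W ++ I. *)
Definition std (W I : seq nat) (E : seq edge) : predgraph :=
  PreDGraph (size W) (size I) (map (map_ends (new_label (W ++ I))) E).

(** Equality of [ends], expressed without the order of the labels, so that it is visibly invariant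
    under injective relabelling. Two loops at one vertex are parallel. *)
Definition parallel (e f : edge) : bool :=
  ((tail e == tail f) && (head e == head f))
  || ((tail e == head f) && (head e == tail f)).

Lemma ends_eq e f : (ends e == ends f) = parallel e f.
Proof.
rewrite /ends /parallel xpair_eqE; apply/idP/idP; first lia.
by case/orP => /andP [/eqP -> /eqP ->]; rewrite ?eqxx // minnC maxnC !eqxx.
Qed.

Lemma tail_map_ends f e : tail (map_ends f e) = f (tail e). Proof. by []. Qed.
Lemma head_map_ends f e : head (map_ends f e) = f (head e). Proof. by []. Qed.
Lemma flipped_map_ends f e : flipped (map_ends f e) = flipped e. Proof. by []. Qed.

Lemma edge_eta e : e = (tail e, head e, flipped e).
Proof. by case: e => [[]]. Qed.

Lemma map_ends_comp f g e : map_ends f (map_ends g e) = map_ends (f \o g) e.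
Proof. by []. Qed.

Lemma par_map (V : seq nat) h e f : {in V &, injective h} ->
  ends_in V e -> ends_in V f -> parallel (map_ends h e) (map_ends h f) = parallel e f.
Proof.
move=> hi /andP [te he] /andP [tf hf].
by rewrite /parallel !tail_map_ends !head_map_ends !(inj_in_eq hi).
Qed.

Lemma is_loop_map (V : seq nat) h e : {in V &, injective h} ->
  ends_in V e -> is_loop (map_ends h e) = is_loop e.
Proof. by move=> hi /andP [te he]; rewrite /is_loop !(inj_in_eq hi). Qed.

Lemma uniq_ends_map (V : seq nat) h E : {in V &, injective h} ->
  all (ends_in V) E ->
  uniq [seq ends e | e <- map (map_ends h) E] = uniq [seq ends e | e <- E].
Proof.
move=> hi; elim: E => //= e E IH /andP [eV EV]; rewrite IH //; congr (~~ _ && _).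
apply/mapP/mapP => [[_ /mapP [f fE ->] /eqP]|[f fE /eqP]].
  rewrite ends_eq (par_map hi eV (allP EV _ fE)) => p.
  by exists f => //; apply/eqP; rewrite ends_eq.
rewrite ends_eq -(par_map hi eV (allP EV _ fE)) => p.
by exists (map_ends h f); [apply: map_f|apply/eqP; rewrite ends_eq].
Qed.

Lemma edge_valence_map (V : seq nat) h E x : {in V &, injective h} ->
  all (ends_in V) E -> x \in V ->
  edge_valence (map (map_ends h) E) (h x) = edge_valence E x.
Proof.
move=> hi EV xV; rewrite /edge_valence !count_map.
by congr (_ + _); apply: eq_in_count => e /(allP EV) /andP [te he] /=;
   rewrite (inj_in_eq hi).
Qed.

Lemma std_vertices W I : uniq (W ++ I) ->
  map (new_label (W ++ I)) W = iota 1 (size W) /\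
  map (new_label (W ++ I)) I = iota (size W).+1 (size I).
Proof.
move=> uV; have /eqP := map_new_label uV.
by rewrite map_cat size_cat iotaD eqseq_cat ?size_map ?size_iota // => /andP [/eqP -> /eqP ->].
Qed.

Lemma is_graph_std W I E : uniq (W ++ I) ->
  is_graph (std W I E) = graph_ok W I E.
Proof.
move=> uV; have [mW mI] := std_vertices uV; have hi := @new_label_inj (W ++ I).
have e1 : all (fun e => [&& 0 < tail e <= nvert (std W I E), 0 < head e <= nvert (std W I E)
     & flipped e ==> is_loop e]) (edges (std W I E)) =
   all (ends_in (W ++ I)) E && all (fun e => flipped e ==> is_loop e) E.
  rewrite -all_predI all_map /nvert; apply: eq_all => e.
  pose L := new_label (W ++ I); rewrite -[LHS]/([&& 0 < L (tail e) <= size W + size I,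
    0 < L (head e) <= size W + size I & flipped e ==> is_loop (map_ends L e)]).
  rewrite [RHS]/= -size_cat /L /ends_in !new_label_range; case: (boolP (tail e \in _)) => //= te.
  by case: (boolP (head e \in _)) => //= he; rewrite /is_loop (inj_in_eq hi).
rewrite /is_graph e1 /graph_ok -andbA; case: (boolP (all (ends_in _) E)) => //= EV.
congr [&& _, _ & _]; rewrite /ext_vertices /int_vertices /= -?mW -?mI all_map;
  by apply: eq_in_all => x xV /=; rewrite /valence /= -/(edge_valence _ _) (edge_valence_map hi) // mem_cat xV ?orbT.
Qed.

Lemma degenerate_std W I E : uniq (W ++ I) -> all (ends_in (W ++ I)) E ->
  degenerate (std W I E) = degen I E.
Proof.
move=> uV EV; have [mW mI] := std_vertices uV; have hi := @new_label_inj (W ++ I).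
rewrite /degenerate /degen (uniq_ends_map hi) //=; congr (_ || _).
rewrite has_map; apply: eq_in_has => e /(allP EV) eV /=; rewrite (is_loop_map hi) //.
congr (_ && _); rewrite /is_internal /int_vertices /= -mI.
apply/mapP/idP => [[x xI /hi ->] //|eI]; last by exists (tail e).
  by case/andP: eV.
by rewrite mem_cat xI orbT.
Qed.

Lemma std_map (h : nat -> nat) W I E : {in W ++ I &, injective h} ->
  all (ends_in (W ++ I)) E ->
  std (map h W) (map h I) (map (map_ends h) E) = std W I E.
Proof.
move=> hi EV; rewrite /std !size_map -map_comp; congr PreDGraph.
apply/eq_in_map => e /(allP EV) /andP [te he] /=.
by rewrite map_ends_comp /map_ends /= -map_cat !(new_label_map hi).
Qed.

Lemma std_self g : is_graph g ->
  std (ext_vertices g) (int_vertices g) (edges g) = g.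
Proof.
case: g => n m E /and3P [/allP gE _ _]; rewrite /std !size_iota /=; congr PreDGraph.
rewrite -[RHS]map_id; apply/eq_in_map => e /gE /and3P [te he _] /=.
by rewrite /ext_vertices /int_vertices -[_.+1]add1n -iotaD /map_ends !new_label_iota // -edge_eta.
Qed.

Lemma lgraph_self g : is_graph g ->
  lgraph (ext_vertices g) (int_vertices g) (edges g).
Proof.
move=> gg; have uV : uniq (ext_vertices g ++ int_vertices g).
  by rewrite /ext_vertices /int_vertices -[(vext g).+1]add1n -iotaD iota_uniq.
by rewrite /lgraph uV -is_graph_std // std_self.
Qed.

(** Positions of the rearranged labels are exactly the list expected by [relabel]: renumbering
    vertices amounts to listing the same labels in another order. *)
Lemma relabel_std W I E W' I' : perm_eq (W' ++ I') (W ++ I) ->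
  size W' = size W -> size I' = size I -> all (ends_in (W ++ I)) E ->
  relabel (map (new_label (W ++ I)) (W' ++ I')) (std W I E) = std W' I' E.
Proof.
move=> pV sW sI EV; rewrite /std /relabel /= sW sI -map_comp; congr PreDGraph.
apply/eq_in_map => e /(allP EV) /andP [te he] /=; rewrite map_ends_comp /map_ends /=.
by rewrite !(@new_label_map _ _ [in W ++ I]) //; try exact: new_label_inj; move=> x; rewrite (perm_mem pV).
Qed.

Lemma all_ends_perm V V' E : perm_eq V V' -> all (ends_in V) E = all (ends_in V') E.
Proof. by move=> p; apply: eq_all => e; rewrite /ends_in !(perm_mem p). Qed.

Lemma edge_valence_perm E E' x : perm_eq E E' -> edge_valence E x = edge_valence E' x.
Proof. by move=> p; rewrite /edge_valence !(permP p). Qed.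

Lemma lgraph_perm W I E W' I' E' : perm_eq W W' -> perm_eq I I' ->
  perm_eq E E' -> lgraph W I E = lgraph W' I' E'.
Proof.
move=> pW pI pE; have pV : perm_eq (W ++ I) (W' ++ I') by apply: perm_cat.
rewrite /lgraph (perm_uniq pV) /graph_ok (all_ends_perm _ pV) !(perm_all _ pE).
rewrite (perm_all _ pW) (perm_all _ pI).
by congr [&& _, _, _, _ & _]; apply: eq_all => x; rewrite (edge_valence_perm _ pE).
Qed.

Lemma degen_perm I E I' E' : perm_eq I I' -> perm_eq E E' -> degen I E = degen I' E'.
Proof.
move=> pI pE; rewrite /degen (perm_uniq (perm_map _ pE)) (perm_has _ pE).
by congr (_ || _); apply: eq_has => e; rewrite (perm_mem pI).
Qed.

Lemma ends_reverse e : ends (reverse e) = ends e.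
Proof. by rewrite /ends minnC maxnC. Qed.

Lemma is_loop_reverse e : is_loop (reverse e) = is_loop e.
Proof. by rewrite /is_loop eq_sym. Qed.

Lemma degen_reverse I E1 E2 e :
  degen I (E1 ++ reverse e :: E2) = degen I (E1 ++ e :: E2).
Proof.
rewrite /degen !map_cat /= ends_reverse !has_cat /= is_loop_reverse.
by rewrite /is_loop /=; case: eqVneq => //= ->.
Qed.

Lemma lgraph_reverse W I E1 E2 e :
  lgraph W I (E1 ++ e :: E2) -> lgraph W I (E1 ++ reverse e :: E2).
Proof.
rewrite /lgraph /graph_ok !all_cat /=.
have v x : edge_valence (E1 ++ reverse e :: E2) x = edge_valence (E1 ++ e :: E2) x.
  by rewrite /edge_valence !count_cat /= /reverse /tail /head /=; lia.
case/and5P => -> /and3P [-> /andP [h1 h2] ->] /and3P [-> fe ->] a1 a2 /=.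
rewrite /ends_in /= h1 h2 /= is_loop_reverse {1}/flipped /=.
rewrite (eq_all (a2 := fun x => 0 < edge_valence (E1 ++ e :: E2) x)) //=; last by move=> x; rewrite v.
rewrite a1 (eq_all (a2 := fun x => 2 < edge_valence (E1 ++ e :: E2) x)) ?a2; last by move=> x; rewrite v.
by case: (is_loop e); rewrite ?andbT ?implybT.
Qed.

Local Open Scope ring_scope.

(** * Alternating functions of graphs *)

Section LinearHelpers.
Context (R : nzRingType) (V W : lmodType R) (G : V -> Prop) (f : {linear V -> W}).

Lemma quot_lift_pi v : (forall u, G u -> f u = 0) ->
  quot_lift f (quot_pi G v) = f v.
Proof.
move=> fG; rewrite /quot_lift; case: asboolP => // _.
apply/eqP; rewrite -subr_eq0 -linearB; apply/eqP.
have /spanP [s [Gs ->]] : quot_repr (quot_pi G v) - v \in span G.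
  by apply/quot_piP; rewrite quot_reprK.
rewrite linear_sum big_seq big1 // => z /Gs /fG fz.
by rewrite linearZ /= fz scaler0.
Qed.
End LinearHelpers.

Lemma lextend1 (R : nzRingType) (K : choiceType) (W : lmodType R) (f : K -> W) (k : K) :
  lextend f << k >> = f k.
Proof.
rewrite (@lextendEw R K W f [fset k]%fset << k >>); last exact: msuppU_le.
by rewrite big_seq_fset1 mcoeffUU scale1r.
Qed.

Lemma lextend_gen (R : realType) (W : lmodType R) (F : predgraph -> W) g :
  is_graph g -> lextend (fun h : dgraph => F (val h)) (gen R g) = F g.
Proof. by move=> gg; rewrite /gen insubT lextend1. Qed.

Section Signs.
Context (R : realType).

Definition bsgn (b : bool) : R := (-1) ^+ b.

Lemma bsgnM a b : bsgn a * bsgn b = bsgn (a (+) b).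
Proof. by rewrite /bsgn signr_addb. Qed.

Lemma sgn_bsgn n : sgn R n = bsgn (odd n).
Proof. by rewrite /sgn /bsgn signr_odd. Qed.

Lemma bsgn0 : bsgn false = 1. Proof. by rewrite /bsgn expr0. Qed.
Lemma bsgn1 : bsgn true = -1. Proof. by rewrite /bsgn expr1. Qed.

Lemma bsgnZ (V : lmodType R) a b (x : V) : bsgn a *: (bsgn b *: x) = bsgn (a (+) b) *: x.
Proof. by rewrite scalerA bsgnM. Qed.

Lemma bsgnN (V : lmodType R) a (x : V) : bsgn (~~ a) *: x = - (bsgn a *: x).
Proof. by case: a; rewrite /= !(bsgn0, bsgn1) ?scaleN1r ?scale1r ?opprK. Qed.

(** Twice [x] is 0 and 2 is invertible in [R]. This is what kills antisymmetric double sums. *)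
Lemma opp_fixed0 (V : lmodType R) (x : V) : x = - x -> x = 0.
Proof.
move=> e; have /eqP : (2%:R : R) *: x = 0.
  by rewrite scaler_nat mulr2n {1}e addNr.
by rewrite scaler_eq0 Num.Theory.pnatr_eq0 => /eqP.
Qed.

End Signs.

Section Alternating.
Context (R : realType) (c : parity).

(** The clause on edges is restricted to non-degenerate graphs because [perm_odd] is a sign only for
    lists without repetition; [alt_degen] takes care of the others. *)
Record alternating (M : lmodType R) (F : predgraph -> M) : Prop := Alternating {
  alt_rot : forall W I E W', lgraph W I E -> rotation W' W ->
    F (std W' I E) = bsgn R (perm_odd W' W) *: F (std W I E);
  alt_int : forall W I E I', lgraph W I E -> perm_eq I' I ->
    F (std W I' E) = bsgn R (is_odd c && perm_odd I' I) *: F (std W I E);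
  alt_edge : forall W I E E', lgraph W I E -> ~~ degen I E -> perm_eq E' E ->
    F (std W I E') = bsgn R (is_even c && perm_odd E' E) *: F (std W I E);
  alt_rev : forall W I E1 e E2, lgraph W I (E1 ++ e :: E2) ->
    F (std W I (E1 ++ reverse e :: E2)) = bsgn R (is_odd c) *: F (std W I (E1 ++ e :: E2));
  alt_degen : forall W I E, lgraph W I E -> degen I E -> F (std W I E) = 0 }.

Lemma lgraph_uniq W I E : lgraph W I E -> uniq (W ++ I).
Proof. by case/andP. Qed.

Lemma lgraph_ends W I E : lgraph W I E -> all (ends_in (W ++ I)) E.
Proof. by case/andP => _ /and4P []. Qed.

Lemma lgraph_std W I E : lgraph W I E -> is_graph (std W I E).
Proof. by case/andP => uV ok; rewrite is_graph_std. Qed.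

Lemma sorted_ext_int g : sorted ltn (ext_vertices g ++ int_vertices g).
Proof.
by rewrite /ext_vertices /int_vertices -[(vext g).+1]add1n -iotaD iota_ltn_sorted.
Qed.

Lemma uniq_ext_int g : uniq (ext_vertices g ++ int_vertices g).
Proof. by have := sorted_ext_int g; rewrite ltn_sorted_uniq_leq => /andP []. Qed.

Lemma degen_uniq I E : ~~ degen I E -> uniq E.
Proof. by case/norP; rewrite negbK => /map_uniq. Qed.

Lemma relabel_self g s t : is_graph g -> perm_eq s (ext_vertices g) ->
  perm_eq t (int_vertices g) -> relabel (s ++ t) g = std s t (edges g).
Proof.
move=> gg ps pt; have := @relabel_std (ext_vertices g) (int_vertices g) (edges g) s t.
rewrite std_self // => <- //; try by rewrite ?(perm_size ps) ?(perm_size pt).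
- congr relabel; rewrite -[LHS]map_id; apply/eq_in_map => x.
  rewrite !mem_cat (perm_mem ps) (perm_mem pt) !mem_iota => hx.
  rewrite /ext_vertices /int_vertices -[(vext g).+1]add1n -iotaD new_label_iota //.
  by move: hx; lia.
- by apply: perm_cat.
- exact: lgraph_ends (lgraph_self gg).
Qed.

Lemma set_edges_std g E : is_graph g -> all (ends_in (ext_vertices g ++ int_vertices g)) E ->
  set_edges g E = std (ext_vertices g) (int_vertices g) E.
Proof.
case: g => n m E0 gg /allP EV; rewrite /std /set_edges !size_iota /=; congr PreDGraph.
rewrite -[LHS]map_id; apply/eq_in_map => e /EV.
rewrite /ext_vertices /int_vertices -[_.+1]add1n /= -iotaD /ends_in !mem_iota => /andP [te he].
by rewrite /map_ends !new_label_iota -?edge_eta //; lia.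
Qed.

Lemma sgn_mulb (b : bool) n : sgn R (b * n) = bsgn R (b && odd n).
Proof. by rewrite sgn_bsgn oddM; case: b. Qed.

Lemma lextendBZ (K : choiceType) (M : lmodType R) (f : K -> M) u a v :
  lextend f (u - a *: v) = lextend f u - a *: lextend f v.
Proof. by rewrite linearB linearZ. Qed.

(** Each generator of [graph_rel] is the difference of the two sides of one clause of [alternating],
    read on the canonical labels. *)
Lemma alternating_kills (M : lmodType R) (F : predgraph -> M) : alternating F ->
  forall v, graph_rel c v -> lextend (fun g : dgraph => F (val g)) v = 0.
Proof.
case=> rotF intF edgeF revF degF v; case=> {v} [g n s|g s ps|g s ps|g es1 es2 e eg|g dg];
  pose W := ext_vertices (val g); pose I := int_vertices (val g);
  have gg := valP g; have lg := lgraph_self gg; have Fg := lextend_gen F gg;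
  rewrite ?lextendBZ ?Fg.
- have rs : rotation s W by apply/rotationP; exists n.
  rewrite relabel_self ?(rotation_perm rs) // (lextend_gen F); last first.
    by rewrite lgraph_std // (lgraph_perm (rotation_perm rs) (perm_refl _) (perm_refl _)).
  rewrite (rotF W I) // std_self // sgn_bsgn perm_odd_sorted ?subrr ?iota_ltn_sorted //.
  by move=> x; rewrite (perm_mem (rotation_perm rs)).
- rewrite relabel_self // (lextend_gen F); last first.
    by rewrite lgraph_std // (lgraph_perm (perm_refl _) ps (perm_refl _)).
  rewrite (intF W I) // std_self // sgn_mulb perm_odd_sorted ?subrr ?iota_ltn_sorted //.
  by move=> x; rewrite (perm_mem ps).
- set E := edges (val g); set E' := map _ s; have pE : perm_eq E' E.
    by apply: perm_trans (perm_map _ ps) _; rewrite map_nth_iota0 // take_size.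
  have lg' : lgraph W I E' by rewrite (lgraph_perm (perm_refl _) (perm_refl _) pE).
  rewrite set_edges_std // ?lgraph_ends // (lextend_gen F) ?lgraph_std //.
  (* With repeated edges there is no sign to compare, but then both graphs are degenerate and both
     values are 0. *)
  have [dE|dE] := boolP (degen I E).
    have dE' : degen I E' by rewrite (degen_perm (perm_refl _) pE).
    have F0 : F (val g) = 0 by rewrite -(std_self gg) degF.
    by rewrite F0 (degF W I E') // scaler0 subrr.
  rewrite (edgeF W I E) // std_self // sgn_mulb /perm_odd /E' -map_comp.
  (* As the edges are distinct, the position of the [k]-th edge is [k], so the list of positions is
     [s] itself. *)
  set s' := map _ s; have -> : s' = s; last by rewrite subrr.
  rewrite -[RHS]map_id; apply/eq_in_map => k; rewrite (perm_mem ps) mem_iota /= add0n => lt.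
  by rewrite index_uniq // (degen_uniq dE).
- have lg' := lg; rewrite eg in lg'; have lg2 := lgraph_reverse lg'.
  rewrite set_edges_std // ?lgraph_ends // (lextend_gen F) ?lgraph_std //.
  rewrite revF // -eg std_self // sgn_bsgn; case: (is_odd c); by rewrite subrr.
- by rewrite -(std_self gg) degF.
Qed.

Lemma cls_not_graph g : ~~ is_graph g -> cls R c g = 0.
Proof. by move=> ng; rewrite /cls /gen insubF ?linear0 //; apply: negbTE. Qed.

Lemma cls_rel g h a : graph_rel c (gen R g - a *: gen R h) -> cls R c g = a *: cls R c h.
Proof.
move=> r; rewrite /cls -linearZ; apply/quot_piP/spanP.
exists [:: (1, gen R g - a *: gen R h)]; rewrite big_seq1 scale1r; split => // x.
by rewrite inE => /eqP ->.
Qed.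

Lemma cls_rel0 g : graph_rel c (gen R g) -> cls R c g = 0.
Proof.
move=> r; rewrite /cls -(linear0 (quot_pi (graph_rel c))); apply/quot_piP/spanP.
exists [:: (1, gen R g)]; rewrite big_seq1 scale1r subr0; split => // x.
by rewrite inE => /eqP ->.
Qed.

Lemma inversions_label V s : inversions (map (new_label V) s) = inversions [seq index x V | x <- s].
Proof.
have -> : map (new_label V) s = map S [seq index x V | x <- s] by rewrite -map_comp.
by rewrite inversions_mono.
Qed.

Lemma inversions_label_cat (V : seq nat) (s t : seq nat) : uniq (s ++ t) ->
  (forall x, x \in V -> x \in t) ->
  odd (inversions (map (new_label (s ++ t)) V)) = perm_odd V t.
Proof.
move=> us Vt; rewrite inversions_label /perm_odd.
have -> : [seq index x (s ++ t) | x <- V] = map (addn (size s)) [seq index x t | x <- V].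
  rewrite -map_comp; apply/eq_in_map => x /Vt xt /=; rewrite index_cat ifN //.
  by apply: contraL xt => xs; apply/negP => xt; move: us; rewrite cat_uniq => /and3P [_ /hasPn /(_ _ xt) /negP].
by rewrite inversions_mono // => x y _ _; rewrite ltn_add2l.
Qed.

(** Each clause is one of the relations, applied to [std W I E]. Together with [alternating_kills],
    this makes [cls] the universal alternating function. *)
Lemma cls_alternating : alternating (cls R c).
Proof.
split.
- move=> W I E W' lg rW; have gg := lgraph_std lg; have pW := rotation_perm rW.
  have uV := lgraph_uniq lg; case/rotationP: rW => n eW.
  have [mW mI] := std_vertices uV.
  have := @RelExternal R c (Sub _ gg) n; rewrite SubK /= /ext_vertices /int_vertices /=.
  rewrite -mW -mI -map_rot -map_cat -eW relabel_std ?(perm_size pW) ?perm_cat ?lgraph_ends //.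
  move/cls_rel ->; rewrite sgn_bsgn.
  have uW : uniq W by move: uV; rewrite cat_uniq => /andP [].
  congr (bsgn R _ *: _); rewrite inversions_label /perm_odd; congr (odd (inversions _)).
  by apply/eq_in_map => x; rewrite (perm_mem pW) => xW; rewrite index_cat xW.
- move=> W I E I' lg pI; have gg := lgraph_std lg.
  have uV := lgraph_uniq lg; have [mW mI] := std_vertices uV.
  have := @RelInternal R c (Sub _ gg) (map (new_label (W ++ I)) I').
  rewrite SubK /= /ext_vertices /int_vertices /=.
  rewrite -mW -mI -map_cat relabel_std ?(perm_size pI) ?perm_cat ?lgraph_ends //.
  move/(_ (perm_map _ pI)) /cls_rel ->; rewrite sgn_mulb inversions_label_cat //.
  by move=> x; rewrite (perm_mem pI).
- move=> W I E E' lg dE pE; have gg := lgraph_std lg.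
  have uE := degen_uniq dE.
  have := @RelEdges R c (Sub _ gg) [seq index e E | e <- E'].
  rewrite SubK /= /nedge /= size_map -map_index_self // => /(_ (perm_map _ pE)).
  set g' := set_edges _ _; have -> : g' = std W I E'.
    rewrite /g' /set_edges /std /=; congr PreDGraph; rewrite -map_comp; apply/eq_in_map => e.
    by rewrite (perm_mem pE) => eE /=; rewrite (nth_map no_edge) ?index_mem // nth_index.
  by move/cls_rel ->; rewrite sgn_mulb.
- move=> W I E1 e E2 lg; have gg := lgraph_std lg.
  pose L := map_ends (new_label (W ++ I)).
  have := @RelOrientation R c (Sub _ gg) (map L E1) (map L E2) (L e).
  rewrite SubK /= map_cat => /(_ erefl).
  have eV : ends_in (W ++ I) e by move: (lgraph_ends lg); rewrite all_cat /= => /and3P [].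
  have Lr : reverse (L e) = L (reverse e).
    by rewrite /L /reverse (is_loop_map (@new_label_inj _) eV).
  have -> : set_edges (std W I (E1 ++ e :: E2)) (map L E1 ++ reverse (L e) :: map L E2)
    = std W I (E1 ++ reverse e :: E2) by rewrite /set_edges /std !map_cat /= Lr.
  by move/cls_rel ->; rewrite sgn_bsgn; case: (is_odd c).
- move=> W I E lg dE; have gg := lgraph_std lg.
  apply: cls_rel0; apply: (@RelDegenerate R c (Sub _ gg)); rewrite SubK degenerate_std //.
    exact: lgraph_uniq lg.
  exact: lgraph_ends lg.
Qed.

Definition induced (M : lmodType R) (F : predgraph -> M) : graph_complex R c -> M :=
  @quot_lift _ _ (@graph_rel R c) _ (lextend (fun g : dgraph => F (val g))).
HB.instance Definition _ (M : lmodType R) (F : predgraph -> M) := GRing.Linear.on (@induced M F).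

Lemma induced_cls (M : lmodType R) (F : predgraph -> M) g : alternating F ->
  is_graph g -> induced F (cls R c g) = F g.
Proof.
move=> aF gg; rewrite /induced /cls quot_lift_pi; last exact: alternating_kills.
exact: lextend_gen.
Qed.

Definition graph_cls W I E : graph_complex R c := cls R c (std W I E).

(** By the default value of [gen]. It extends the clauses of [cls_alternating] to all lists with
    distinct vertices: outside graphs both sides are 0. *)
Lemma cl_not_lgraph W I E : uniq (W ++ I) -> ~~ lgraph W I E -> graph_cls W I E = 0.
Proof. by rewrite /lgraph => uV; rewrite uV /= -is_graph_std //; apply: cls_not_graph. Qed.

Lemma cl_rot W I E W' : uniq (W ++ I) -> rotation W' W ->
  graph_cls W' I E = bsgn R (perm_odd W' W) *: graph_cls W I E.
Proof.
move=> uV rW; have [lg|nlg] := boolP (lgraph W I E); first exact: (alt_rot cls_alternating).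
have pW := rotation_perm rW.
rewrite !cl_not_lgraph ?scaler0 ?(lgraph_perm pW (perm_refl _) (perm_refl _)) //.
by rewrite (perm_uniq (perm_cat pW (perm_refl _))).
Qed.

Lemma cl_int W I E I' : uniq (W ++ I) -> perm_eq I' I ->
  graph_cls W I' E = bsgn R (is_odd c && perm_odd I' I) *: graph_cls W I E.
Proof.
move=> uV pI; have [lg|nlg] := boolP (lgraph W I E); first exact: (alt_int cls_alternating).
rewrite !cl_not_lgraph ?scaler0 ?(lgraph_perm (perm_refl _) pI (perm_refl _)) //.
by rewrite (perm_uniq (perm_cat (perm_refl _) pI)).
Qed.

Lemma cl_degen W I E : uniq (W ++ I) -> degen I E -> graph_cls W I E = 0.
Proof.
move=> uV dE; have [lg|nlg] := boolP (lgraph W I E); last exact: cl_not_lgraph.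
exact: (alt_degen cls_alternating).
Qed.

Lemma cl_edge W I E E' : uniq (W ++ I) -> perm_eq E' E ->
  graph_cls W I E' = bsgn R (is_even c && perm_odd E' E) *: graph_cls W I E.
Proof.
move=> uV pE; have [dE|dE] := boolP (degen I E).
  by rewrite !cl_degen ?scaler0 // (degen_perm (perm_refl _) pE).
have [lg|nlg] := boolP (lgraph W I E); first exact: (alt_edge cls_alternating).
by rewrite !cl_not_lgraph ?scaler0 ?(lgraph_perm (perm_refl _) (perm_refl _) pE).
Qed.

(** [reverse] resets the bit of an edge that is not a loop, so it is an involution only on edges
    whose bit is set for loops alone. *)
Lemma reverseK e : (flipped e ==> is_loop e) -> reverse (reverse e) = e.
Proof.
case: e => [[a b] f]; rewrite /reverse /is_loop /tail /head /flipped /= [b == a]eq_sym.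
by case: (a == b); case: f.
Qed.

Lemma cl_rev W I E1 e E2 : uniq (W ++ I) -> flipped e ==> is_loop e ->
  graph_cls W I (E1 ++ reverse e :: E2) = bsgn R (is_odd c) *: graph_cls W I (E1 ++ e :: E2).
Proof.
move=> uV fe; have [lg|nlg] := boolP (lgraph W I (E1 ++ e :: E2)).
  exact: (alt_rev cls_alternating).
rewrite !cl_not_lgraph ?scaler0 //; apply: contra nlg => /lgraph_reverse.
by rewrite reverseK.
Qed.

Lemma cl_map (h : nat -> nat) W I E : {in W ++ I &, injective h} ->
  all (ends_in (W ++ I)) E ->
  graph_cls (map h W) (map h I) (map (map_ends h) E) = graph_cls W I E.
Proof. by move=> hi EV; rewrite /graph_cls std_map. Qed.

End Alternating.

(** * Contractions of labelled graphs *)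

Section Contractions.
Local Open Scope nat_scope.

Definition subst (a t x : nat) : nat := if x == a then t else x.
Definition contract (a t : nat) (E : seq edge) : seq edge := map (map_ends (subst a t)) E.
Definition joins (x y : nat) (e : edge) : bool :=
  ((tail e, head e) == (x, y)) || ((tail e, head e) == (y, x)).
(** Labelled form of [contract_arc] for the arc from [x] to [y]: the name [x] survives. For a new
    loop the first half-edge is the one that was at [x], so the bit is set when the edge started at
    [y]. *)
Definition merge_ends (x y : nat) (e : edge) : edge :=
  if joins x y e then (x, x, tail e == y) else map_ends (subst y x) e.

Lemma joinsP x y e : reflect ((tail e = x /\ head e = y) \/ (tail e = y /\ head e = x)) (joins x y e).
Proof.
rewrite /joins !xpair_eqE; apply: (iffP orP).
  by case=> /andP [/eqP -> /eqP ->]; [left|right].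
by case=> -[-> ->]; [left|right]; rewrite !eqxx.
Qed.

Lemma tail_merge x y e : tail (merge_ends x y e) = subst y x (tail e).
Proof.
rewrite /merge_ends /subst; case: joinsP => // -[] [-> _]; rewrite ?eqxx /=; first by case: (x == y).
by [].
Qed.

Lemma head_merge x y e : head (merge_ends x y e) = subst y x (head e).
Proof.
rewrite /merge_ends /subst; case: joinsP => // -[] [_ ->]; rewrite ?eqxx /=; last by case: (x == y).
by [].
Qed.

Lemma edge_valence_ctr a t E z : z != a ->
  edge_valence (contract a t E) z = edge_valence E z + (z == t) * edge_valence E a.
Proof.
move=> za; rewrite /edge_valence; elim: E => [|e E IH] /=; first by rewrite muln0.
rewrite !(mulnDr, mulnA) /= in IH *.
have s y : (subst a t y == z) = (y == z) + (z == t) * (y == a) :> nat.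
  rewrite /subst; have [->|ya] := eqVneq y a; rewrite ?muln1 ?muln0 ?addn0 //.
  by rewrite [a == z]eq_sym (negbTE za) eq_sym.
by rewrite tail_map_ends head_map_ends !s; lia.
Qed.

Lemma edge_valence_ends E E' z : map tail E = map tail E' -> map head E = map head E' ->
  edge_valence E z = edge_valence E' z.
Proof.
move=> et eh; rewrite /edge_valence -(count_map tail (pred1 z)) et count_map.
by rewrite -(count_map head (pred1 z)) eh count_map.
Qed.

Lemma edge_valence_merge x y E z :
  edge_valence (map (merge_ends x y) E) z = edge_valence (contract y x E) z.
Proof.
by apply: edge_valence_ends; rewrite -!map_comp; apply: eq_map => e /=;
  rewrite ?tail_merge ?head_merge.
Qed.

Lemma subst_in a t x V V' : perm_eq V (a :: V') -> t \in V' ->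
  x \in V -> subst a t x \in V'.
Proof.
by move=> pV tV; rewrite (perm_mem pV) inE /subst; case: eqP.
Qed.

Lemma ends_in_perm V V' e : perm_eq V V' -> ends_in V e = ends_in V' e.
Proof. by move=> p; rewrite /ends_in !(perm_mem p). Qed.

(* r tells that e is oriented towards a. *)
Definition oriented (r : bool) (a t : nat) (e : edge) : bool :=
  (tail e == if r then t else a) && (head e == if r then a else t).

Lemma oriented_valence r a t e E z : oriented r a t e ->
  edge_valence (e :: E) z = (z == a) + (z == t) + edge_valence E z.
Proof.
rewrite /edge_valence /= => /andP [/eqP -> /eqP ->].
by rewrite ![_ == z]eq_sym; case: r; lia.
Qed.

(** The vertex [t] loses one half-edge with [e] and inherits the other half-edges of [a], at least
    two in number because [a] is internal. All other valences are unchanged. *)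
Lemma lgraph_ctr W I a t r e E : lgraph W (a :: I) (e :: E) ->
  oriented r a t e -> a != t -> lgraph W I (contract a t E).
Proof.
case/andP => uV /and4P [EV fl vW vI] oe at_.
have pV : perm_eq (W ++ a :: I) (a :: W ++ I) by rewrite -cat1s perm_catCA.
have uV' : uniq (a :: W ++ I) by rewrite -(perm_uniq pV).
have tV : t \in W ++ I.
  move: EV oe; rewrite /= (ends_in_perm _ pV) /oriented /ends_in !inE => /andP [/andP [te he] _].
  by case/andP => /eqP et /eqP eh; move: te he; rewrite et eh; case: r {et eh}; rewrite eqxx eq_sym (negbTE at_).
have vz z : z \in W ++ I -> edge_valence (e :: E) z <= edge_valence (contract a t E) z + (z == t).
  move=> zV; have za : z != a by apply: contraNneq (proj1 (andP uV')) => <-.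
  by rewrite (oriented_valence _ _ oe) edge_valence_ctr // (negbTE za); clear; lia.
have vt : t \in W ++ I -> edge_valence (e :: E) t + edge_valence (e :: E) a <= edge_valence (contract a t E) t + 2.
  by rewrite eq_sym in at_; rewrite !(oriented_valence _ _ oe) edge_valence_ctr // eqxx (negbTE at_) eq_sym (negbTE at_); clear; lia.
have va : 3 <= edge_valence (e :: E) a by case/andP: vI.
have le_ctr z : z \in W ++ I -> edge_valence (e :: E) z <= edge_valence (contract a t E) z.
  move=> zV; have [->|zt] := eqVneq z t; first by move: (vt tV) va; clear; lia.
  by move: (vz z zV); rewrite (negbTE zt) addn0.
apply/andP; split; first by case/andP: uV'.
apply/and4P; split.
- apply/allP => _ /mapP [f fE ->]; move/allP: EV => /(_ f); rewrite inE fE orbT => /(_ isT) /andP [tf hf].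
  by rewrite /ends_in !(subst_in pV).
- apply/allP => _ /mapP [f fE ->]; move/allP: fl => /(_ f); rewrite inE fE orbT => /(_ isT).
  rewrite flipped_map_ends; case: (flipped f) => //= /eqP e1.
  by rewrite /is_loop tail_map_ends head_map_ends e1.
- apply/allP => z zW; apply: leq_trans (allP vW z zW) (le_ctr z _).
  by rewrite mem_cat zW.
- apply/allP => z zI; apply: leq_trans (allP vI z _) (le_ctr z _); first by rewrite inE zI orbT.
  by rewrite mem_cat zI orbT.
Qed.

(** No edge disappears, and the merged vertex collects the half-edges of both, so no valence
    decreases. *)
Lemma lgraph_merge x y W I E : lgraph (x :: y :: W) I E ->
  lgraph (x :: W) I (map (merge_ends x y) E).
Proof.
case/andP => uV /and4P [EV fl vW vI].
have pV : perm_eq ((x :: y :: W) ++ I) (y :: (x :: W) ++ I).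
  by rewrite /= -(cat1s x) -(cat1s y) perm_catCA.
have uV' : uniq (y :: (x :: W) ++ I) by rewrite -(perm_uniq pV).
have xV : x \in (x :: W) ++ I by rewrite mem_head.
have vz z : z \in (x :: W) ++ I -> edge_valence E z <= edge_valence (map (merge_ends x y) E) z.
  move=> zV; have zy : z != y by apply: contraNneq (proj1 (andP uV')) => <-.
  by rewrite edge_valence_merge edge_valence_ctr //; lia.
apply/andP; split; first by case/andP: uV'.
apply/and4P; split.
- apply/allP => _ /mapP [f fE ->]; move/allP: EV => /(_ f fE) /andP [tf hf].
  by rewrite /ends_in tail_merge head_merge !(subst_in pV).
- apply/allP => _ /mapP [f fE ->]; move/allP: fl => /(_ f fE).
  rewrite [is_loop (merge_ends _ _ _)]/is_loop tail_merge head_merge /merge_ends.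
  case: joinsP => [j _|_]; last by rewrite flipped_map_ends; case: (flipped f) => //= /eqP ->.
  rewrite (_ : subst y x (tail f) == subst y x (head f)) ?implybT //.
  by case: j => -[-> ->]; rewrite /subst eqxx; case: (x == y).
- apply/allP => z zW; have zV : z \in (x :: W) ++ I by rewrite mem_cat zW.
  apply: leq_trans (vz z zV); apply: (allP vW); move: zW; rewrite !inE.
  by case/orP => ->; rewrite ?orbT.
- apply/allP => z zI; have zV : z \in (x :: W) ++ I by rewrite mem_cat zI orbT.
  by apply: leq_trans (vz z zV); apply: (allP vI).
Qed.

Lemma degen_nonloop I E e : ~~ degen I E -> e \in E ->
  (tail e \in I) || (head e \in I) -> ~~ is_loop e.
Proof.
case/norP => _ /hasPn nl /nl; rewrite negb_and => /orP [//|nt].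
by rewrite (negbTE nt) /= => hI; apply: contra nt; rewrite /is_loop => /eqP ->.
Qed.

Lemma uniq_map_inj (T T' : eqType) (h : T -> T') (s : seq T) :
  uniq (map h s) -> {in s &, injective h}.
Proof.
elim: s => //= x s IH /andP [xs us] y z; rewrite !inE.
case/predU1P => [->|ys] /predU1P [->|zs] // e; last exact: IH.
- by rewrite e map_f in xs.
- by rewrite -e map_f in xs.
Qed.

Lemma degen_par I E e f : ~~ degen I E -> e \in E -> f \in E -> parallel e f -> e = f.
Proof.
case/norP; rewrite negbK => u _ eE fE; rewrite -ends_eq => /eqP ef.
exact: (uniq_map_inj u).
Qed.

Lemma par_degen I E e f : e \in E -> f \in E -> e != f -> parallel e f -> degen I E.
Proof.
move=> eE fE ne p; apply: contraT => nd.
by rewrite (degen_par nd eE fE p) eqxx in ne.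
Qed.

(** If the two images coincide, the list of images has a repetition, which is a degeneracy as
    well. *)
Lemma map_degen (m : edge -> edge) I E e f : e \in E -> f \in E -> e != f ->
  parallel (m e) (m f) -> degen I (map m E).
Proof.
move=> eE fE ne p; have [mm|mm] := eqVneq (m e) (m f); last first.
  by apply: par_degen mm p; apply: map_f.
apply/orP; left; rewrite -map_comp; apply/negP => u.
by case/eqP: ne; apply: (uniq_map_inj u) => //=; rewrite mm.
Qed.

End Contractions.

Ltac perm_tac := apply/permP => ?; do 3 rewrite /= ?count_cat; lia.

Lemma perm_rem_front (T : eqType) (x : T) s s' : perm_eq (x :: s') s -> perm_eq s' (rem x s).
Proof.
move=> p; have xs : x \in s by rewrite -(perm_mem p) mem_head.
by rewrite -(perm_cons x); apply: perm_trans p (perm_to_rem xs).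
Qed.

(** First the remaining letters are put in order, then [x] is moved back to its place, which costs
    [index x s] exchanges. *)
Lemma perm_odd_front (T : eqType) (x : T) s s' : uniq s -> perm_eq (x :: s') s ->
  perm_odd (x :: s') s = perm_odd s' (rem x s) (+) odd (index x s).
Proof.
move=> us p; have xs : x \in s by rewrite -(perm_mem p) mem_head.
have p' := perm_rem_front p; have pr := perm_to_rem xs.
rewrite (@perm_odd_trans _ (x :: rem x s)) ?perm_cons //; last by rewrite perm_sym.
by rewrite perm_odd_rem // perm_odd_cons // -(perm_uniq pr).
Qed.

Lemma oriented_regular r a t e (I : seq nat) : oriented r a t e -> a \in I ->
  (tail e \in I) || (head e \in I).
Proof. by case: r => /andP [/eqP -> /eqP ->] ->; rewrite ?orbT. Qed.

Lemma oriented_neq r a t e I E : ~~ degen I E -> e \in E -> oriented r a t e -> a \in I -> a != t.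
Proof.
move=> nd eE o aI; have := degen_nonloop nd eE (oriented_regular o aI).
by rewrite /is_loop; case: r o => /andP [/eqP -> /eqP ->] //; rewrite eq_sym.
Qed.

Lemma substK a t x : subst a t (subst t a x) = subst a t x.
Proof. by rewrite /subst; case: (eqVneq x t) => [->|//]; rewrite eqxx; case: eqP. Qed.

Lemma subst_inj (V : seq nat) a t : t \notin V -> {in V &, injective (subst a t)}.
Proof.
move=> tV x y xV yV; rewrite /subst; case: eqP => [->|_]; case: eqP => [->|_] // e.
- by rewrite e yV in tV.
- by rewrite -e xV in tV.
Qed.

Lemma map_subst_id (V : seq nat) a t : a \notin V -> map (subst a t) V = V.
Proof.
move=> aV; rewrite -[RHS]map_id; apply/eq_in_map => x xV; rewrite /subst.
by case: eqP => // e; rewrite -e xV in aV.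
Qed.

(** * The terms of the coboundary on labelled graphs *)

Section Terms.
Context (R : realType) (c : parity).
Local Notation cl := (graph_cls R c).

(** The sign is that of the rearrangement before [m] is applied. If [m] identifies two edges, that
    sign has no meaning after the map, but then both classes are 0. *)
Lemma cl_edge_map (m : edge -> edge) W I E E' : uniq (W ++ I) -> uniq E ->
  perm_eq E' E ->
  cl W I (map m E') = bsgn R (is_even c && perm_odd E' E) *: cl W I (map m E).
Proof.
move=> uV uE pE; have pm := perm_map m pE; rewrite (cl_edge R c uV pm).
have [um|num] := boolP (uniq (map m E)).
  by rewrite perm_odd_map //; apply: uniq_map_inj.
rewrite cl_degen ?scaler0 //; apply/orP; left.
by apply: contra num => /map_uniq.
Qed.

(** In the odd case the sign is the position of the removed internal vertex, corrected when that
    vertex is the head; in the even case it is the position of the edge. When both ends are internal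
    the tail is removed. An edge with no internal end contributes 0, since only regular edges are
    contracted. *)
Definition edge_term W I E (e : edge) : graph_complex R c :=
  let k b := bsgn R ((is_odd c && b) (+) (is_even c && odd (index e E))) in
  if tail e \in I then
    k (odd (index (tail e) I)) *: cl W (rem (tail e) I) (contract (tail e) (head e) (rem e E))
  else if head e \in I then
    k (~~ odd (index (head e) I)) *: cl W (rem (head e) I) (contract (head e) (tail e) (rem e E))
  else 0.

Lemma cl_front W I E a t e I' E' : uniq (W ++ I) -> uniq E ->
  perm_eq (a :: I') I -> perm_eq (e :: E') E ->
  cl W (rem a I) (contract a t (rem e E)) =
  bsgn R ((is_odd c && (odd (index a I) (+) perm_odd (a :: I') I))
        (+) (is_even c && (odd (index e E) (+) perm_odd (e :: E') E)))
    *: cl W I' (contract a t E').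
Proof.
move=> uV uE pI pE; have uI : uniq I by move: uV; rewrite cat_uniq => /and3P [].
have pI' := perm_rem_front pI; have pE' := perm_rem_front pE.
have uV' : uniq (W ++ rem a I).
  move: uV; have [aI|/rem_id -> //] := boolP (a \in I).
  rewrite (perm_uniq (perm_cat (perm_refl W) (perm_to_rem aI))).
  by rewrite -cat1s uniq_catCA cat_uniq => /and3P [].
have uV2 : uniq (W ++ I') by rewrite (perm_uniq (perm_cat (perm_refl W) pI')).
rewrite (perm_odd_front uI pI) (perm_odd_front uE pE).
rewrite /contract (cl_int _ _ _ uV' pI') (cl_edge_map _ uV' (rem_uniq _ uE) pE').
rewrite !bsgnZ -[LHS]scale1r -(bsgn0 R); congr (bsgn R _ *: _).
by case: (is_odd c); case: (is_even c); case: (odd _); case: (odd _); case: perm_odd; case: perm_odd.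
Qed.

(** The two graphs differ only in the name, [a] or [t], kept by the merged vertex, which stands in
    the same place of the list. *)
Lemma cl_swap_ctr W I a t E :
  uniq (W ++ a :: t :: I) -> all (ends_in (W ++ a :: t :: I)) E ->
  cl W (a :: I) (contract t a E) = cl W (t :: I) (contract a t E).
Proof.
move=> uV EV.
have pV1 : perm_eq (W ++ a :: t :: I) (t :: W ++ a :: I).
  by perm_tac.
have pV2 : perm_eq (W ++ a :: t :: I) (a :: W ++ t :: I).
  by perm_tac.
have tV : t \notin W ++ a :: I by move: uV; rewrite (perm_uniq pV1) => /andP [].
have aV : a \notin W ++ t :: I by move: uV; rewrite (perm_uniq pV2) => /andP [].
have e1 : map (subst a t) W = W.
  by rewrite map_subst_id //; apply: contra aV => aW; rewrite mem_cat aW.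
have e2 : map (subst a t) (a :: I) = t :: I.
  rewrite /= map_subst_id; first by rewrite /subst eqxx.
  by apply: contra aV => aI; rewrite mem_cat inE aI !orbT.
have EV' : all (ends_in (W ++ a :: I)) (contract t a E).
  apply/allP => _ /mapP [f fE ->]; move/allP: EV => /(_ f fE) /andP [tf hf].
  by rewrite /ends_in !(subst_in pV1) // mem_cat mem_head orbT.
rewrite -(cl_map R c (@subst_inj _ a t tV) EV') e1 e2.
congr (graph_cls R c W _ _); rewrite /contract -map_comp; apply: eq_map => e /=; rewrite map_ends_comp /map_ends /=.
by rewrite !substK.
Qed.

(** The form in which contractions are compared: any internal end [a] may be chosen and any order of
    the other vertices and edges. The choice of the end is compensated by the bit [r]. *)
Lemma edge_term_front r W I E a t e I' E' : lgraph W I E -> ~~ degen I E ->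
  oriented r a t e -> perm_eq (a :: I') I -> perm_eq (e :: E') E ->
  edge_term W I E e =
  bsgn R ((is_odd c && (r (+) perm_odd (a :: I') I))
        (+) (is_even c && perm_odd (e :: E') E)) *: cl W I' (contract a t E').
Proof.
move=> lg nd o pI pE; have uV := lgraph_uniq lg; have uE := degen_uniq nd.
have uI : uniq I by move: uV; rewrite cat_uniq => /and3P [].
have eE : e \in E by rewrite -(perm_mem pE) mem_head.
have aI : a \in I by rewrite -(perm_mem pI) mem_head.
have at_ := oriented_neq nd eE o aI.
rewrite /edge_term; case: r o => /andP [/eqP te /eqP he]; last first.
  rewrite te he aI (cl_front _ uV uE pI pE) bsgnZ; congr (bsgn R _ *: _).
  by case: (is_odd c); case: (is_even c); case: (odd _); case: (odd _); case: perm_odd; case: perm_odd.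
rewrite te he; case: ifPn => [tI|tI]; last first.
  rewrite aI (cl_front _ uV uE pI pE) bsgnZ; congr (bsgn R _ *: _).
  by case: (is_odd c); case: (is_even c); case: (odd _); case: (odd _); case: perm_odd; case: perm_odd.
(* Both ends are internal, and [edge_term] removes the tail [t] instead of [a]. Renaming the merged
   vertex and exchanging [a] and [t] at the front produces the sign accounted for by [r]. *)
have tI' : t \in I' by move: tI; rewrite -(perm_mem pI) inE eq_sym (negbTE at_).
pose J := rem t I'; have pJ : perm_eq I' (t :: J) by apply: perm_to_rem.
have p1 : perm_eq (a :: t :: J) I.
  by rewrite perm_sym in pI; rewrite perm_sym; apply: perm_trans pI _; rewrite perm_cons.
have p2 : perm_eq (t :: a :: J) I by apply: perm_trans p1; apply: (perm_adjacent [::]).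
have uaJ : uniq (a :: t :: J) by rewrite (perm_uniq p1).
have pV : perm_eq (W ++ a :: t :: J) (W ++ I) by apply: perm_cat.
have uWaJ : uniq (W ++ a :: t :: J) by rewrite (perm_uniq pV).
have EV' : all (ends_in (W ++ a :: t :: J)) E'.
  rewrite (all_ends_perm _ pV); move: (lgraph_ends lg).
  by rewrite -(perm_all _ pE) => /andP [].
rewrite (cl_front _ uV uE p2 pE) bsgnZ cl_swap_ctr //.
have uWt : uniq (W ++ t :: J).
  by move: uWaJ; rewrite -cat1s uniq_catCA cat_uniq => /and3P [].
rewrite (cl_int R c (contract a t E') uWt pJ) bsgnZ; congr (bsgn R _ *: _).
have -> : perm_odd (a :: I') I = perm_odd I' (t :: J) (+) perm_odd (a :: t :: J) I.
  by rewrite (@perm_odd_trans _ (a :: t :: J)) // ?perm_odd_cons // perm_cons.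
have -> : perm_odd (t :: a :: J) I = ~~ perm_odd (a :: t :: J) I.
  by rewrite -[t :: _]cat0s perm_odd_swap // eq_sym.
by case: (is_odd c); case: (is_even c); case: (odd _); case: (odd _); case: perm_odd; case: perm_odd; case: perm_odd.
Qed.

Lemma edge_term0 W I E e : ~~ ((tail e \in I) || (head e \in I)) -> edge_term W I E e = 0.
Proof. by rewrite negb_or /edge_term => /andP [/negbTE -> /negbTE ->]. Qed.

(** The word is turned so that [x] and its successor [y] come first; then [y] is dropped. The value
    0 covers a circle with one vertex, which has no arc. *)
Definition arc_contraction W I E (x : nat) : graph_complex R c :=
  if after x W is y :: w then
    bsgn R (perm_odd (from x W) W) *: cl (x :: w) I (map (merge_ends x y) E)
  else 0.

Definition arc_sum W I E := \sum_(x <- W) arc_contraction W I E x.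
Definition edge_sum W I E := \sum_(e <- E) edge_term W I E e.
(** The sign [odd (size W)] is the factor (-1)^v_e left out of [edge_term]: in the even case it
    belongs to [edge_exponent], in the odd case the removed internal vertex is numbered after the
    [size W] external ones. *)
Definition labelled_d W I E : graph_complex R c :=
  if degen I E then 0 else arc_sum W I E + bsgn R (odd (size W)) *: edge_sum W I E.
End Terms.

(** * Sign rules for the coboundary *)

Lemma regularP (I : seq nat) e : (tail e \in I) || (head e \in I) ->
  exists r a t, a \in I /\ oriented r a t e.
Proof.
case/orP => h; first by exists false, (tail e), (head e); rewrite /oriented !eqxx.
by exists true, (head e), (tail e); rewrite /oriented !eqxx.
Qed.

Lemma oriented_reverse r a t e : oriented (~~ r) a t (reverse e) = oriented r a t e.
Proof. by rewrite /oriented /=; case: r; rewrite andbC. Qed.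

Lemma map_ends_reverse f e : (f (tail e) == f (head e)) = is_loop e ->
  map_ends f (reverse e) = reverse (map_ends f e).
Proof. by rewrite /reverse => h; rewrite [is_loop (map_ends _ _)]h. Qed.

(** For an edge joining [x] and [y], reversal exchanges the half-edge at which it starts, and this
    is precisely the flip of the bit of the resulting loop. *)
Lemma merge_ends_reverse x y e : x != y -> flipped e ==> is_loop e ->
  merge_ends x y (reverse e) = reverse (merge_ends x y e).
Proof.
move=> xy fe; have jr : joins x y (reverse e) = joins x y e.
  by rewrite /joins orbC !xpair_eqE; congr (_ || _); apply: andbC.
rewrite /merge_ends jr; case: joinsP => j.
  have -> : tail (reverse e) = head e by [].
  rewrite [RHS](_ : _ = (x, x, tail e != y)); last by rewrite /reverse /is_loop /= eqxx.
  by case: j => -[-> ->]; rewrite ?eqxx ?(negbTE xy).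
apply: map_ends_reverse; rewrite /is_loop /subst.
have [ty|ty] := eqVneq (tail e) y; have [hy|hy] := eqVneq (head e) y; rewrite ?(eqxx x) ?ty ?hy ?(eqxx y) //.
- rewrite ![_ == head e]eq_sym; rewrite (negbTE hy); apply/eqP => e1; apply: j; right; rewrite ty; split => //.
- rewrite (negbTE ty); apply/eqP => e1; apply: j; left; split => //.
Qed.

Lemma uniq_after (W I : seq nat) x y w : uniq (W ++ I) -> x \in W ->
  after x W = y :: w -> [/\ uniq (x :: y :: w ++ I), uniq ((x :: w) ++ I) & x != y].
Proof.
move=> uV xW aE; have pW : perm_eq (x :: y :: w) W by rewrite -aE perm_after.
have u : uniq (x :: y :: w ++ I) by rewrite (perm_uniq (_ : perm_eq _ (W ++ I))) // -!cat_cons perm_cat.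
split=> //; last by apply: (@uniq_adjacent _ [::] x y (w ++ I)).
by move: u; rewrite /= inE negb_or => /and3P [/andP [_ ->] _ ->].
Qed.

Section Invariance.
Context (R : realType) (c : parity).
Local Notation cl := (graph_cls R c).
Local Notation arc_term := (arc_contraction R c).
Local Notation edge_term := (edge_term R c).
Local Notation labelled_d := (labelled_d R c).

Lemma bsgnZD (V : lmodType R) a b (x y : V) :
  bsgn R a *: (x + bsgn R b *: y) = bsgn R a *: x + bsgn R b *: (bsgn R a *: y).
Proof. by rewrite scalerDr !bsgnZ addbC. Qed.

Lemma cl_rev0 W I e E : uniq (W ++ I) -> flipped e ==> is_loop e ->
  cl W I (reverse e :: E) = bsgn R (is_odd c) *: cl W I (e :: E).
Proof. exact: (@cl_rev R c W I [::] e E). Qed.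

Lemma after_rotation (W W' : seq nat) x : uniq W -> x \in W -> rotation W' W ->
  after x W' = after x W.
Proof.
move=> uW xW rW; have := from_eq uW xW rW; rewrite !fromE //; first by case.
by rewrite (perm_mem (rotation_perm rW)).
Qed.

(** The word [from x W] depends only on the circle; only the reference order of the sign changes. *)
Lemma arc_term_rot W I E W' x : uniq W -> x \in W -> rotation W' W ->
  arc_term W' I E x = bsgn R (perm_odd W' W) *: arc_term W I E x.
Proof.
move=> uW xW rW; rewrite /arc_term (after_rotation uW xW rW).
case: (after x W) => [|y w]; first by rewrite scaler0.
have pW := rotation_perm rW; have uW' : uniq W' by rewrite (perm_uniq pW).
rewrite bsgnZ (from_eq uW xW rW) (perm_oddC uW' pW).
rewrite (@perm_odd_trans _ W) ?perm_from //; last by rewrite perm_sym.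
by rewrite addbC.
Qed.

Lemma arc_term_int W I E I' x : uniq (W ++ I) -> x \in W -> perm_eq I' I ->
  arc_term W I' E x = bsgn R (is_odd c && perm_odd I' I) *: arc_term W I E x.
Proof.
move=> uV xW pI; rewrite /arc_term; case aE : (after x W) => [|y w]; first by rewrite scaler0.
have [_ u _] := uniq_after uV xW aE.
by rewrite (cl_int R c _ u pI) !bsgnZ addbC.
Qed.

Lemma arc_term_edge W I E E' x : uniq (W ++ I) -> x \in W -> uniq E -> perm_eq E' E ->
  arc_term W I E' x = bsgn R (is_even c && perm_odd E' E) *: arc_term W I E x.
Proof.
move=> uV xW uE pE; rewrite /arc_term; case aE : (after x W) => [|y w]; first by rewrite scaler0.
have [_ u _] := uniq_after uV xW aE.
by rewrite (cl_edge_map R c _ u uE pE) !bsgnZ addbC.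
Qed.

Lemma flipped_merge_ends x y e : flipped e ==> is_loop e ->
  flipped (merge_ends x y e) ==> is_loop (merge_ends x y e).
Proof.
rewrite [is_loop (merge_ends _ _ _)]/is_loop tail_merge head_merge /merge_ends.
case: joinsP => [j _|_]; last by rewrite flipped_map_ends; case: (flipped e) => //= /eqP ->.
rewrite (_ : subst y x (tail e) == subst y x (head e)) ?implybT //.
by case: j => -[-> ->]; rewrite /subst eqxx; case: (x == y).
Qed.

Lemma flipped_map_loop f e : flipped e ==> is_loop e ->
  flipped (map_ends f e) ==> is_loop (map_ends f e).
Proof.
by rewrite flipped_map_ends; case: (flipped e) => //= /eqP h; rewrite /is_loop tail_map_ends head_map_ends h.
Qed.

Lemma arc_term_rev W I e E x : uniq (W ++ I) -> x \in W -> flipped e ==> is_loop e ->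
  arc_term W I (reverse e :: E) x = bsgn R (is_odd c) *: arc_term W I (e :: E) x.
Proof.
move=> uV xW fe; rewrite /arc_term; case aE : (after x W) => [|y w]; first by rewrite scaler0.
have [_ u xy] := uniq_after uV xW aE.
rewrite !map_cons (merge_ends_reverse xy fe).
rewrite (cl_rev0 _ u (flipped_merge_ends x y fe)).
by rewrite !bsgnZ addbC.
Qed.

Lemma edge_term_rot W I E W' e : uniq (W ++ I) -> rotation W' W ->
  edge_term W' I E e = bsgn R (perm_odd W' W) *: edge_term W I E e.
Proof.
move=> uV rW.
have u a : uniq (W ++ rem a I).
  have [aI|/rem_id -> //] := boolP (a \in I); move: uV.
  rewrite (perm_uniq (perm_cat (perm_refl W) (perm_to_rem aI))).
  by rewrite -cat1s uniq_catCA cat_uniq => /and3P [].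
rewrite /edge_term; case: ifP => _; last (case: ifP => _; last by rewrite scaler0).
all: by rewrite (cl_rot R c _ (u _) rW) !bsgnZ addbC.
Qed.

Lemma edge_term_int W I E I' e : lgraph W I E -> ~~ degen I E -> e \in E -> perm_eq I' I ->
  edge_term W I' E e = bsgn R (is_odd c && perm_odd I' I) *: edge_term W I E e.
Proof.
move=> lg nd eE pI; have [reg|nreg] := boolP ((tail e \in I) || (head e \in I)); last first.
  by rewrite !edge_term0 ?scaler0 // !(perm_mem pI).
have lg' : lgraph W I' E by rewrite (lgraph_perm (perm_refl _) pI (perm_refl _)).
have nd' : ~~ degen I' E by rewrite (degen_perm pI (perm_refl _)).
have [r [a [t [aI o]]]] := regularP reg.
have p1 : perm_eq (a :: rem a I) I by rewrite perm_sym perm_to_rem.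
have p2 : perm_eq (a :: rem a I) I' by apply: perm_trans p1 _; rewrite perm_sym.
have pE : perm_eq (e :: rem e E) E by rewrite perm_sym perm_to_rem.
rewrite (edge_term_front R c lg' nd' o p2 pE) (edge_term_front R c lg nd o p1 pE) bsgnZ.
congr (bsgn R _ *: _); have uI' : uniq I' by move: (lgraph_uniq lg'); rewrite cat_uniq => /and3P [].
rewrite (perm_oddC uI' pI) (@perm_odd_trans _ I) //; last by rewrite perm_sym.
by case: (is_odd c); case: (is_even c); case: r {o}; do 3 case: perm_odd.
Qed.

Lemma edge_term_edge W I E E' e : lgraph W I E -> ~~ degen I E -> e \in E -> perm_eq E' E ->
  edge_term W I E' e = bsgn R (is_even c && perm_odd E' E) *: edge_term W I E e.
Proof.
move=> lg nd eE pE; have [reg|nreg] := boolP ((tail e \in I) || (head e \in I)); last first.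
  by rewrite !edge_term0 ?scaler0.
have lg' : lgraph W I E' by rewrite (lgraph_perm (perm_refl _) (perm_refl _) pE).
have nd' : ~~ degen I E' by rewrite (degen_perm (perm_refl _) pE).
have [r [a [t [aI o]]]] := regularP reg.
have pI : perm_eq (a :: rem a I) I by rewrite perm_sym perm_to_rem.
have p1 : perm_eq (e :: rem e E) E by rewrite perm_sym perm_to_rem.
have p2 : perm_eq (e :: rem e E) E' by apply: perm_trans p1 _; rewrite perm_sym.
rewrite (edge_term_front R c lg' nd' o pI p2) (edge_term_front R c lg nd o pI p1) bsgnZ.
congr (bsgn R _ *: _); have uE' := degen_uniq nd'.
rewrite (perm_oddC uE' pE) (@perm_odd_trans _ E) //; last by rewrite perm_sym.
by case: (is_odd c); case: (is_even c); case: r {o}; do 3 case: perm_odd.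
Qed.

Lemma parC e f : parallel e f = parallel f e.
Proof. by rewrite -!ends_eq eq_sym. Qed.

(** No new loop arises from an edge that is not parallel to [e]. This is what lets contraction
    commute with the reversal of another edge, since [reverse] treats loops separately. *)
Lemma loop_subst r a t e f : oriented r a t e -> a != t -> ~~ parallel e f ->
  (subst a t (tail f) == subst a t (head f)) = is_loop f.
Proof.
rewrite /oriented /parallel /is_loop /subst => /andP [/eqP -> /eqP ->] at_ np.
have [ta|ta] := eqVneq (tail f) a; have [ha|ha] := eqVneq (head f) a; rewrite ?ta ?ha ?eqxx //.
- rewrite [a == _]eq_sym (negbTE ha); apply/eqP => th; case/negP: np.
  by rewrite ta -th; case: r; rewrite !eqxx ?orbT.
- rewrite (negbTE ta); apply/eqP => th; case/negP: np.
  by rewrite th ha; case: r; rewrite !eqxx ?orbT.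
Qed.

Lemma edge_term_rev W I e0 E e : lgraph W I (e0 :: E) -> ~~ degen I (e0 :: E) -> e \in E ->
  edge_term W I (reverse e0 :: E) e = bsgn R (is_odd c) *: edge_term W I (e0 :: E) e.
Proof.
move=> lg nd eE; have [reg|nreg] := boolP ((tail e \in I) || (head e \in I)); last first.
  by rewrite !edge_term0 ?scaler0.
have lg' : lgraph W I (reverse e0 :: E) by apply: (@lgraph_reverse W I [::] E e0).
have nd' : ~~ degen I (reverse e0 :: E) by rewrite (degen_reverse I [::] E e0).
have [r [a [t [aI o]]]] := regularP reg.
have pI : perm_eq (a :: rem a I) I by rewrite perm_sym perm_to_rem.
have pE : perm_eq (e :: rem e E) E by rewrite perm_sym perm_to_rem.
have p x : perm_eq (e :: x :: rem e E) (x :: E).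
  by apply: perm_trans (perm_adjacent [::] _ _ _) _; rewrite perm_cons.
have po x : uniq (x :: E) -> perm_odd (e :: x :: rem e E) (x :: E) = ~~ perm_odd (e :: rem e E) E.
  move=> ux; rewrite -[e :: _]cat0s perm_odd_swap /= ?perm_odd_cons //.
  - by apply: contraTneq ux => <- /=; rewrite eE.
  - by rewrite inE eE orbT.
have eE0 : e \in e0 :: E by rewrite inE eE orbT.
have at_ := oriented_neq nd eE0 o aI.
rewrite (edge_term_front R c lg' nd' o pI (p _)) (edge_term_front R c lg nd o pI (p _)).
rewrite !po ?(degen_uniq nd) ?(degen_uniq nd') // /contract /=.
have np : ~~ parallel e e0.
  apply/negP => pe; have := degen_uniq nd; rewrite -(degen_par nd eE0 (mem_head _ _) pe) /=.
  by rewrite eE.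
rewrite map_ends_reverse; last exact: loop_subst o at_ np.
have fe0 : flipped e0 ==> is_loop e0 by case/andP: lg => _ /and4P [_ /andP []].
rewrite (cl_rev0 _ _ (flipped_map_loop _ fe0)); last first.
  move: (lgraph_uniq lg); rewrite -(perm_uniq (perm_cat (perm_refl W) pI)).
  by rewrite -cat1s uniq_catCA cat_uniq => /and3P [].
by rewrite !bsgnZ addbC.
Qed.

(** The same vertex can be removed before and after reversal, but the edge points the other way, so
    the bit [r] of [edge_term_front] is negated. *)
Lemma edge_term_rev_self W I e E : lgraph W I (e :: E) -> ~~ degen I (e :: E) ->
  edge_term W I (reverse e :: E) (reverse e) = bsgn R (is_odd c) *: edge_term W I (e :: E) e.
Proof.
move=> lg nd; have [reg|nreg] := boolP ((tail e \in I) || (head e \in I)); last first.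
  by rewrite !edge_term0 ?scaler0 //= orbC.
have lg' : lgraph W I (reverse e :: E) by apply: (@lgraph_reverse W I [::] E e).
have nd' : ~~ degen I (reverse e :: E) by rewrite (degen_reverse I [::] E e).
have [r [a [t [aI o]]]] := regularP reg.
have o' : oriented (~~ r) a t (reverse e) by rewrite oriented_reverse.
have pI : perm_eq (a :: rem a I) I by rewrite perm_sym perm_to_rem.
rewrite (edge_term_front R c lg' nd' o' pI (perm_refl _)).
rewrite (edge_term_front R c lg nd o pI (perm_refl _)) bsgnZ.
rewrite !perm_oddss ?(degen_uniq nd) ?(degen_uniq nd') //; congr (bsgn R _ *: _).
by case: (is_odd c); case: r {o o'}; case: perm_odd; rewrite ?andbF.
Qed.

Lemma labelled_d_rot W I E W' : lgraph W I E -> rotation W' W ->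
  labelled_d W' I E = bsgn R (perm_odd W' W) *: labelled_d W I E.
Proof.
move=> lg rW; rewrite /labelled_d; case: (degen I E); first by rewrite scaler0.
have uV := lgraph_uniq lg; have uW : uniq W by move: uV; rewrite cat_uniq => /andP [].
have pW := rotation_perm rW.
rewrite (perm_size pW) bsgnZD; congr (_ + _ *: _); rewrite /arc_sum /edge_sum scaler_sumr.
  rewrite (perm_big W pW) /= !big_seq; apply: eq_bigr => x xW; exact: arc_term_rot.
by apply: eq_bigr => e _; exact: edge_term_rot.
Qed.

Lemma labelled_d_int W I E I' : lgraph W I E -> perm_eq I' I ->
  labelled_d W I' E = bsgn R (is_odd c && perm_odd I' I) *: labelled_d W I E.
Proof.
move=> lg pI; rewrite /labelled_d (degen_perm pI (perm_refl E)).
have [dg|nd] := boolP (degen I E); first by rewrite scaler0.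
have uV := lgraph_uniq lg.
rewrite bsgnZD; congr (_ + _ *: _); rewrite /arc_sum /edge_sum scaler_sumr !big_seq.
  by apply: eq_bigr => x xW; exact: arc_term_int.
by apply: eq_bigr => e eE; exact: edge_term_int.
Qed.

Lemma labelled_d_edge W I E E' : lgraph W I E -> perm_eq E' E -> ~~ degen I E ->
  labelled_d W I E' = bsgn R (is_even c && perm_odd E' E) *: labelled_d W I E.
Proof.
move=> lg pE nd; rewrite /labelled_d (degen_perm (perm_refl I) pE) (negbTE nd).
have uV := lgraph_uniq lg; have uE := degen_uniq nd.
rewrite bsgnZD; congr (_ + _ *: _); rewrite /arc_sum /edge_sum scaler_sumr.
  by rewrite !big_seq; apply: eq_bigr => x xW; exact: arc_term_edge.
rewrite (perm_big E pE) /= !big_seq.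
by apply: eq_bigr => e eE; exact: edge_term_edge.
Qed.

Lemma labelled_d_rev W I e E : lgraph W I (e :: E) ->
  labelled_d W I (reverse e :: E) = bsgn R (is_odd c) *: labelled_d W I (e :: E).
Proof.
move=> lg; rewrite /labelled_d (degen_reverse I [::] E e).
have [dg|nd] := boolP (degen I _); first by rewrite scaler0.
have uV := lgraph_uniq lg.
have fe : flipped e ==> is_loop e by case/andP: lg => _ /and4P [_ /andP []].
rewrite bsgnZD; congr (_ + _ *: _); rewrite /arc_sum /edge_sum scaler_sumr.
  by rewrite !big_seq; apply: eq_bigr => x xW; exact: arc_term_rev.
rewrite !big_cons (edge_term_rev_self lg nd); congr (_ + _).
by rewrite !big_seq; apply: eq_bigr => f fE; exact: edge_term_rev.
Qed.

End Invariance.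

(** * Naturality under injective relabelling *)

Lemma lgraph_map (h : nat -> nat) W I E : {in W ++ I &, injective h} ->
  lgraph W I E -> lgraph (map h W) (map h I) (map (map_ends h) E).
Proof.
move=> hi lg; have uV := lgraph_uniq lg; have EV := lgraph_ends lg.
have u : uniq (map h W ++ map h I) by rewrite -map_cat map_inj_in_uniq.
by rewrite /lgraph u -is_graph_std // std_map // lgraph_std.
Qed.

Lemma ends_in_map (h : nat -> nat) V e : ends_in V e -> ends_in (map h V) (map_ends h e).
Proof. by case/andP => te he; rewrite /ends_in tail_map_ends head_map_ends !map_f. Qed.

Lemma degen_map (h : nat -> nat) W I E : {in W ++ I &, injective h} ->
  uniq (W ++ I) -> all (ends_in (W ++ I)) E ->
  degen (map h I) (map (map_ends h) E) = degen I E.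
Proof.
move=> hi uV EV; have u : uniq (map h W ++ map h I) by rewrite -map_cat map_inj_in_uniq.
rewrite -(degenerate_std u) ?std_map ?degenerate_std //.
apply/allP => _ /mapP [e eE ->]; rewrite -map_cat; apply: ends_in_map; exact: (allP EV).
Qed.

Lemma map_subst (h : nat -> nat) (V : seq nat) a t x : {in V &, injective h} ->
  a \in V -> x \in V -> h (subst a t x) = subst (h a) (h t) (h x).
Proof. by move=> hi aV xV; rewrite /subst (inj_in_eq hi) //; case: eqP. Qed.

Lemma ctr_map (h : nat -> nat) (V : seq nat) a t E : {in V &, injective h} -> a \in V ->
  all (ends_in V) E -> contract (h a) (h t) (map (map_ends h) E) = map (map_ends h) (contract a t E).
Proof.
move=> hi aV EV; rewrite /contract -!map_comp; apply/eq_in_map => e /(allP EV) /andP [te he] /=.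
by rewrite !map_ends_comp /map_ends /= !(map_subst _ hi).
Qed.

Lemma merge_ends_map (h : nat -> nat) (V : seq nat) x y e : {in V &, injective h} -> x \in V -> y \in V ->
  ends_in V e -> merge_ends (h x) (h y) (map_ends h e) = map_ends h (merge_ends x y e).
Proof.
move=> hi xV yV /andP [te he]; rewrite /merge_ends.
have -> : joins (h x) (h y) (map_ends h e) = joins x y e.
  by rewrite /joins !xpair_eqE tail_map_ends head_map_ends !(inj_in_eq hi).
case: ifP => _; first by rewrite /map_ends /= tail_map_ends (inj_in_eq hi).
by rewrite !map_ends_comp /map_ends /= !(map_subst _ hi).
Qed.

Lemma map_ends_inj (h : nat -> nat) (V : seq nat) : {in V &, injective h} ->
  {in ends_in V &, injective (map_ends h)}.
Proof.
move=> hi [[p q] u] [[p' q'] u'] /andP [te he] /andP [tf hf] [] e1 e2 e3.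
by congr (_, _, _); [apply: hi|apply: hi|].
Qed.

Lemma oriented_map (h : nat -> nat) r a t e : oriented r a t e ->
  oriented r (h a) (h t) (map_ends h e).
Proof.
rewrite /oriented tail_map_ends head_map_ends => /andP [/eqP -> /eqP ->].
by case: r; rewrite !eqxx.
Qed.

Lemma ctr_ends W I a t r e E : lgraph W (a :: I) (e :: E) -> oriented r a t e -> a != t ->
  all (ends_in (W ++ I)) (contract a t E).
Proof. by move=> lg o at_; apply: lgraph_ends (lgraph_ctr lg o at_). Qed.

Section Coboundary.
Context (R : realType) (c : parity).
Local Notation cl := (graph_cls R c).
Local Notation arc_term := (arc_contraction R c).
Local Notation edge_term := (edge_term R c).
Local Notation labelled_d := (labelled_d R c).

Lemma arc_term_map (h : nat -> nat) W I E x : {in W ++ I &, injective h} ->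
  lgraph W I E -> x \in W ->
  arc_term (map h W) (map h I) (map (map_ends h) E) (h x) = arc_term W I E x.
Proof.
move=> hi lg xW; have uV := lgraph_uniq lg.
have sW : {subset W <= W ++ I} by move=> z zW; rewrite mem_cat zW.
have ix : index (h x) (map h W) = index x W by apply: (index_map_in hi) => //; apply: sW.
have af : after (h x) (map h W) = map h (after x W).
  by rewrite /after ix map_cat map_drop map_take.
rewrite /arc_term af; case aE : (after x W) => [|y w] //=.
have fr : from (h x) (map h W) = map h (from x W) by rewrite /from ix map_rot.
have hiW : {in W &, injective h} by move=> a b aW bW; apply: hi; apply: sW.
rewrite fr perm_odd_map ?perm_from //; congr (_ *: _).
have pW : perm_eq (x :: y :: w) W by rewrite -aE perm_after.
have yV : y \in W ++ I by apply: sW; rewrite -(perm_mem pW) !inE eqxx orbT.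
have lg' : lgraph (x :: y :: w) I E by rewrite (lgraph_perm pW (perm_refl _) (perm_refl _)).
have lgm := lgraph_merge lg'.
rewrite -[RHS](cl_map R c (h := h)); last exact: lgraph_ends lgm.
- congr (graph_cls R c _ _ _); rewrite -!map_comp; apply/eq_in_map => e eE /=.
  by apply: (merge_ends_map hi) => //; [apply: sW|apply: (allP (lgraph_ends lg))].
- move=> a b aV bV; apply: hi; have pV := perm_cat pW (perm_refl I).
    by rewrite -(perm_mem pV); move: aV; rewrite /= !inE => /orP [->|->]; rewrite ?orbT.
  by rewrite -(perm_mem pV); move: bV; rewrite /= !inE => /orP [->|->]; rewrite ?orbT.
Qed.

Lemma edge_term_map (h : nat -> nat) W I E e : {in W ++ I &, injective h} ->
  lgraph W I E -> ~~ degen I E -> e \in E ->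
  edge_term (map h W) (map h I) (map (map_ends h) E) (map_ends h e) = edge_term W I E e.
Proof.
move=> hi lg nd eE; have uV := lgraph_uniq lg; have EV := lgraph_ends lg.
have lg' := lgraph_map hi lg.
have nd' : ~~ degen (map h I) (map (map_ends h) E) by rewrite (degen_map hi).
have mI x : x \in W ++ I -> (h x \in map h I) = (x \in I).
  move=> xV; apply/idP/idP => [/mapP [y yI /hi e1]|xI]; last exact: map_f.
  by rewrite e1 // mem_cat yI orbT.
have /andP [te he] := allP EV e eE.
have [reg|nreg] := boolP ((tail e \in I) || (head e \in I)); last first.
  by rewrite !edge_term0 // tail_map_ends head_map_ends !mI.
have [r [a [t [aI o]]]] := regularP reg.
have pI : perm_eq (a :: rem a I) I by rewrite perm_sym perm_to_rem.
have pE : perm_eq (e :: rem e E) E by rewrite perm_sym perm_to_rem.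
have at_ := oriented_neq nd eE o aI.
have lge : lgraph W (a :: rem a I) (e :: rem e E).
  by rewrite (lgraph_perm (perm_refl _) pI pE).
rewrite (edge_term_front R c lg nd o pI pE).
have pI' := perm_map h pI; have pE' := perm_map (map_ends h) pE.
rewrite (edge_term_front R c lg' nd' (oriented_map h o) pI' pE').
have hiI : {in I &, injective h}.
  by move=> x y xI yI; apply: hi; rewrite mem_cat ?xI ?yI orbT.
have hiE : {in E &, injective (map_ends h)}.
  by move=> x y xE yE; apply: (map_ends_inj hi); apply: (allP EV).
rewrite -!map_cons !perm_odd_map //; congr (_ *: _).
have aV : a \in W ++ I by rewrite mem_cat aI orbT.
have EV' : all (ends_in (W ++ I)) (rem e E).
  by apply/allP => f /mem_rem fE; apply: (allP EV).
rewrite (ctr_map t hi aV EV') (cl_map R c) //; last exact: ctr_ends lge o at_.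
move=> x y xV yV; apply: hi; rewrite mem_cat.
  by move: xV; rewrite mem_cat => /orP [->//|/mem_rem ->]; rewrite orbT.
by move: yV; rewrite mem_cat => /orP [->//|/mem_rem ->]; rewrite orbT.
Qed.

Lemma labelled_d_map (h : nat -> nat) W I E : {in W ++ I &, injective h} -> lgraph W I E ->
  labelled_d (map h W) (map h I) (map (map_ends h) E) = labelled_d W I E.
Proof.
move=> hi lg; have uV := lgraph_uniq lg; have EV := lgraph_ends lg.
rewrite /labelled_d (degen_map hi) //; case: (boolP (degen I E)) => // nd.
rewrite size_map /arc_sum /edge_sum !big_map !big_seq; congr (_ + _ *: _).
  by apply: eq_bigr => x xW; apply: arc_term_map.
by apply: eq_bigr => e eE; apply: edge_term_map.
Qed.
End Coboundary.

(** * The coboundary of a labelled graph *)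

Section Numeric.
Local Open Scope nat_scope.

Lemma index_iota m n x : m <= x < m + n -> index x (iota m n) = x - m.
Proof.
move=> h; have e : x = nth 0 (iota m n) (x - m) by rewrite nth_iota; lia.
by rewrite {1}e index_uniq ?iota_uniq // size_iota; lia.
Qed.

Lemma rem_iota n a : 0 < a <= n ->
  rem a (iota 1 n) = iota 1 a.-1 ++ iota a.+1 (n - a).
Proof.
move=> h; rewrite remE index_iota; last lia.
by rewrite take_iota drop_iota; congr (iota _ _ ++ iota _ _); lia.
Qed.

Lemma new_label_rem n a x : 0 < a <= n -> 0 < x <= n -> x != a ->
  new_label (rem a (iota 1 n)) x = if a < x then x.-1 else x.
Proof.
move=> ha hx xa; rewrite rem_iota // /new_label index_cat mem_iota size_iota.
by case: (ltnP a x) => h2; case: ifP => h1; rewrite ?index_iota; lia.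
Qed.

Lemma merge_labelC i j x : merge_label i j x = merge_label j i x.
Proof. by rewrite /merge_label orbC minnC maxnC. Qed.

(** Once the larger label [a] is removed, the position of a label above it drops by one: this is the
    rescaling in [merge_label]. *)
Lemma merge_labelE n a t x : 0 < t < a -> a <= n -> 0 < x <= n ->
  new_label (rem a (iota 1 n)) (subst a t x) = merge_label t a x.
Proof.
move=> ta an hx; rewrite /subst /merge_label; have [->|xa] := eqVneq x a.
  by rewrite orbT new_label_rem; [case: ifP|..]; lia.
rewrite orbF new_label_rem //; last lia.
have -> : maxn t a = a by lia.
by case: eqP => // ->; case: ifP; lia.
Qed.

Lemma rem_catr (s t : seq nat) x : x \notin s -> rem x (s ++ t) = s ++ rem x t.
Proof.
by elim: s => //= y s IH; rewrite inE negb_or eq_sym => /andP [/negbTE -> /IH ->].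
Qed.

Lemma rem_catl (s t : seq nat) x : x \in s -> rem x (s ++ t) = rem x s ++ t.
Proof.
by elim: s => //= y s IH; rewrite inE eq_sym; case: eqP => //= _ /IH ->.
Qed.

Lemma ext_int_iota g : ext_vertices g ++ int_vertices g = iota 1 (nvert g).
Proof. by rewrite /ext_vertices /int_vertices -[(vext g).+1]add1n -iotaD. Qed.

(** [merge_label] keeps the smaller label, so the vertex removed must be the larger end [a]. *)
Lemma contract_edge_std g k e a t : is_graph g -> uniq (edges g) -> k < nedge g ->
  e = nth no_edge (edges g) k -> a \in int_vertices g -> 0 < t < a ->
  (tail e = a /\ head e = t) \/ (tail e = t /\ head e = a) ->
  contract_edge k.+1 g
  = std (ext_vertices g) (rem a (int_vertices g)) (contract a t (rem e (edges g))).
Proof.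
move=> gg uE kn ee aI ta th; have EV := lgraph_ends (lgraph_self gg).
have aW : a \notin ext_vertices g by move: aI; rewrite !mem_iota; lia.
have an : a <= nvert g by move: aI; rewrite mem_iota /nvert; lia.
rewrite /contract_edge /std -rem_catr // ext_int_iota /= size_iota size_rem // size_iota.
congr PreDGraph; have ix : index e (edges g) = k by rewrite ee index_uniq.
rewrite (remE e) ix /contract -map_comp -ee; apply/eq_in_map => f fE /=.
have {}fE : f \in edges g.
  by move: fE; rewrite mem_cat => /orP [/mem_take|/mem_drop].
move: (allP EV f fE); rewrite /ends_in ext_int_iota !mem_iota => /andP [tf hf].
rewrite map_ends_comp /map_ends /= !merge_labelE //; try lia.
by case: th => -[-> ->]; rewrite // ![merge_label a t _]merge_labelC.
Qed.

Lemma contract_arc_std g x : is_graph g -> 0 < x < vext g ->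
  contract_arc (x, x.+1) g
  = std (rem x.+1 (ext_vertices g)) (int_vertices g) (map (merge_ends x x.+1) (edges g)).
Proof.
move=> gg hx; have EV := lgraph_ends (lgraph_self gg).
have yW : x.+1 \in ext_vertices g by rewrite mem_iota; lia.
rewrite /contract_arc /std -rem_catl // ext_int_iota /= size_rem // !size_iota.
congr PreDGraph; rewrite -map_comp; apply/eq_in_map => f fE /=.
move: (allP EV f fE); rewrite /ends_in ext_int_iota !mem_iota => /andP [tf hf].
have xn : x < nvert g by rewrite /nvert; lia.
have sx : new_label (rem x.+1 (iota 1 (nvert g))) x = x by rewrite new_label_rem; [case: ifP|..]; lia.
rewrite /merge_ends -/(joins _ _ _); case: ifP => _; last first.
  by rewrite map_ends_comp /map_ends /= !merge_labelE //; lia.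
by rewrite /map_ends /tail /head /flipped /= sx; congr (_, _, _); lia.
Qed.

(** Here the surviving label is the end 1 of the arc, whereas [merge_ends] keeps its origin; hence
    the additional renaming [subst v 1]. *)
Lemma contract_last_arc_std g (v := vext g) : is_graph g -> 1 < v ->
  contract_arc (v, 1) g
  = std (iota 1 v.-1) (int_vertices g)
      (map (map_ends (subst v 1)) (map (merge_ends v 1) (edges g))).
Proof.
move=> gg hx; have EV := lgraph_ends (lgraph_self gg).
have vn : v <= nvert g by rewrite /nvert -/v; lia.
have eV : iota 1 v.-1 ++ int_vertices g = rem v (iota 1 (nvert g)).
  by rewrite rem_iota /int_vertices -/v /nvert ?addKn //; lia.
rewrite /contract_arc /std eV /= !size_iota.
congr PreDGraph; rewrite -!map_comp; apply/eq_in_map => f fE /=.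
move: (allP EV f fE); rewrite /ends_in ext_int_iota !mem_iota => /andP [tf hf].
have sx : new_label (rem v (iota 1 (nvert g))) 1 = 1 by rewrite new_label_rem; [case: ifP|..]; lia.
rewrite /merge_ends -/(joins _ _ _); case: ifP => _; last first.
  rewrite !map_ends_comp /map_ends /= !substK !merge_labelE //; try lia.
  by rewrite ![merge_label 1 v _]merge_labelC.
by rewrite /map_ends /tail /head /flipped /= /subst eqxx sx; congr (_, _, _); lia.
Qed.

Lemma arcsE g : 1 < vext g ->
  arcs g = [seq (x, if x == vext g then 1 else x.+1) | x <- ext_vertices g].
Proof.
move=> v1; rewrite /arcs v1 /ext_vertices; case: (vext g) v1 => // v v1.
have -> : rot 1 (iota 1 v.+1) = rcons (iota 2 v) 1 by rewrite /= rot1_cons.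
apply: (@eq_from_nth _ (0,0)) => [|i].
  by rewrite size_zip size_map size_rcons !size_iota minnn.
rewrite size_zip size_rcons !size_iota minnn => iv.
rewrite nth_zip ?size_rcons ?size_iota // (nth_map 0) ?size_iota // !nth_iota // nth_rcons size_iota.
congr (_, _); have [lt|ge] := ltnP i v; first by rewrite nth_iota //; case: eqP; lia.
by rewrite (_ : i = v) ?eqxx //; lia.
Qed.

Lemma after_iota v x : 0 < x <= v -> after x (iota 1 v) = iota x.+1 (v - x) ++ iota 1 x.-1.
Proof.
move=> h; rewrite /after index_iota; last lia.
by rewrite take_iota drop_iota; congr (iota _ _ ++ iota _ _); lia.
Qed.

End Numeric.

Section CoboundaryGraph.
Context (R : realType) (c : parity).
Local Notation cl := (graph_cls R c).
Local Notation arc_term := (arc_contraction R c).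
Local Notation edge_term := (edge_term R c).
Local Notation labelled_d := (labelled_d R c).

Lemma arc_term_numeric g x : is_graph g -> (1 < vext g)%N -> x \in ext_vertices g ->
  let y := if x == vext g then 1%N else x.+1 in
  sgn R (oriented_exponent x y) *: cls R c (contract_arc (x, y) g)
  = arc_term (ext_vertices g) (int_vertices g) (edges g) x.
Proof.
move=> gg v1 xW y; have lg := lgraph_self gg; have hx : (0 < x <= vext g)%N by move: xW; rewrite mem_iota; lia.
have uV := lgraph_uniq lg.
rewrite /arc_term /y {y}; set W := ext_vertices g; set I := int_vertices g; set E := edges g.
have frE := fromE xW; case: eqP => xv.
  have aE : after x W = 1%N :: iota 2 (vext g).-2.
    rewrite after_iota // xv subnn /=; case: (vext g) v1 => // -[] //.
  rewrite aE xv contract_last_arc_std // -/(cl _ _ _).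
  have [u1 u2 ne] := uniq_after uV xW aE; rewrite -/I xv in u1 u2 ne.
  have lg' : lgraph (vext g :: 1%N :: iota 2 (vext g).-2) I E.
    rewrite -(lgraph_perm (_ : perm_eq W _) (perm_refl I) (perm_refl E)) //.
    by rewrite perm_sym; have := perm_after xW; rewrite aE xv.
  have hi : {in (vext g :: iota 2 (vext g).-2) ++ I &, injective (subst (vext g) 1)}.
    by apply: subst_inj; rewrite cat_cons inE negb_or eq_sym ne; case/and3P: u1.
  rewrite -(cl_map R c hi); last exact: lgraph_ends (lgraph_merge lg').
  have vnI : vext g \notin I by move: u1; rewrite /= inE mem_cat !negb_or => /andP [/and3P []].
  rewrite [map _ I]map_subst_id // sgn_bsgn; congr (bsgn R _ *: graph_cls R c _ _ _).
    rewrite -xv frE aE /oriented_exponent ifN; last by rewrite xv; lia.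
    have eW : W = iota 1 (vext g).-1 ++ [:: x].
      rewrite /W /ext_vertices xv; case: (vext g) v1 => // n _.
      by rewrite -[X in iota _ X = _]addn1 iotaD add1n.
    have e1 : 1%N :: iota 2 (vext g).-2 = iota 1 (vext g).-1 by case: (vext g) v1 => // -[].
    (* The last vertex passes [vext g - 1] others to reach the front, and the exponent of the
       wrapping arc is [vext g + 1]. *)
    rewrite e1 eW -[X in _ :: X]cats0 perm_odd_pivot ?size_iota -?eW; last exact: iota_uniq.
    by rewrite xv; case: (vext g) v1 => //= n _; rewrite negbK.
  rewrite /= {1}/subst eqxx map_subst_id; first by case: (vext g) v1 => // -[].
  by rewrite mem_iota; lia.
have xl : (0 < x < vext g)%N by lia.
pose w := iota x.+2 (vext g - x.+1) ++ iota 1 x.-1.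
have aE : after x W = x.+1 :: w.
  by rewrite after_iota // /w; have -> : (vext g - x = (vext g - x.+1).+1)%N by lia.
have [u1 u2 ne] := uniq_after uV xW aE.
rewrite aE contract_arc_std // -/(cl _ _ _) -/W -/I -/E.
pose A := iota 1 x.-1; pose B := iota x.+2 (vext g - x.+1).
have e1 : rem x.+1 W = A ++ x :: B.
  rewrite rem_iota; last lia.
  rewrite [in LHS](_ : x.+1.-1 = x) // (_ : iota 1 x = A ++ [:: x]) -?catA //.
  by rewrite /A; case: (x) xl => // n _; rewrite -[X in iota _ X = _]addn1 iotaD add1n.
have e2 : W = A ++ x :: x.+1 :: B.
  rewrite /W /ext_vertices /A /B (_ : vext g = x.-1 + (vext g - x.+1).+2)%N; last lia.
  by rewrite iotaD; congr (_ ++ _); rewrite /=; do ![congr (_ :: _)|congr (iota _ _)]; lia.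
have r1 : rotation (x :: w) (rem x.+1 W).
  by rewrite e1 /w -cat_cons rotation_cat.
have uR : uniq (rem x.+1 W ++ I).
  by rewrite (perm_uniq (perm_cat (_ : perm_eq _ (x :: w)) (perm_refl I))) // perm_sym (rotation_perm r1).
(* The class on the right is turned back to the increasing order. The rotations before and after
   deleting [x.+1] exchange blocks whose lengths differ by one, so their signs differ by [size A],
   that is [x - 1], of the parity of the exponent [x + 1]. *)
rewrite [in RHS](cl_rot R c _ uR r1) bsgnZ frE aE sgn_bsgn; congr (bsgn R _ *: _).
have uW : uniq W by apply: iota_uniq.
rewrite {1}e2 e1 /w -/A -/B.
have p1 : perm_odd (x :: x.+1 :: B ++ A) (A ++ x :: x.+1 :: B) = odd (size (x :: x.+1 :: B) * size A).
  by apply: (@perm_odd_catC _ (x :: x.+1 :: B) A); rewrite uniq_catC -e2.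
have p2 : perm_odd (x :: B ++ A) (A ++ x :: B) = odd (size (x :: B) * size A).
  apply: (@perm_odd_catC _ (x :: B) A); rewrite uniq_catC -e1.
  by apply: rem_uniq.
rewrite p1 p2 /oriented_exponent ltnSn -oddD -mulnDl !oddM /= !oddD /= /A size_iota.
by case: (x) xl => //= z _; case: (odd (size B)); case: (odd z).
Qed.

(** The removed vertex is taken to be the larger end [a], whose position among the internal vertices
    is [a - vext g - 1]; the factor in [vext g] cancels the shift. In the odd case [r] then
    separates the exponents [a] and [a + 1]. *)
Lemma edge_term_numeric g k : is_graph g -> ~~ degenerate g -> (k < nedge g)%N ->
  (if regular_edge g k.+1 then sgn R (edge_exponent c g k.+1) *: cls R c (contract_edge k.+1 g) else 0)
  = bsgn R (odd (vext g)) *: edge_term (ext_vertices g) (int_vertices g) (edges g) (nth no_edge (edges g) k).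
Proof.
move=> gg nd kn; have lg := lgraph_self gg; rewrite /regular_edge /=.
set e := nth _ _ _; rewrite /is_internal; case: ifPn => reg; last by rewrite edge_term0 ?scaler0.
have nd' : ~~ degen (int_vertices g) (edges g) by [].
have uE := degen_uniq nd'; have eE : e \in edges g by apply: mem_nth.
have := degen_nonloop nd' eE reg; rewrite /is_loop => nl.
have := allP (lgraph_ends lg) e eE; rewrite /ends_in ext_int_iota !mem_iota => /andP [te he].
have pE : perm_eq (e :: rem e (edges g)) (edges g) by rewrite perm_sym perm_to_rem.
have ie : index e (edges g) = k by rewrite index_uniq.
have [r [a [t [aI o ta]]]] : exists r a t,
    [/\ a \in int_vertices g, oriented r a t e & (0 < t < a)%N /\ (r = (tail e < head e)%N)].
  move: reg nl; rewrite !mem_iota /oriented neq_ltn => reg /orP [lt|lt].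
  - exists true, (head e), (tail e); rewrite !eqxx mem_iota lt; split => //; last split => //; move: reg te he lt; rewrite /nvert; clear; lia.
  - exists false, (tail e), (head e); rewrite !eqxx mem_iota; split => //; last split => //; move: reg te he lt; rewrite /nvert; clear; lia.
case: ta => ta er; have pI : perm_eq (a :: rem a (int_vertices g)) (int_vertices g) by rewrite perm_sym perm_to_rem.
rewrite (edge_term_front R c lg nd' o pI pE) bsgnZ (contract_edge_std gg uE kn (erefl : e = nth no_edge (edges g) k) aI ta); last first.
  by move: o; rewrite /oriented; case: (r) => /andP [/eqP h1 /eqP h2]; [right|left].
rewrite -/e -/(cl _ _ _) sgn_bsgn; congr (bsgn R _ *: _).
have uI : uniq (int_vertices g) by apply: iota_uniq.
rewrite !perm_odd_rem // ie /int_vertices index_iota; last by move: aI; rewrite mem_iota.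
have av : (vext g < a)%N by move: aI; rewrite mem_iota => /andP [].
rewrite /edge_exponent; case: c => /=; last by rewrite !oddD /=; case: odd; case: odd.
rewrite -/e /oriented_exponent -er addbF oddB // /=.
by move: o; rewrite /oriented; case: (r) => /andP [/eqP h1 /eqP h2] /=; rewrite ?h1 ?h2 /=; case: (odd a); case: odd.
Qed.

Lemma coboundary_graphE g : is_graph g ->
  coboundary_graph R c g = labelled_d (ext_vertices g) (int_vertices g) (edges g).
Proof.
move=> gg; rewrite /coboundary_graph /labelled_d.
have -> : degen (int_vertices g) (edges g) = degenerate g by [].
have [//|nd] := boolP (degenerate g); congr (_ + _).
  rewrite /arc_sum; have [v1|v1] := ltnP 1 (vext g).
    by rewrite arcsE // big_map !big_seq; apply: eq_bigr => x xW; apply: arc_term_numeric.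
  (* With at most one external vertex, the list [after x] is empty and every arc term is 0. *)
  rewrite /arcs ltnNge v1 big_nil big_seq big1 // => x; rewrite mem_iota => hx.
  by rewrite /arc_term after_iota; [rewrite (_ : x = 1%N) /= ?cats0; [have -> : (vext g - 1 = 0)%N by lia|lia]|lia].
rewrite big_add1 /= big_mkcond /= size_iota /edge_sum (big_nth no_edge) scaler_sumr.
by rewrite !big_nat; apply: eq_bigr => k /andP [_ kn]; apply: edge_term_numeric.
Qed.

Lemma coboundary_graph_std W I E : lgraph W I E ->
  coboundary_graph R c (std W I E) = labelled_d W I E.
Proof.
move=> lg; have gg := lgraph_std lg; have uV := lgraph_uniq lg.
rewrite coboundary_graphE // -(labelled_d_map R c (@new_label_inj (W ++ I)) lg).
by have [-> ->] := std_vertices uV.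
Qed.

(** An edge inside the list is moved to the front, reversed there and moved back; both moves have
    the same length, so their signs cancel. *)
Lemma alternating_front (M : lmodType R) (F : predgraph -> M) :
  (forall W I E W', lgraph W I E -> rotation W' W ->
    F (std W' I E) = bsgn R (perm_odd W' W) *: F (std W I E)) ->
  (forall W I E I', lgraph W I E -> perm_eq I' I ->
    F (std W I' E) = bsgn R (is_odd c && perm_odd I' I) *: F (std W I E)) ->
  (forall W I E E', lgraph W I E -> ~~ degen I E -> perm_eq E' E ->
    F (std W I E') = bsgn R (is_even c && perm_odd E' E) *: F (std W I E)) ->
  (forall W I e E, lgraph W I (e :: E) ->
    F (std W I (reverse e :: E)) = bsgn R (is_odd c) *: F (std W I (e :: E))) ->
  (forall W I E, lgraph W I E -> degen I E -> F (std W I E) = 0) ->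
  alternating c F.
Proof.
move=> hr hi he hf hd; split=> // W I E1 e E2 lg.
have [dg|nd] := boolP (degen I (E1 ++ e :: E2)).
  rewrite !hd ?scaler0 ?degen_reverse //; exact: lgraph_reverse.
have p x : perm_eq (E1 ++ x :: E2) (x :: E1 ++ E2) by rewrite -cat1s perm_catCA.
have lg1 : lgraph W I (e :: E1 ++ E2) by rewrite -(lgraph_perm (perm_refl _) (perm_refl _) (p e)).
have lg2 : lgraph W I (reverse e :: E1 ++ E2) by apply: (@lgraph_reverse W I [::] _ e).
have nd1 : ~~ degen I (e :: E1 ++ E2) by rewrite -(degen_perm (perm_refl I) (p e)).
have nd2 : ~~ degen I (reverse e :: E1 ++ E2) by rewrite (degen_reverse I [::] _ e).
have po x : uniq (x :: E1 ++ E2) -> perm_odd (E1 ++ x :: E2) (x :: E1 ++ E2) = odd (size E1).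
  move=> u; have u' : uniq (E1 ++ x :: E2) by rewrite (perm_uniq (p x)).
  by rewrite perm_oddC // perm_odd_pivot.
rewrite (he _ _ _ _ lg1 nd1 (p e)) (he _ _ _ _ lg2 nd2 (p _)) hf //.
by rewrite !po ?(degen_uniq nd1) ?(degen_uniq nd2) // !bsgnZ addbC.
Qed.

Lemma coboundary_alternating : alternating c (coboundary_graph R c).
Proof.
apply: alternating_front.
- move=> W I E W' lg rW; have lg' : lgraph W' I E.
    by rewrite (lgraph_perm (rotation_perm rW) (perm_refl _) (perm_refl _)).
  by rewrite !coboundary_graph_std //; apply: labelled_d_rot.
- move=> W I E I' lg pI; have lg' : lgraph W I' E.
    by rewrite (lgraph_perm (perm_refl _) pI (perm_refl _)).
  by rewrite !coboundary_graph_std // (labelled_d_int R c lg pI).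
- move=> W I E E' lg nd pE; have lg' : lgraph W I E'.
    by rewrite (lgraph_perm (perm_refl _) (perm_refl _) pE).
  by rewrite !coboundary_graph_std // (labelled_d_edge R c lg pE nd).
- move=> W I e E lg; have lg' : lgraph W I (reverse e :: E) by apply: (@lgraph_reverse W I [::] E e).
  by rewrite !coboundary_graph_std //; apply: labelled_d_rev.
- by move=> W I E lg dg; rewrite coboundary_graph_std // /labelled_d dg.
Qed.

Lemma coboundary_cls g : is_graph g -> coboundary R c (cls R c g) = coboundary_graph R c g.
Proof. exact: (induced_cls coboundary_alternating). Qed.

Lemma coboundary_cl W I E : lgraph W I E -> coboundary R c (cl W I E) = labelled_d W I E.
Proof. by move=> lg; rewrite /cl coboundary_cls ?lgraph_std // coboundary_graph_std. Qed.

End CoboundaryGraph.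

(** * The square of the coboundary *)

Lemma edge_ext (e f : edge) : tail e = tail f -> head e = head f -> flipped e = flipped f -> e = f.
Proof. by move: e f => [[p q] u] [[p' q'] u']; rewrite /tail /head /flipped /= => -> -> ->. Qed.

Lemma joins_sym x y e : joins x y e = joins y x e.
Proof. by rewrite /joins orbC. Qed.

Lemma flipped_merge x y e : flipped (merge_ends x y e) = if joins x y e then tail e == y else flipped e.
Proof. by rewrite /merge_ends; case: ifP. Qed.

Lemma joinsE x y e : joins x y e = ((tail e == x) && (head e == y)) || ((tail e == y) && (head e == x)).
Proof. by rewrite /joins !xpair_eqE. Qed.

Lemma eqF (T : eqType) (x y : T) : x != y -> ((x == y) = false) * ((y == x) = false).
Proof. by move=> xy; rewrite [y == x]eq_sym (negbTE xy). Qed.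

(** Three consecutive vertices [x], [y], [q] become one. In either order, the bit of a new loop
    tells that its tail was the later of its two ends in this order. *)
Lemma merge_ends_adjacent x y q e : uniq [:: x; y; q] ->
  merge_ends x q (merge_ends x y e) = merge_ends x y (merge_ends y q e).
Proof.
rewrite /= !inE negb_or => /and3P [/andP [/eqF xy /eqF xq] /eqF yq _].
pose N := (xy, xq, yq, (fun n : nat => eqxx n)).
have C p : [\/ p = x, p = y, p = q | [/\ (p == x) = false, (p == y) = false & (p == q) = false]].
  have [->|] := eqVneq p x; first by constructor 1.
  have [->|] := eqVneq p y; first by constructor 2.
  by have [->|] := eqVneq p q; [constructor 3|constructor 4].
case: e => [[p r] u]; apply: edge_ext;
  rewrite ?flipped_merge ?joinsE ?tail_merge ?head_merge /subst /tail /head /flipped /=.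
- by case: (C p) => [->|->|->|[p1 p2 p3]]; do 3 rewrite ?N ?p1 ?p2 ?p3 /=.
- by case: (C r) => [->|->|->|[p1 p2 p3]]; do 3 rewrite ?N ?p1 ?p2 ?p3 /=.
case: (C p) => [->|->|->|[p1 p2 p3]]; case: (C r) => [->|->|->|[r1 r2 r3]];
by do 3 rewrite ?N ?p1 ?p2 ?p3 ?r1 ?r2 ?r3 /=.
Qed.

Lemma merge_ends_disjoint x y z q e : uniq [:: x; y; z; q] ->
  merge_ends z q (merge_ends x y e) = merge_ends x y (merge_ends z q e).
Proof.
rewrite /= !inE !negb_or => /and4P [/and3P [/eqF xy /eqF xz /eqF xq] /andP [/eqF yz /eqF yq] /eqF zq _].
pose N := (xy, xz, xq, yz, yq, zq, (fun n : nat => eqxx n)).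
have C p : [\/ p = x, p = y, p = z | p = q \/ [/\ (p == x) = false, (p == y) = false, (p == z) = false & (p == q) = false]].
  have [->|] := eqVneq p x; first by constructor 1.
  have [->|] := eqVneq p y; first by constructor 2.
  have [->|] := eqVneq p z; first by constructor 3.
  by have [->|] := eqVneq p q; constructor 4; [left|right].
case: e => [[p r] u]; apply: edge_ext;
  rewrite ?flipped_merge ?joinsE ?tail_merge ?head_merge /subst /tail /head /flipped /=.
- by case: (C p) => [->|->|->|[->|[p1 p2 p3 p4]]]; do 3 rewrite ?N ?p1 ?p2 ?p3 ?p4 /=.
- by case: (C r) => [->|->|->|[->|[p1 p2 p3 p4]]]; do 3 rewrite ?N ?p1 ?p2 ?p3 ?p4 /=.
case: (C p) => [->|->|->|[->|[p1 p2 p3 p4]]]; case: (C r) => [->|->|->|[->|[r1 r2 r3 r4]]];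
by do 3 rewrite ?N ?p1 ?p2 ?p3 ?p4 ?r1 ?r2 ?r3 ?r4 /=.
Qed.

Lemma par_map_preserved (m : nat -> nat) e f : parallel e f -> parallel (map_ends m e) (map_ends m f).
Proof.
rewrite /parallel !tail_map_ends !head_map_ends.
by case/orP => /andP [/eqP -> /eqP ->]; rewrite !eqxx ?orbT.
Qed.

Lemma par_merge x y e f : parallel (merge_ends x y e) (merge_ends x y f) =
  parallel (map_ends (subst y x) e) (map_ends (subst y x) f).
Proof. by rewrite /parallel !tail_merge !head_merge. Qed.

Lemma uniq_map_factor (T T1 T2 : eqType) (g : T -> T1) (h : T -> T2) s :
  {in s &, forall e f, g e = g f -> h e = h f} -> uniq (map h s) -> uniq (map g s).
Proof.
elim: s => //= x s IH gh /andP [xs us]; rewrite IH ?andbT //; last first.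
  by move=> e f es fs; apply: gh; rewrite inE ?es ?fs orbT.
apply: contra xs => /mapP [y ys e]; apply/mapP; exists y => //.
by apply: gh; rewrite ?inE ?eqxx ?ys ?orbT.
Qed.

(** Parallel edges remain parallel, and a loop at an internal vertex is untouched because the merged
    vertices are not internal. *)
Lemma degen_merge x y I E : x \notin I -> y \notin I -> degen I E ->
  degen I (map (merge_ends x y) E).
Proof.
move=> xI yI /orP [nu|/hasP [e eE /andP [le te]]]; last first.
  apply/orP; right; apply/hasP; exists (merge_ends x y e); first exact: map_f.
  rewrite /is_loop tail_merge head_merge -(eqP le) eqxx /= /subst.
  by case: eqP => // ty; rewrite -ty te in yI.
apply/orP; left; apply: contra nu => u.
move: u; rewrite -map_comp; apply: uniq_map_factor => e f _ _ /eqP.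
rewrite ends_eq => p; apply/eqP; rewrite /= ends_eq par_merge.
exact: par_map_preserved.
Qed.

(** * Two arcs contracted in both orders *)

Section ArcArc.
Context (R : realType) (c : parity).
Local Notation cl := (graph_cls R c).
Local Notation arc_term := (arc_contraction R c).

Lemma arc_term_at W I E x y w : uniq W -> rotation (x :: y :: w) W ->
  arc_term W I E x = bsgn R (perm_odd (x :: y :: w) W) *: cl (x :: w) I (map (merge_ends x y) E).
Proof.
move=> uW rW; have e := from_head uW rW.
have xW : x \in W by rewrite -(perm_mem (rotation_perm rW)) mem_head.
by rewrite /arc_term -e fromE //; move: e; rewrite fromE // => -[->].
Qed.

Lemma arc_term1 I E x : arc_term [:: x] I E x = 0.
Proof. by rewrite /arc_term /after /= eqxx. Qed.

(** The arc starting at [x] is contracted before the one starting at [z]. If [z] is the absorbed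
    vertex [y], its outgoing arc now starts at [x]; the case [z = x] would repeat the first arc and
    is set to 0. *)
Definition arc_arc W I E x z : graph_complex R c :=
  if after x W is y :: w then
    if z == x then 0 else
    bsgn R (perm_odd (from x W) W)
      *: arc_term (x :: w) I (map (merge_ends x y) E) (if z == y then x else z)
  else 0.

Lemma arc_arc_at W I E x y w z : uniq W -> rotation (x :: y :: w) W -> z != x ->
  arc_arc W I E x z = bsgn R (perm_odd (x :: y :: w) W)
      *: arc_term (x :: w) I (map (merge_ends x y) E) (if z == y then x else z).
Proof.
move=> uW rW zx; have e := from_head uW rW.
have xW : x \in W by rewrite -(perm_mem (rotation_perm rW)) mem_head.
by rewrite /arc_arc -e fromE //; move: e; rewrite fromE // => -[->]; rewrite (negbTE zx).
Qed.

(** The two orders differ by carrying [x] once around the other vertices, once before and once after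
    [q] has been removed: the two lengths differ by one. *)
Lemma arc_arc_adjacent W I E x y w : uniq (W ++ I) -> rotation (x :: y :: w) W ->
  arc_arc W I E x y = - arc_arc W I E y x.
Proof.
move=> uV rW; have uW : uniq W by move: uV; rewrite cat_uniq => /andP [].
have pW := rotation_perm rW; have ux : uniq (x :: y :: w) by rewrite (perm_uniq pW).
have xy : x != y by apply: (@uniq_adjacent _ [::] x y w).
have yx : y != x by rewrite eq_sym.
have r1 : rotation (y :: w ++ [:: x]) W.
  by rewrite (rotation_eql _ (_ : rotation _ (x :: y :: w))) // (rotation_cat [:: x] (y :: w)).
rewrite (arc_arc_at _ _ uW rW) // eqxx.
case: w => [|q r] in pW ux rW r1 *.
  (* On a circle with two vertices the first contraction leaves no arc. *)
  by rewrite (arc_arc_at _ _ uW r1) // eqxx !arc_term1 !scaler0 oppr0.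
rewrite (arc_arc_at _ _ uW r1) //.
have xq : x == q = false.
  by apply/negbTE; move: ux; rewrite /= !inE !negb_or => /and3P [/and3P []].
rewrite xq; have u1 : uniq (x :: q :: r).
  by move: ux; rewrite (perm_uniq (perm_adjacent [::] x y (q :: r))) => /andP [].
rewrite (arc_term_at _ _ u1 (rotation_refl _)) perm_oddss // bsgn0 scale1r.
have u2 : uniq (y :: r ++ [:: x]).
  have u3 : uniq (y :: q :: r ++ [:: x]) by rewrite (perm_uniq (rotation_perm r1)).
  by apply: subseq_uniq u3; rewrite /= eqxx; apply: subseq_cons.
have r2 : rotation (x :: y :: r) (y :: r ++ [:: x]) by apply: (rotation_cat (y :: r) [:: x]).
rewrite (arc_term_at _ _ u2 r2) bsgnZ -!map_comp.
have -> : map (merge_ends x q \o merge_ends x y) E = map (merge_ends x y \o merge_ends y q) E.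
  apply: eq_map => e /=; apply: merge_ends_adjacent.
  by move: ux; rewrite /= !inE !negb_or => /and3P [/and3P [-> -> _] /andP [-> _]].
rewrite -bsgnN; congr (bsgn R _ *: _).
rewrite (@perm_odd_trans _ (x :: y :: q :: r) (y :: q :: r ++ [:: x])) //; last first.
  by rewrite (perm_trans (rotation_perm r1)) // perm_sym.
have -> : perm_odd (y :: q :: r ++ [:: x]) (x :: y :: q :: r) = odd (size (y :: q :: r) * 1).
  by apply: (@perm_odd_catC _ (y :: q :: r) [:: x]); rewrite uniq_catC.
have -> : perm_odd (x :: y :: r) (y :: r ++ [:: x]) = odd (1 * size (y :: r)).
  by apply: (@perm_odd_catC _ [:: x] (y :: r)); rewrite -(perm_uniq (rotation_perm r2)) in u2.
by rewrite !muln1 !mul1n /=; case: perm_odd; case: odd.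
Qed.

(** With a and b the lengths of [A] and [B], the four block exchanges have lengths (b+2)(a+2),
    (b+2)(a+1), (b+1)(a+2) and (b+1)(a+1); their sum is odd. *)
Lemma arc_arc_disjoint W I E x y A z q B : uniq (W ++ I) ->
  rotation (x :: y :: A ++ z :: q :: B) W ->
  arc_arc W I E x z = - arc_arc W I E z x.
Proof.
move=> uV rW; have uW : uniq W by move: uV; rewrite cat_uniq => /andP [].
have pW := rotation_perm rW; have ux : uniq (x :: y :: A ++ z :: q :: B) by rewrite (perm_uniq pW).
have rz0 : rotation (z :: q :: B ++ x :: y :: A) (x :: y :: A ++ z :: q :: B).
  exact: (rotation_cat (x :: y :: A) (z :: q :: B)).
have rz : rotation (z :: q :: B ++ x :: y :: A) W by rewrite (rotation_eql _ rz0).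
have u4 : uniq [:: x; y; z; q].
  by apply: subseq_uniq ux; rewrite /= !eqxx; apply: (@cat_subseq _ [::] _ A) => //=; rewrite ?sub0seq // !eqxx sub0seq.
have [xz [zy xq]] : x != z /\ z != y /\ x != q.
  by move: u4; rewrite /= !inE !negb_or eq_sym [z == y]eq_sym => /and4P [/and3P [_ -> ->] /andP [-> _] _ _].
have zx : z != x by rewrite eq_sym.
rewrite (arc_arc_at _ _ uW rW) // (negbTE zy).
rewrite (arc_arc_at _ _ uW rz) // (negbTE xq).
have ux1 : uniq (x :: A ++ z :: q :: B).
  by apply: subseq_uniq ux; rewrite /= eqxx; apply: subseq_cons.
have uz1 : uniq (z :: B ++ x :: y :: A).
  have uz : uniq (z :: q :: B ++ x :: y :: A) by rewrite (perm_uniq (rotation_perm rz)).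
  by apply: subseq_uniq uz; rewrite /= eqxx; apply: subseq_cons.
have rx2 : rotation (z :: q :: B ++ x :: A) (x :: A ++ z :: q :: B).
  exact: (rotation_cat (x :: A) (z :: q :: B)).
have rz2 : rotation (x :: y :: A ++ z :: B) (z :: B ++ x :: y :: A).
  exact: (rotation_cat (z :: B) (x :: y :: A)).
rewrite (arc_term_at _ _ ux1 rx2) (arc_term_at _ _ uz1 rz2) -!map_comp.
have -> : map (merge_ends z q \o merge_ends x y) E = map (merge_ends x y \o merge_ends z q) E.
  by apply: eq_map => e; apply: merge_ends_disjoint.
have r3 : rotation (z :: B ++ x :: A) (x :: A ++ z :: B) by exact: (rotation_cat (x :: A) (z :: B)).
have pxW : perm_eq (x :: y :: q :: A ++ z :: B) W.
  apply: perm_trans pW; rewrite !perm_cons.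
  have h : perm_eq ([:: q] ++ rcons A z ++ B) (rcons A z ++ [:: q] ++ B) by rewrite perm_catCA.
  by rewrite !cat_rcons in h.
have u5 : uniq ((x :: A ++ z :: B) ++ I).
  move: uV; rewrite -(perm_uniq (perm_cat pxW (perm_refl I))).
  apply: subseq_uniq; apply: (@cat_subseq _ [:: x] ((A ++ z :: B) ++ I) [:: x; y; q]) => //.
  by rewrite /= eqxx.
rewrite (cl_rot R c _ u5 r3) !bsgnZ -bsgnN; congr (bsgn R _ *: _).
rewrite (@perm_odd_trans _ (x :: y :: A ++ z :: q :: B) (z :: q :: B ++ x :: y :: A)) ?(rotation_perm rz0) //.
have -> : perm_odd (z :: q :: B ++ x :: y :: A) (x :: y :: A ++ z :: q :: B)
   = odd (size (z :: q :: B) * size (x :: y :: A)).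
  by apply: (@perm_odd_catC _ (z :: q :: B) (x :: y :: A)); rewrite uniq_catC.
have -> : perm_odd (z :: q :: B ++ x :: A) (x :: A ++ z :: q :: B)
   = odd (size (z :: q :: B) * size (x :: A)).
  by apply: (@perm_odd_catC _ (z :: q :: B) (x :: A)); rewrite uniq_catC.
have -> : perm_odd (x :: y :: A ++ z :: B) (z :: B ++ x :: y :: A)
   = odd (size (x :: y :: A) * size (z :: B)).
  by apply: (@perm_odd_catC _ (x :: y :: A) (z :: B)); rewrite uniq_catC.
have -> : perm_odd (z :: B ++ x :: A) (x :: A ++ z :: B) = odd (size (z :: B) * size (x :: A)).
  apply: (@perm_odd_catC _ (z :: B) (x :: A)); rewrite uniq_catC.
  by move: u5; rewrite cat_uniq => /andP [].
rewrite !oddM /=; case: perm_odd; case: (odd (size A)); case: (odd (size B)) => //.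
Qed.

Lemma arc_arc_anti W I E x z : uniq (W ++ I) -> x \in W -> z \in W ->
  arc_arc W I E x z = - arc_arc W I E z x.
Proof.
move=> uV xW zW; have uW : uniq W by move: uV; rewrite cat_uniq => /andP [].
have [->|zx] := eqVneq z x.
  by rewrite /arc_arc eqxx; case: (after x W) => [|y w]; rewrite oppr0.
have rx : rotation (x :: after x W) W by rewrite -fromE // from_rotation.
have zA : z \in after x W.
  by move: zW; rewrite -(perm_mem (rotation_perm rx)) inE (negbTE zx).
case: (after x W) zA rx => [//|y w] zA rx.
move: zA; rewrite inE => /predU1P [->|zw]; first exact: arc_arc_adjacent rx.
case/splitPr: zw rx => A [|q B] rx; last exact: arc_arc_disjoint rx.
(* Nothing follows [z], so its successor on the circle is [x]: this is the adjacent case with the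
   roles exchanged. *)
apply/eqP; rewrite -eqr_oppLR; apply/eqP; symmetry.
apply: (@arc_arc_adjacent _ _ _ z x (y :: A)) => //.
rewrite (rotation_eql _ (_ : rotation _ (x :: y :: A ++ [:: z]))) //.
exact: (rotation_cat (x :: y :: A) [:: z]).
Qed.

Lemma antisym_sum (T : eqType) (V : lmodType R) (s : seq T) (F : T -> T -> V) :
  {in s &, forall x z, F x z = - F z x} -> \sum_(x <- s) \sum_(z <- s) F x z = 0.
Proof.
move=> anti; apply: (@opp_fixed0 R); rewrite {1}exchange_big /= -sumrN.
rewrite !big_seq; apply: eq_bigr => x xs; rewrite -sumrN !big_seq.
by apply: eq_bigr => z zs; apply: anti.
Qed.

Lemma arc_sum_square W I E : uniq (W ++ I) ->
  \sum_(x <- W) (if after x W is y :: w then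
    bsgn R (perm_odd (from x W) W) *: arc_sum R c (x :: w) I (map (merge_ends x y) E) else 0) = 0.
Proof.
move=> uV; have uW : uniq W by move: uV; rewrite cat_uniq => /andP [].
rewrite -[RHS](@antisym_sum _ _ W (arc_arc W I E)) => [|x z xW zW]; last exact: arc_arc_anti.
rewrite !big_seq; apply: eq_bigr => x xW.
have pW := perm_after xW; rewrite -(perm_big _ pW) /= /arc_arc.
case aE : (after x W) => [|y w] in pW *; first by rewrite big_cons big_nil addr0.
have ux : uniq (x :: y :: w) by rewrite (perm_uniq pW).
have yx : y != x by rewrite eq_sym; apply: (@uniq_adjacent _ [::] x y w).
(* The term [z = x] is 0, and the term [z = y] supplies the arc leaving [x] in the contracted
   circle. *)
rewrite !big_cons eqxx add0r (negbTE yx) eqxx /arc_sum big_cons scalerDr; congr (_ + _).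
rewrite scaler_sumr !big_seq; apply: eq_bigr => z zw.
have zx : z != x by apply: contraTneq ux => <-; rewrite /= inE zw orbT.
have zy : z != y by apply: contraTneq ux => <-; rewrite /= zw andbF.
by rewrite (negbTE zx) (negbTE zy).
Qed.
End ArcArc.

(** * Two edges contracted in both orders *)

Definition contracted (I : seq nat) (e : edge) : nat := if tail e \in I then tail e else head e.
(** [contracted] and [target] follow the branches of [edge_term]: for an edge with two internal ends
    the tail is removed. *)
Definition target (I : seq nat) (e : edge) : nat := if tail e \in I then head e else tail e.
Definition regular (I : seq nat) (e : edge) : bool := (tail e \in I) || (head e \in I).

Lemma oriented_contracted I e : oriented (tail e \notin I) (contracted I e) (target I e) e.
Proof. by rewrite /oriented /contracted /target; case: (tail e \in I) => /=; rewrite !eqxx. Qed.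

Lemma contracted_in I e : regular I e -> contracted I e \in I.
Proof. by rewrite /regular /contracted; case: ifP. Qed.

Lemma oriented_par r q a t b s e f : oriented r a t e -> oriented q b s f ->
  parallel e f = ((a == b) && (t == s)) || ((a == s) && (t == b)).
Proof.
rewrite /oriented /parallel => /andP [/eqP -> /eqP ->] /andP [/eqP -> /eqP ->].
by case: r; case: q; rewrite // ?[(t == _) && _]andbC 1?orbC.
Qed.

Lemma oriented_map_ends m r a t e : oriented r a t e -> oriented r (m a) (m t) (map_ends m e).
Proof.
rewrite /oriented tail_map_ends head_map_ends => /andP [/eqP -> /eqP ->].
by case: r; rewrite !eqxx.
Qed.

Lemma oriented_not r a t e : oriented (~~ r) t a e = oriented r a t e.
Proof. by rewrite /oriented; case: r. Qed.

(** Two contractions removing different vertices. The excluded configuration, [s = a] and [t = b],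
    is that of two edges both joining [a] and [b]. *)
Lemma subst_comm a t b s x : a != b -> t != a -> s != b -> ~~ ((s == a) && (t == b)) ->
  subst b (subst a t s) (subst a t x) = subst a (subst b s t) (subst b s x).
Proof.
rewrite /subst => ab ta bsgn h; have [->|xa] := eqVneq x a.
  rewrite (negbTE ab) eqxx; have [etb|ntb] := eqVneq t b => //.
  by move: h; rewrite etb eqxx andbT => /negbTE ->.
have [_|xb] := eqVneq x b.
  have [esa|nsa] := eqVneq s a.
    by move: h; rewrite esa eqxx /= => /negbTE ->.
  by rewrite ?(negbTE nsa).
by rewrite ?(negbTE xa) ?(negbTE xb).
Qed.

(** Two edges issue from the same vertex [a], towards [t] and [s]. Once one of them is contracted
    the other joins [t] and [s]; in either order [a] and [t] end up at [s]. *)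
Lemma subst_comm1 a t s x : t != s -> a != s -> 
  subst t s (subst a t x) = subst t s (subst a s x).
Proof.
rewrite /subst => ts as_; have [_|xa] := eqVneq x a => //.
by rewrite eqxx [s == t]eq_sym (negbTE ts).
Qed.

Lemma not_uniq_map (T T' : eqType) (g : T -> T') (s : seq T) : uniq s -> ~~ uniq (map g s) ->
  exists x y, [/\ x \in s, y \in s, x != y & g x = g y].
Proof.
elim: s => //= x s IH /andP [xs us]; rewrite negb_and negbK => /orP [/mapP [y ys e]|/IH].
  exists x, y; rewrite mem_head inE ys orbT e; split => //.
  by apply: contraNneq xs => ->.
case=> // y [z [ys zs ne e]]; exists y, z; split => //; by rewrite inE ?ys ?zs orbT.
Qed.

(* A contraction creates a degeneracy only by making two sides of a triangle parallel. *)
Lemma degen_ctr I E r a t e : ~~ degen I E -> e \in E -> oriented r a t e -> a \in I ->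
  degen (rem a I) (contract a t (rem e E)) ->
  exists g h, [/\ g \in rem e E, h \in rem e E, g != h &
                  parallel (map_ends (subst a t) g) (map_ends (subst a t) h)].
Proof.
move=> nd eE o aI; have uE := degen_uniq nd; case/orP => [nu|/hasP [_ /mapP [g gE ->]]].
  rewrite /contract -map_comp in nu; have [g [h [gE hE ne e0]]] := not_uniq_map (rem_uniq _ uE) nu.
  by exists g, h; split => //; rewrite -ends_eq; apply/eqP.
have gE' := mem_rem gE; rewrite /is_loop tail_map_ends head_map_ends => /andP [lg tg].
have np : ~~ parallel e g.
  apply/negP => p; have eg := degen_par nd eE gE' p.
  by move: gE; rewrite -eg mem_rem_uniqF.
have at_ := oriented_neq nd eE o aI.
have lg' : is_loop g by rewrite -(loop_subst o at_ np).
case/norP: nd => _ /hasPn /(_ g gE'); rewrite lg' /= => tgI.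
have ga : tail g != a by apply: contraNneq tgI => ->.
by move: (mem_rem tg); rewrite /subst (negbTE ga) (negbTE tgI).
Qed.

(** If contracting [e] makes [f] and [h] parallel, these two share a vertex and their other ends are
    the ends of [e]. The three edges form a triangle, a condition symmetric in them. *)
Lemma triangle r q a t b s e f h : oriented r a t e -> oriented q b s f ->
  a != t -> b != s -> ~~ parallel e f -> ~~ parallel e h -> ~~ parallel f h ->
  parallel (map_ends (subst a t) f) (map_ends (subst a t) h) ->
  parallel (map_ends (subst b s) e) (map_ends (subst b s) h).
Proof.
move=> oe of_; have oh : oriented false (tail h) (head h) h by rewrite /oriented !eqxx.
rewrite (oriented_par oe of_) (oriented_par oe oh) (oriented_par of_ oh).
rewrite (oriented_par (oriented_map_ends (subst a t) of_) (oriented_map_ends _ oh)).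
rewrite (oriented_par (oriented_map_ends (subst b s) oe) (oriented_map_ends _ oh)).
move: (tail h) (head h) => u v {oe of_ oh}.
have key x y : subst a t x = subst a t y -> [\/ x = y, x = a /\ y = t | x = t /\ y = a].
  rewrite /subst; have [->|xa] := eqVneq x a; have [->|ya] := eqVneq y a => //.
  - by move=> _; constructor 1.
  - by move=> <-; constructor 2.
  - by move=> ->; constructor 3.
  - by move=> ->; constructor 1.
have S1 : subst b s b = s by rewrite /subst eqxx.
have S2 : subst b s s = s by rewrite /subst; case: eqP.
have np i j k l : ~~ ((i == j) && (k == l) || (i == l) && (k == j)) ->
    (i = j -> k = l -> False) /\ (i = l -> k = j -> False).
  by move=> hn; split=> e1 e2; move: hn; rewrite e1 e2 !eqxx ?orbT.
move=> /eqP at_ /eqP bs /np [n1 n2] /np [n3 n4] /np [n5 n6].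
case/orP => /andP [/eqP /key k1 /eqP /key k2].
all: case: k1 => [?|[? ?]|[? ?]]; case: k2 => [?|[? ?]|[? ?]].
all: clear key np; subst; rewrite ?S1 ?S2 ?eqxx ?orbT //; exfalso; tauto.
Qed.

Section EdgeEdge.
Context (R : realType) (c : parity).
Local Notation cl := (graph_cls R c).
Local Notation edge_term := (edge_term R c).

Definition edge_sign I E e : R :=
  bsgn R ((is_odd c && ((tail e \notin I) (+) odd (index (contracted I e) I)))
        (+) (is_even c && odd (index e E))).

Lemma edge_termE W I E e : regular I e ->
  edge_term W I E e = edge_sign I E e *:
    cl W (rem (contracted I e) I) (contract (contracted I e) (target I e) (rem e E)).
Proof.
rewrite /edge_term /edge_sign /regular /contracted /target.
by case: (tail e \in I) => //= ->.
Qed.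

(** The value 0 after a degenerate first contraction reflects the convention in [labelled_d]; the
    loss of symmetry this may cause is repaired by [edge_edge_flag]. *)
Definition edge_edge W I E e f : graph_complex R c :=
  let I' := rem (contracted I e) I in
  let E' := contract (contracted I e) (target I e) (rem e E) in
  if (f == e) || ~~ regular I e || degen I' E' then 0 else
  edge_sign I E e *: edge_term W I' E' (map_ends (subst (contracted I e) (target I e)) f).

Lemma edge_edge_front W I E e f q b s J K :
  lgraph W I E -> ~~ degen I E -> e \in E -> f \in E -> f != e -> regular I e ->
  let a := contracted I e in let t := target I e in let r := tail e \notin I in
  ~~ degen (rem a I) (contract a t (rem e E)) ->
  oriented q b s (map_ends (subst a t) f) -> perm_eq (a :: b :: J) I -> perm_eq (e :: f :: K) E ->
  edge_edge W I E e f =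
  bsgn R ((is_odd c && (r (+) q (+) perm_odd (a :: b :: J) I)) (+) (is_even c && perm_odd (e :: f :: K) E))
   *: cl W J (contract b s (contract a t K)).
Proof.
move=> lg nd eE fE fe reg a t r nd' o pI pE.
rewrite /edge_edge (negbTE fe) reg (negbTE nd') /=.
have aI : a \in I by apply: contracted_in.
have uI : uniq I by move: (lgraph_uniq lg); rewrite cat_uniq => /and3P [].
have uE := degen_uniq nd.
have p1 : perm_eq (a :: rem a I) I by rewrite perm_sym perm_to_rem.
have p2 : perm_eq (e :: rem e E) E by rewrite perm_sym perm_to_rem.
have oe := oriented_contracted I e; have at_ := oriented_neq nd eE oe aI.
have lg' : lgraph W (rem a I) (contract a t (rem e E)).
  by apply: lgraph_ctr oe at_; rewrite (lgraph_perm (perm_refl _) p1 p2).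
have pI' : perm_eq (b :: J) (rem a I) by apply: perm_rem_front.
have pE' : perm_eq (f :: K) (rem e E) by apply: perm_rem_front.
have pm : perm_eq (map_ends (subst a t) f :: contract a t K) (contract a t (rem e E)).
  exact: (perm_map (map_ends (subst a t)) pE').
rewrite (edge_term_front R c lg' nd' o pI' pm) /edge_sign -/a -/r -/t bsgnZ.
congr (bsgn R _ *: _); have um : uniq (contract a t (rem e E)) := degen_uniq nd'.
rewrite -[_ :: contract a t K]/(map (map_ends (subst a t)) (f :: K)) perm_odd_map //; last exact: uniq_map_inj um.
rewrite (perm_odd_front uI pI) (perm_odd_front uE pE).
move: (odd (index a I)) (odd (index e E)) (perm_odd (b :: J) _) (perm_odd (f :: K) _) (is_odd c) (is_even c) (r) (q).
by do 8 case.
Qed.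

Lemma perm_two (T : eqType) (x y : T) s : x \in s -> y \in s -> x != y ->
  perm_eq (x :: y :: rem y (rem x s)) s.
Proof.
move=> xs ys xy; rewrite perm_sym; apply: perm_trans (perm_to_rem xs) _.
rewrite perm_cons; apply: perm_to_rem; apply: rem_mem => //.
by rewrite eq_sym.
Qed.

Lemma perm_odd_two (T : eqType) (x y : T) s t : uniq t -> perm_eq (x :: y :: s) t ->
  perm_odd (y :: x :: s) t = ~~ perm_odd (x :: y :: s) t.
Proof.
move=> ut p; have u : uniq (x :: y :: s) by rewrite (perm_uniq p).
rewrite -[y :: _]cat0s perm_odd_swap //; last by rewrite -(perm_mem p) !inE eqxx orbT.
by rewrite eq_sym; apply: (@uniq_adjacent _ [::] x y s).
Qed.

(** Contracting [e] creates a parallel pair. If [f] belonged to it, [triangle] would make the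
    contraction of [f] degenerate too. So the pair survives among the edges [K], and any [m]
    factoring through the contraction of [e] keeps it parallel. *)
Lemma edge_edge_flag W I E e f J K : lgraph W I E -> ~~ degen I E -> e \in E -> f \in E -> f != e ->
  regular I e -> regular I f ->
  let a := contracted I e in let t := target I e in
  let b := contracted I f in let s := target I f in
  forall m, uniq (W ++ J) -> perm_eq (e :: f :: K) E ->
  (forall g h, parallel (map_ends (subst a t) g) (map_ends (subst a t) h) -> parallel (map_ends m g) (map_ends m h)) ->
  degen (rem a I) (contract a t (rem e E)) -> ~~ degen (rem b I) (contract b s (rem f E)) ->
  cl W J (map (map_ends m) K) = 0.
Proof.
move=> lg nd eE fE fe re rf a t b s m uJ pE mp dg nd'.
have uE := degen_uniq nd.
have oe := oriented_contracted I e; have of_ := oriented_contracted I f.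
have aI : a \in I := contracted_in re; have bI : b \in I := contracted_in rf.
have at_ : a != t := oriented_neq nd eE oe aI; have bs : b != s := oriented_neq nd fE of_ bI.
have [g [h [gE hE ne p]]] := degen_ctr nd eE oe aI dg.
have np x y : x \in E -> y \in E -> x != y -> ~~ parallel x y.
  by move=> xE yE; apply: contra => pxy; rewrite (degen_par nd xE yE pxy).
have tri h' : h' \in rem e E -> h' != f ->
    parallel (map_ends (subst a t) f) (map_ends (subst a t) h') -> cl W J (map (map_ends m) K) = 0.
  move=> hE' hf p'; case/negP: nd'.
  have he : h' != e by move: hE'; rewrite mem_rem_uniq // inE => /andP [].
  have hEE := mem_rem hE'; have ef : e != f by rewrite eq_sym.
  apply: (@map_degen _ _ _ e h'); rewrite ?mem_rem_uniq ?inE ?ef ?hf ?eE ?hEE // 1?eq_sym //.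
  apply: (triangle oe of_) => //; apply: np => //; by rewrite eq_sym.
have [gf|gf] := eqVneq g f; first by apply: (tri h) => //; rewrite -?gf // eq_sym.
have [hf|hf] := eqVneq h f; first by apply: (tri g) => //; rewrite -hf parC.
have inK x : x \in rem e E -> x != f -> x \in K.
  by rewrite -(perm_mem (perm_rem_front pE)) inE => /predU1P [->|//]; rewrite eqxx.
apply: cl_degen => //; apply: (@map_degen (map_ends m) J K g h) => //; first exact: inK.
  exact: inK.
exact: mp.
Qed.

(** In the even case the sign comes from exchanging [e] and [f]. In the odd case it comes from
    exchanging the two removed vertices or, when both edges share the removed vertex, from the
    opposite directions in which the remaining side is traversed. *)
Lemma edge_edge_anti W I E e f : lgraph W I E -> ~~ degen I E -> e \in E -> f \in E ->
  edge_edge W I E e f = - edge_edge W I E f e.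
Proof.
move=> lg nd eE fE.
have uV := lgraph_uniq lg; have uE := degen_uniq nd.
have uI : uniq I by move: uV; rewrite cat_uniq => /and3P [].
have [->|fe] := eqVneq f e; first by rewrite /edge_edge eqxx oppr0.
have ef : e != f by rewrite eq_sym.
have npar : ~~ parallel e f by apply: contra ef => p; rewrite (degen_par nd eE fE p).
have nreg0 x y : x \in E -> y \in E -> x != y -> ~~ regular I x -> edge_edge W I E y x = 0.
  move=> xE yE xy nx; rewrite /edge_edge; case: ifP => // /norP [/norP [_ ry _]].
  rewrite negbK in ry; rewrite edge_term0 ?scaler0 //.
  have aI := contracted_in ry; case/norP: nx => tx hx.
  have ta : tail x != contracted I y by apply: contraNneq tx => ->.
  have ha : head x != contracted I y by apply: contraNneq hx => ->.
  rewrite tail_map_ends head_map_ends /subst (negbTE ta) (negbTE ha).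
  by apply/norP; split; [apply: contra tx => /mem_rem|apply: contra hx => /mem_rem].
have nreg1 x y : ~~ regular I x -> edge_edge W I E x y = 0.
  by move=> nx; rewrite /edge_edge nx orbT.
have [re|nre] := boolP (regular I e); last by rewrite nreg1 // (nreg0 e f) ?oppr0.
have [rf|nrf] := boolP (regular I f); last by rewrite (nreg0 f e) // nreg1 ?oppr0.
pose a := contracted I e; pose t := target I e; pose r := tail e \notin I.
pose b := contracted I f; pose s := target I f; pose q := tail f \notin I.
have oe : oriented r a t e := oriented_contracted I e.
have of_ : oriented q b s f := oriented_contracted I f.
have aI : a \in I := contracted_in re; have bI : b \in I := contracted_in rf.
have at_ : a != t := oriented_neq nd eE oe aI; have bs : b != s := oriented_neq nd fE of_ bI.
pose K := rem f (rem e E); have pK : perm_eq (e :: f :: K) E by apply: perm_two.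
have pK' : perm_eq (f :: e :: K) E by apply: perm_trans pK; apply: (perm_adjacent [::]).
have conv x y z w : (forall k, subst x y (subst a t k) = subst z w (subst b s k)) ->
    contract x y (contract a t K) = contract z w (contract b s K).
  by move=> h; rewrite /contract -!map_comp; apply: eq_map => k /=; rewrite !map_ends_comp /map_ends /= !h.
have vanish J x y z w : uniq (W ++ J) ->
    (forall k, subst x y (subst a t k) = subst z w (subst b s k)) ->
    degen (rem a I) (contract a t (rem e E)) != degen (rem b I) (contract b s (rem f E)) ->
    cl W J (contract x y (contract a t K)) = 0.
  move=> uJ h; rewrite (conv _ _ _ _ h).
  have [de|ne] := boolP (degen (rem a I) _); have [df|nf] := boolP (degen (rem b I) _) => // _.
    rewrite -(conv _ _ _ _ h) /contract -map_comp.
    apply: (edge_edge_flag lg nd eE fE fe re rf (m := fun k => subst x y (subst a t k))) uJ pK _ de nf.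
    by move=> g g' p; apply: (@par_map_preserved (subst x y)) p.
  rewrite /contract -map_comp.
  apply: (edge_edge_flag lg nd fE eE ef rf re (m := fun k => subst z w (subst b s k))) uJ pK' _ df ne.
  by move=> g g' p; apply: (@par_map_preserved (subst z w)) p.
have uJ J x y : perm_eq (x :: y :: J) I -> uniq (W ++ J).
  move=> p; move: uV; rewrite -(perm_uniq (perm_cat (perm_refl W) p)).
  by apply: subseq_uniq; apply: cat_subseq => //; apply: subseq_trans (subseq_cons _ _); apply: subseq_cons.
(* The common end of all cases: both orders are written with the same list [J] of remaining internal
   vertices, and it suffices that the composite substitutions agree and that the vertex signs are
   opposite. *)
have fin x y z w J q1 r1 (p1 : perm_eq (a :: x :: J) I) (p2 : perm_eq (b :: z :: J) I) :
    (forall k, subst x y (subst a t k) = subst z w (subst b s k)) ->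
    oriented q1 x y (map_ends (subst a t) f) -> oriented r1 z w (map_ends (subst b s) e) ->
    (r (+) q1 (+) perm_odd (a :: x :: J) I) = ~~ (q (+) r1 (+) perm_odd (b :: z :: J) I) ->
    edge_edge W I E e f = - edge_edge W I E f e.
  move=> hm o1 o2 sg.
  have e1 : ~~ degen (rem a I) (contract a t (rem e E)) -> edge_edge W I E e f = _ :=
    fun h => edge_edge_front lg nd eE fE fe re h o1 p1 pK.
  have e2 : ~~ degen (rem b I) (contract b s (rem f E)) -> edge_edge W I E f e = _ :=
    fun h => edge_edge_front lg nd fE eE ef rf h o2 p2 pK'.
  have z1 : degen (rem a I) (contract a t (rem e E)) -> edge_edge W I E e f = 0.
    by move=> h; rewrite /edge_edge h orbT.
  have z2 : degen (rem b I) (contract b s (rem f E)) -> edge_edge W I E f e = 0.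
    by move=> h; rewrite /edge_edge h orbT.
  have van := vanish J x y z w (uJ _ _ _ p1) hm.
  have [de|ne] := boolP (degen (rem a I) (contract a t (rem e E)));
  have [df|nf] := boolP (degen (rem b I) (contract b s (rem f E))).
  - by rewrite z1 // z2 // oppr0.
  - by rewrite z1 // e2 // -(conv _ _ _ _ hm) van ?de ?(negbTE nf) // scaler0 oppr0.
  - by rewrite z2 // e1 // van ?df ?(negbTE ne) // scaler0 oppr0.
  rewrite e1 // e2 // (conv _ _ _ _ hm) -bsgnN -/a -/b -/r -/q; congr (bsgn R _ *: _).
  rewrite sg (perm_odd_two uE pK) /is_even.
  by move: (perm_odd (b :: z :: J) I) (perm_odd (e :: f :: K) E) (is_odd c) (q) (r1); do 5 case.
have [ab|ab] := eqVneq a b; last first.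
  pose J := rem b (rem a I); have pJ : perm_eq (a :: b :: J) I by apply: perm_two.
  have pJ' : perm_eq (b :: a :: J) I by apply: perm_trans pJ; apply: (perm_adjacent [::]).
  have nst : ~~ ((s == a) && (t == b)).
    apply: contra npar => /andP [/eqP sa /eqP tb].
    by rewrite (oriented_par oe of_) sa tb !eqxx orbT.
  apply: (fin b (subst a t s) a (subst b s t) J q r pJ pJ').
  - by move=> k; apply: subst_comm; rewrite // eq_sym.
  - by have := oriented_map_ends (subst a t) of_; rewrite {1}/subst eq_sym (negbTE ab).
  - by have := oriented_map_ends (subst b s) oe; rewrite {1}/subst (negbTE ab).
  - by rewrite (perm_odd_two uI pJ); move: (r) (q) (perm_odd (a :: b :: J) I); do 3 case.
(* From here on both edges remove the same vertex; their other ends differ, as otherwise the edges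
   would be parallel. *)
have ts : t != s.
  apply: contra npar => /eqP ts; by rewrite (oriented_par oe of_) ab ts !eqxx.
have tsa : subst a t s = s by rewrite /subst ab eq_sym (negbTE bs).
have stb : subst b s t = t by rewrite /subst -ab eq_sym (negbTE at_).
have o1 : oriented q t s (map_ends (subst a t) f).
  by have := oriented_map_ends (subst a t) of_; rewrite tsa /subst ab eqxx.
have o2 : oriented r s t (map_ends (subst b s) e).
  by have := oriented_map_ends (subst b s) oe; rewrite stb /subst ab eqxx.
(* The second contraction can remove [t] in both orders. Then [f] keeps its direction bit, while
   [e], seen from [t] instead of [a], has it negated. *)
have [tI|tI] := boolP (t \in I).
  pose J := rem t (rem a I); have pJ : perm_eq (a :: t :: J) I by apply: perm_two.
  have pJ' : perm_eq (b :: t :: J) I by rewrite -ab.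
  apply: (fin t s t s J q (~~ r) pJ pJ') => //.
  - by move=> k; rewrite -ab; apply: subst_comm1 => //; rewrite ab.
  - by rewrite oriented_not.
  - by rewrite -ab; move: (r) (q) (perm_odd _ I); do 3 case.
have [sI|sI] := boolP (s \in I).
  have as_ : a != s by rewrite ab.
  pose J := rem s (rem a I); have pJ : perm_eq (a :: s :: J) I by apply: perm_two.
  have pJ' : perm_eq (b :: s :: J) I by rewrite -ab.
  apply: (fin s t s t J (~~ q) r pJ pJ') => //.
  - by move=> k; rewrite -ab; symmetry; apply: subst_comm1 => //; rewrite eq_sym.
  - by rewrite oriented_not.
  - by rewrite -ab; move: (r) (q) (perm_odd _ I); do 3 case.
(* If neither [t] nor [s] is internal, the edge left over is no longer regular and both double terms
   are 0. *)
have irr x y z u p : oriented p x y u -> x \notin I -> y \notin I -> ~~ regular (rem z I) u.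
  rewrite /oriented /regular => /andP [/eqP -> /eqP ->] xI yI.
  have n v : v \notin I -> v \notin rem z I by apply: contra; apply: mem_rem.
  by case: p; apply/norP; split; apply: n.
rewrite /edge_edge -/a -/b -/t -/s.
rewrite (edge_term0 R c W _ (irr t s a _ _ o1 tI sI)) (edge_term0 R c W _ (irr s t b _ _ o2 sI tI)).
by rewrite !scaler0 !if_same oppr0.
Qed.

Lemma edge_sum_square W I E : lgraph W I E -> ~~ degen I E ->
  \sum_(e <- E) (if regular I e && ~~ degen (rem (contracted I e) I) (contract (contracted I e) (target I e) (rem e E))
    then edge_sign I E e *: edge_sum R c W (rem (contracted I e) I) (contract (contracted I e) (target I e) (rem e E))
    else 0) = 0.
Proof.
move=> lg nd; have uE := degen_uniq nd.
rewrite -[RHS](@antisym_sum _ _ _ E (edge_edge W I E)) => [|e f eE fE]; last exact: edge_edge_anti.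
rewrite !big_seq; apply: eq_bigr => e eE.
rewrite (perm_big _ (perm_to_rem eE)) /= big_cons {1}/edge_edge eqxx add0r.
have ne f : f \in rem e E -> f != e by rewrite mem_rem_uniq // inE => /andP [].
case: ifPn => [/andP [re nd']|h]; last first.
  rewrite big_seq big1 // => f /ne /negbTE fe; rewrite /edge_edge fe /=.
  by move: h; rewrite negb_and negbK => ->.
rewrite /edge_sum big_map scaler_sumr !big_seq; apply: eq_bigr => f /ne /negbTE fe.
by rewrite /edge_edge fe re (negbTE nd').
Qed.
End EdgeEdge.

(** * An arc and an edge contracted in both orders *)

Lemma uniq_consl (W J : seq nat) a : uniq (W ++ a :: J) -> uniq (W ++ J).
Proof. by apply: subseq_uniq; apply: cat_subseq => //; apply: subseq_cons. Qed.

Lemma merge_subst_comm x y a t z : a != x -> a != y ->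
  subst y x (subst a t z) = subst a (subst y x t) (subst y x z).
Proof.
rewrite /subst => ax ay; have [->|za] := eqVneq z a.
  by rewrite (negbTE ay) eqxx.
have [_|zy] := eqVneq z y; first by rewrite [x == a]eq_sym (negbTE ax).
by rewrite ?(negbTE za).
Qed.

Lemma oriented_joins r a t x y e : oriented r a t e ->
  joins x y e = ((a == x) && (t == y)) || ((a == y) && (t == x)).
Proof.
rewrite joinsE /oriented => /andP [/eqP -> /eqP ->].
by case: r; rewrite // ![(t == _) && _]andbC orbC.
Qed.

Lemma merge_not_joins x y e : ~~ joins x y e -> merge_ends x y e = map_ends (subst y x) e.
Proof. by rewrite /merge_ends => /negbTE ->. Qed.

Section Mixed.
Context (R : realType) (c : parity).
Local Notation cl := (graph_cls R c).
Local Notation arc_term := (arc_contraction R c).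
Local Notation edge_term := (edge_term R c).
Local Notation edge_sign := (edge_sign R c).

(** A degeneracy persists when an arc is contracted, so sums over arcs vanish on degenerate graphs
    without any test. *)
Lemma arc_sum_degen W I E : uniq (W ++ I) -> degen I E -> arc_sum R c W I E = 0.
Proof.
move=> uV dg; rewrite /arc_sum big_seq big1 // => x xW; rewrite /arc_term.
case aE : (after x W) => [|y w] //; have [u1 u2 xy] := uniq_after uV xW aE.
rewrite cl_degen ?scaler0 // degen_merge //; move: u1; rewrite /= inE mem_cat !negb_or.
  by case/andP => /and3P [].
by rewrite mem_cat negb_or => /andP [_ /andP [/andP []]].
Qed.

Lemma loop_flip W I (x : nat) b E : uniq (W ++ I) ->
  cl W I ((x, x, b) :: E) = bsgn R (is_odd c && b) *: cl W I ((x, x, false) :: E).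
Proof.
move=> uV; case: b; last by rewrite andbF bsgn0 scale1r.
have h := @cl_rev0 R c W I (x, x, false) E uV isT; rewrite andbT -h; congr (graph_cls R c _ _ (_ :: _)).
by rewrite /reverse /is_loop /tail /head /= eqxx.
Qed.

(** The edge comes first here. A degenerate intermediate graph needs no separate case, by
    [arc_sum_degen]; in [arc_edge], with the arc first, it does. *)
Definition edge_arc W I E e x : graph_complex R c :=
  if regular I e then edge_sign I E e *:
    arc_term W (rem (contracted I e) I) (contract (contracted I e) (target I e) (rem e E)) x
  else 0.

Definition arc_edge W I E x e : graph_complex R c :=
  if after x W is y :: w then
    if degen I (map (merge_ends x y) E) then 0 else
    bsgn R (perm_odd (from x W) W) *: edge_term (x :: w) I (map (merge_ends x y) E) (merge_ends x y e)
  else 0.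

Lemma regular_merge x y I e : x \notin I -> y \notin I -> regular I (merge_ends x y e) = regular I e.
Proof.
move=> xI yI; have h z : (subst y x z \in I) = (z \in I).
  by rewrite /subst; case: eqP => // ->; rewrite (negbTE xI) (negbTE yI).
by rewrite /regular tail_merge head_merge !h.
Qed.

Lemma merge_loop_external x y I e : x \notin I -> y \notin I -> is_loop (merge_ends x y e) ->
  regular I e -> is_loop e.
Proof.
move=> xI yI; rewrite /is_loop tail_merge head_merge /regular /subst.
have [->|ty] := eqVneq (tail e) y; have [->|hy] := eqVneq (head e) y; rewrite ?eqxx //.
  by rewrite (negbTE yI) /= => /eqP <-; rewrite (negbTE xI).
by rewrite (negbTE yI) orbF => /eqP ->; rewrite (negbTE xI).
Qed.

(** The two signs live on different lists, [W] for the arc, [I] and [E] for the edge, so the terms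
    are equal and not opposite. They cancel only through the factor in [size W] of [labelled_d]. *)
Lemma arc_edge_nondegen W I E x e : lgraph W I E -> ~~ degen I E -> x \in W -> e \in E ->
  (if after x W is y :: w then ~~ degen I (map (merge_ends x y) E) else true) ->
  arc_edge W I E x e = edge_arc W I E e x.
Proof.
move=> lg nd xW eE; have uV := lgraph_uniq lg; rewrite /arc_edge /edge_arc /arc_term.
case aE : (after x W) => [|y w]; first by rewrite scaler0 if_same.
move=> nd'; rewrite (negbTE nd'); have [u1 u2 xy] := uniq_after uV xW aE.
have [xI yI] : x \notin I /\ y \notin I.
  move: u1; rewrite /= inE !mem_cat !negb_or => /and3P [/and3P [_ _ ->] /andP [_ ->] _].
  by [].
case: ifPn => [re|nre]; last first.
  by rewrite edge_term0 ?scaler0 //; rewrite -(regular_merge e xI yI) in nre.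
pose a := contracted I e; pose t := target I e.
have o : oriented (tail e \notin I) a t e := oriented_contracted I e.
have aI : a \in I := contracted_in re.
have ax : a != x by apply: contraNneq xI => <-.
have ay : a != y by apply: contraNneq yI => <-.
have uE := degen_uniq nd; have at_ := oriented_neq nd eE o aI.
have pI : perm_eq (a :: rem a I) I by rewrite perm_sym perm_to_rem.
have pE : perm_eq (e :: rem e E) E by rewrite perm_sym perm_to_rem.
pose m := merge_ends x y.
have o' : oriented (tail e \notin I) a (subst y x t) (m e).
  have := oriented_map_ends (subst y x) o; rewrite {1}/subst (negbTE ay).
  by rewrite /oriented tail_map_ends head_map_ends tail_merge head_merge.
have lg' : lgraph (x :: w) I (map m E).
  apply: lgraph_merge; rewrite (lgraph_perm _ (perm_refl I) (perm_refl E) (W' := W)) //.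
  by rewrite -aE perm_after.
have pm : perm_eq (m e :: map m (rem e E)) (map m E) := perm_map m pE.
rewrite (edge_term_front R c lg' nd' o' pI pm).
have hm : perm_odd (m e :: map m (rem e E)) (map m E) = perm_odd (e :: rem e E) E.
  by apply: (@perm_odd_map _ _ m (e :: rem e E)) => //; exact: uniq_map_inj (degen_uniq nd').
rewrite hm.
have uI : uniq I by move: uV; rewrite cat_uniq => /and3P [].
rewrite (perm_odd_rem uI aI).
rewrite (perm_odd_rem uE eE).
rewrite /edge_sign -/a -/t.
rewrite !bsgnZ.
congr (bsgn R _ *: graph_cls R c _ _ _); first exact: addbC.
rewrite /contract -!map_comp; apply/eq_in_map => f fE /=.
have fE' := mem_rem fE; have fe : f != e by move: fE; rewrite mem_rem_uniq // inE => /andP [].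
have np : ~~ parallel (m e) (m f).
  by apply: contra nd' => p; apply: (@map_degen m I E e f) => //; rewrite eq_sym.
have eqm g : ~~ joins x y g -> ~~ joins x y (map_ends (subst a t) g) ->
   map_ends (subst a (subst y x t)) (m g) = m (map_ends (subst a t) g).
  move=> j1 j2; rewrite /m !merge_not_joins // !map_ends_comp.
  by congr (_, _, _); symmetry; apply: (@merge_subst_comm x y a t).
(* An edge joining [x] and [y] avoids [a]; the contraction of [e] leaves it alone and it becomes the
   same loop in both orders. *)
have [jf|jf] := boolP (joins x y f).
  have st z : z != a -> subst a t z = z by rewrite /subst => /negbTE ->.
  have -> : map_ends (subst a t) f = f.
    have [ta ha] : tail f != a /\ head f != a.
      by case/joinsP: jf => -[-> ->]; split; rewrite eq_sym.
    by apply: edge_ext; rewrite ?tail_map_ends ?head_map_ends ?st.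
  by rewrite /m /merge_ends jf /map_ends /= /tail /head /= /subst eq_sym (negbTE ax).
apply: eqm => //; apply/negP => jf'.
(* f joins a to the end of the arc opposite to t, hence it is parallel to e after the arc is contracted *)
case/negP: np; have of_ : oriented false (tail f) (head f) f by rewrite /oriented !eqxx.
have e1 : parallel (m e) (m f) = ((a == subst y x (tail f)) && (subst y x t == subst y x (head f)))
   || ((a == subst y x (head f)) && (subst y x t == subst y x (tail f))).
  apply: (@oriented_par _ false _ _ _ _ _ _ o').
  by rewrite /oriented tail_merge head_merge !eqxx.
rewrite e1; move: jf jf'; rewrite !joinsE tail_map_ends head_map_ends.
move: (tail f) (head f) => p q; rewrite /subst.
have [->|pa] := eqVneq p a; have [->|qa] := eqVneq q a; rewrite ?(negbTE ax) ?(negbTE ay) ?eqxx //=.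
- by move=> _; case/orP => /andP [/eqP h1 /eqP h2]; move: xy; rewrite -h1 -h2 eqxx.
- by move=> _; case/orP => /andP [/eqP -> /eqP ->]; do 3 rewrite ?eqxx ?if_same ?orbT /=.
- by move=> _; case/orP => /andP [/eqP -> /eqP ->]; do 3 rewrite ?eqxx ?if_same ?orbT /=.
- by move=> /negbTE ->.
Qed.

Lemma edge_arc_front W I E e E' x : lgraph W I E -> ~~ degen I E -> x \in W -> regular I e ->
  perm_eq (e :: E') E ->
  edge_arc W I E e x =
  bsgn R ((is_odd c && ((tail e \notin I) (+) odd (index (contracted I e) I)))
        (+) (is_even c && perm_odd (e :: E') E))
    *: arc_term W (rem (contracted I e) I) (contract (contracted I e) (target I e) E') x.
Proof.
move=> lg nd xW re pE; have uE := degen_uniq nd; have uV := lgraph_uniq lg.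
have pE' := perm_rem_front pE.
rewrite /edge_arc re /arc_term; case aE : (after x W) => [|y w]; first by rewrite !scaler0.
set a := contracted I e; set t := target I e.
have [_ u2 _] := uniq_after uV xW aE.
have aI : a \in I by apply: contracted_in.
have u3 : uniq ((x :: w) ++ rem a I).
  move: u2; rewrite (perm_uniq (perm_cat (perm_refl (x :: w)) (perm_to_rem aI))).
  exact: uniq_consl.
rewrite (perm_odd_front uE pE) /contract -!map_comp.
rewrite (cl_edge_map R c _ u3 (rem_uniq _ uE) pE') /edge_sign -/a !bsgnZ.
congr (bsgn R _ *: _).
move: (tail e \in I) (odd (index a I)) (odd (index e E)) (perm_odd E' _) (perm_odd _ W) (is_odd c) (is_even c).
by do 7 case.
Qed.

(** The edges [g] and [h] form a triangle with the arc. Contracting one of them and then the arc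
    turns the other into a loop at [x]. In the odd case the two loops have their half-edges in
    opposite orders relative to the directions of the edges; in the even case [g] and [h] have been
    exchanged. *)
Lemma edge_arc_pair W I E g h K x y w : lgraph W I E -> ~~ degen I E -> x \in W ->
  after x W = y :: w -> regular I g -> regular I h -> perm_eq (g :: h :: K) E ->
  contracted I g = contracted I h -> target I g = x -> target I h = y ->
  edge_arc W I E g x + edge_arc W I E h x = 0.
Proof.
move=> lg nd xW aE rg rh pE ab tx sy; have uE := degen_uniq nd; have uV := lgraph_uniq lg.
have pE' : perm_eq (h :: g :: K) E by apply: perm_trans pE; apply: (perm_adjacent [::]).
have [u1 u2 xy] := uniq_after uV xW aE.
have [xI yI] : x \notin I /\ y \notin I.
  move: u1; rewrite /= inE !mem_cat !negb_or => /and3P [/and3P [_ _ ->] /andP [_ ->] _].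
  by [].
have oh := oriented_contracted I h; have og := oriented_contracted I g.
rewrite (edge_arc_front lg nd xW rg pE) (edge_arc_front lg nd xW rh pE').
rewrite -ab sy in oh; rewrite tx in og; rewrite -ab tx sy.
set a := contracted I g in oh og *.
have aI : a \in I by apply: contracted_in.
have ax : a != x by apply: contraNneq xI => <-.
have ay : a != y by apply: contraNneq yI => <-.
have u3 : uniq ((x :: w) ++ rem a I).
  move: u2; rewrite (perm_uniq (perm_cat (perm_refl (x :: w)) (perm_to_rem aI))).
  exact: uniq_consl.
have l1 : merge_ends x y (map_ends (subst a x) h) = (x, x, tail h \notin I).
  have := oriented_map_ends (subst a x) oh; rewrite {1}/subst eqxx {1}/subst eq_sym (negbTE ay) => o1.
  rewrite /merge_ends (oriented_joins _ _ o1) !eqxx /=; congr (_, _, _).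
  by move: o1; rewrite /oriented => /andP [/eqP -> _]; case: (tail h \in I); rewrite ?eqxx ?(negbTE xy).
have l2 : merge_ends x y (map_ends (subst a y) g) = (x, x, tail g \in I).
  have := oriented_map_ends (subst a y) og; rewrite {1}/subst eqxx {1}/subst eq_sym (negbTE ax) => o1.
  rewrite /merge_ends (oriented_joins _ _ o1) !eqxx orbT /=; congr (_, _, _).
  by move: o1; rewrite /oriented => /andP [/eqP -> _]; case: (tail g \in I); rewrite ?eqxx ?(negbTE xy).
have inE3 k : k \in K -> k \in E /\ k != g /\ k != h.
  move=> kK; rewrite -(perm_mem pE) !inE kK !orbT; split => //.
  move: uE; rewrite -(perm_uniq pE) /= inE negb_or => /and3P [/andP [_ gK] hK _].
  by split; [apply: contraNneq gK|apply: contraNneq hK] => <-.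
(* Once [x] and [y] are merged, it is immaterial to which of them [a] was moved, except for an edge
   that has become an edge between [x] and [y]; any such edge that met [a] is parallel to [g] or
   [h]. *)
have eM : map (merge_ends x y) (contract a x K) = map (merge_ends x y) (contract a y K).
  rewrite /contract -!map_comp; apply/eq_in_map => k /inE3 [kE [kg kh]] /=.
  have npg : ~~ parallel g k.
    by apply: contra kg => p; rewrite (degen_par nd _ kE p) // -(perm_mem pE) mem_head.
  have nph : ~~ parallel h k.
    by apply: contra kh => p; rewrite (degen_par nd _ kE p) // -(perm_mem pE') mem_head.
  have ok : oriented false (tail k) (head k) k by rewrite /oriented !eqxx.
  have nl : (tail k == a) && (head k == a) = false.
    apply/negP => /andP [/eqP ta /eqP ha].
    have := degen_nonloop nd kE; rewrite ta aI => /(_ isT).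
    by rewrite /is_loop ta ha eqxx.
  move: npg nph; rewrite (oriented_par og ok) (oriented_par oh ok).

  move: nl; set p := tail k; set u := head k => nl npg nph.
  have ss z : subst y x (subst a x z) = subst y x (subst a y z).
    rewrite /subst; have [_|za] := eqVneq z a => //.
    by rewrite (negbTE xy) eqxx.
  apply: edge_ext; rewrite ?flipped_merge ?joinsE ?tail_merge ?head_merge ?tail_map_ends ?head_map_ends ?flipped_map_ends //.
  rewrite -/p -/u; move: nl npg nph; rewrite /subst.
  have [->|pa] := eqVneq p a; have [->|ua] := eqVneq u a => //.
    rewrite ?eqxx /= ?orbF ![_ == u]eq_sym => _ /negbTE -> /negbTE ->.
    by rewrite !andbF.
  rewrite ?eqxx /= ![_ == p]eq_sym => _ /negbTE -> /negbTE ->.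
  by rewrite ?andbF.
have ctrE t k : map (merge_ends x y) (contract a t (k :: K)) =
    merge_ends x y (map_ends (subst a t) k) :: map (merge_ends x y) (contract a t K) by [].
rewrite /arc_term aE !ctrE l1 l2 eM.
rewrite (loop_flip _ (tail h \notin I) _ u3) (loop_flip _ (tail g \in I) _ u3) !bsgnZ.
rewrite (perm_odd_two uE pE).
set b1 := (X in bsgn R X *: _); set b2 := (X in _ + bsgn R X *: _).
have -> : b2 = ~~ b1; last by rewrite bsgnN subrr.
rewrite /b1 /b2; move: (tail g \in I) (tail h \in I) (odd (index a I)) (perm_odd (g :: h :: K) E) (perm_odd _ W) => v1 v2 v3 v4 v5.
by rewrite /is_even; case: (is_odd c); case: v1; case: v2; case: v3; case: v4; case: v5.
Qed.

(** Contracting the arc makes some [g] and [h] parallel. Contracting any other edge first keeps them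
    parallel after the arc, so these terms vanish. The terms of [g] and [h] are 0 if they are not
    regular; otherwise they are the two sides handled by [edge_arc_pair]. *)
Lemma edge_arc_degen W I E x y w : lgraph W I E -> ~~ degen I E -> x \in W ->
  after x W = y :: w -> degen I (map (merge_ends x y) E) ->
  \sum_(e <- E) edge_arc W I E e x = 0.
Proof.
move=> lg nd xW aE dg; have uE := degen_uniq nd; have uV := lgraph_uniq lg.
have [u1 u2 xy] := uniq_after uV xW aE.
have [xI yI] : x \notin I /\ y \notin I.
  move: u1; rewrite /= inE !mem_cat !negb_or => /and3P [/and3P [_ _ ->] /andP [_ ->] _].
  by [].
have [g [h [gE hE gh p]]] : exists g h, [/\ g \in E, h \in E, g != h &
    parallel (merge_ends x y g) (merge_ends x y h)].
  case/orP: dg => [nu|/hasP [_ /mapP [g gE ->] /andP [lp tI]]].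
    rewrite -map_comp in nu; have [g [h [gE hE ne e0]]] := not_uniq_map uE nu.
    by exists g, h; split => //; rewrite -ends_eq; apply/eqP.
  (* Contracting an arc never creates a loop at an internal vertex, so the degeneracy can only be a
     parallel pair. *)
  have rg : regular I g by rewrite -(regular_merge g xI yI) /regular tI.
  by have := degen_nonloop nd gE rg; rewrite (merge_loop_external xI yI lp rg).
have neq e : regular I e -> contracted I e != x /\ contracted I e != y.
  move=> /contracted_in aI; split; first by apply: contraNneq xI => <-.
  by apply: contraNneq yI => <-.
have zero e : e \in E -> e != g -> e != h -> edge_arc W I E e x = 0.
  move=> eE eg eh; rewrite /edge_arc; case: ifP => // re; have [ax ay] := neq e re.
  have aI := contracted_in re; rewrite /arc_term aE cl_degen ?scaler0 //.
    move: u2; rewrite (perm_uniq (perm_cat (perm_refl (x :: w)) (perm_to_rem aI))).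
    exact: uniq_consl.
  rewrite /contract -map_comp; apply: (@map_degen _ _ _ g h) => //.
  - by rewrite mem_rem_uniq // inE gE eq_sym eg.
  - by rewrite mem_rem_uniq // inE hE eq_sym eh.
  move: p; rewrite /= !par_merge !map_ends_comp => p.
  have sw k : map_ends (subst y x \o subst (contracted I e) (target I e)) k
    = map_ends (subst (contracted I e) (subst y x (target I e))) (map_ends (subst y x) k).
    by congr (_, _, _); apply: merge_subst_comm.
  by rewrite !sw; apply: par_map_preserved.
pose K := rem h (rem g E); have pE : perm_eq (g :: h :: K) E by apply: perm_two.
rewrite -(perm_big _ pE) /= !big_cons big_seq big1; last first.
  move=> k kK; have kE : k \in E by rewrite -(perm_mem pE) !inE kK !orbT.
  have := uE; rewrite -(perm_uniq pE) /= inE negb_or => /and3P [/andP [_ gK] hK _].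
  by apply: zero => //; [apply: contraNneq gK|apply: contraNneq hK] => <-.
rewrite [X in _ + X]addr0.
have rgh : regular I g = regular I h.
  apply: etrans (esym (regular_merge g xI yI)) (etrans _ (regular_merge h xI yI)).
  move: p; rewrite /parallel /regular => /orP [] /andP [/eqP -> /eqP ->] //.
  exact: orbC.
have [rg|nrg] := boolP (regular I g); last first.
  by rewrite /edge_arc -rgh (negbTE nrg) addr0.
have rh : regular I h by rewrite -rgh.
have [ax ay] := neq g rg; have [bx by_] := neq h rh.
have og := oriented_contracted I g; have oh := oriented_contracted I h.
have npar : ~~ parallel g h by apply: contra gh => /(degen_par nd gE hE) ->.
move: p; rewrite par_merge (oriented_par (oriented_map_ends (subst y x) og) (oriented_map_ends (subst y x) oh)).
move: npar; rewrite (oriented_par og oh).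
have sid z : z != y -> subst y x z = z by rewrite /subst => /negbTE ->.
rewrite !(sid (contracted _ _)) // => npar p.
have pE' : perm_eq (h :: g :: K) E by apply: perm_trans pE; apply: (perm_adjacent [::]).
(* The other matching of ends would make [g] and [h] parallel before the arc was contracted. *)
have [ab st] : contracted I g = contracted I h /\ subst y x (target I g) = subst y x (target I h).
  case/orP: p => /andP [/eqP h1 /eqP h2] //; case/negP: npar; apply/orP; right.
  have hs : target I h != y by apply: contra_neq ax => e; rewrite h1 e /subst eqxx.
  have gt : target I g != y by apply: contra_neq bx => e; rewrite -h2 e /subst eqxx.
  by rewrite h1 -h2 !sid // !eqxx.
have ts : target I g != target I h.
  by apply: contra npar => /eqP ->; rewrite ab !eqxx.
move: st ts; rewrite /subst; have [ty|ty] := eqVneq (target I g) y; have [sy|sy] := eqVneq (target I h) y.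
- by rewrite ty sy eqxx.
- move=> xs _; rewrite addrC; apply: (edge_arc_pair lg nd xW aE rh rg pE') => //.
- move=> tx _; apply: (edge_arc_pair lg nd xW aE rg rh pE) => //.
- by move=> ->; rewrite eqxx.
Qed.

(** Arc by arc: if its contraction is non-degenerate the terms agree, and otherwise the left side is
    0 by convention and the right side by [edge_arc_degen]. *)
Lemma dE_dA W I E : lgraph W I E -> ~~ degen I E ->
  \sum_(x <- W) (if after x W is y :: w then
      if degen I (map (merge_ends x y) E) then 0 else
      bsgn R (perm_odd (from x W) W) *: edge_sum R c (x :: w) I (map (merge_ends x y) E)
    else 0)
  = \sum_(e <- E) (if regular I e then edge_sign I E e *:
      arc_sum R c W (rem (contracted I e) I) (contract (contracted I e) (target I e) (rem e E)) else 0).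
Proof.
move=> lg nd; transitivity (\sum_(x <- W) \sum_(e <- E) edge_arc W I E e x); last first.
  rewrite exchange_big /=; apply: eq_bigr => e _; rewrite /edge_arc /arc_sum.
  by case: ifP => _; [rewrite scaler_sumr|rewrite big1].
rewrite !big_seq; apply: eq_bigr => x xW.
have h := fun e eE => @arc_edge_nondegen W I E x e lg nd xW eE.
case aE : (after x W) h => [|y w] h.
  rewrite big_seq big1 // => e eE; rewrite -h //.
  by rewrite /arc_edge aE.
have [dg|nd'] := boolP (degen I (map (merge_ends x y) E)).
  by rewrite (edge_arc_degen lg nd xW aE dg).
rewrite /edge_sum big_map scaler_sumr !big_seq; apply: eq_bigr => e eE.
by rewrite -h // /arc_edge aE (negbTE nd').
Qed.

Lemma coboundary_labelled_d W I E : lgraph W I E -> coboundary R c (labelled_d R c W I E) = 0.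
Proof.
move=> lg; rewrite /labelled_d; have [|nd] := boolP (degen I E); first by rewrite linear0.
have uV := lgraph_uniq lg; pose n := size W; pose m x y := map (merge_ends x y) E.
pose cE e := contract (contracted I e) (target I e) (rem e E); pose cI e := rem (contracted I e) I.
have hA : coboundary R c (arc_sum R c W I E) =
   \sum_(x <- W) (if after x W is y :: w then
      bsgn R (perm_odd (from x W) W) *: arc_sum R c (x :: w) I (m x y) else 0)
   + bsgn R (odd n.-1) *: \sum_(x <- W) (if after x W is y :: w then
      if degen I (m x y) then 0 else
      bsgn R (perm_odd (from x W) W) *: edge_sum R c (x :: w) I (m x y) else 0).
  rewrite [in LHS]/arc_sum linear_sum scaler_sumr -big_split /= !big_seq; apply: eq_bigr => x xW.
  rewrite /arc_contraction; case aE : (after x W) => [|y w]; first by rewrite linear0 scaler0 addr0.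
  have [_ u2 _] := uniq_after uV xW aE.
  have pW : perm_eq (x :: y :: w) W by rewrite -aE perm_after.
  rewrite linearZ /= coboundary_cl; last first.
    by apply: lgraph_merge; rewrite (lgraph_perm pW (perm_refl I) (perm_refl E)).
  rewrite /labelled_d -/(m x y); case: ifPn => [dg|_]; first by rewrite arc_sum_degen // !scaler0 addr0.
  by rewrite /n -(perm_size pW) /= scalerDr !bsgnZ addbC.
have hE : coboundary R c (edge_sum R c W I E) =
   \sum_(e <- E) (if regular I e then edge_sign I E e *: arc_sum R c W (cI e) (cE e) else 0)
   + bsgn R (odd n) *: \sum_(e <- E) (if regular I e && ~~ degen (cI e) (cE e)
       then edge_sign I E e *: edge_sum R c W (cI e) (cE e) else 0).
  rewrite [in LHS]/edge_sum linear_sum scaler_sumr -big_split /= !big_seq; apply: eq_bigr => e eE.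
  case: (boolP (regular I e)) => [re|nre]; last by rewrite edge_term0 // linear0 scaler0 addr0.
  have aI := contracted_in re; have o := oriented_contracted I e.
  have at_ := oriented_neq nd eE o aI.
  have pI : perm_eq (contracted I e :: cI e) I by rewrite perm_sym perm_to_rem.
  have pE : perm_eq (e :: rem e E) E by rewrite perm_sym perm_to_rem.
  have lg' : lgraph W (cI e) (cE e).
    by apply: lgraph_ctr o at_; rewrite (lgraph_perm (perm_refl W) pI pE).
  rewrite edge_termE // linearZ /= coboundary_cl // /labelled_d -/(cE e) -/(cI e).
  case: ifPn => [dg|_] /=; first by rewrite arc_sum_degen ?(lgraph_uniq lg') // !scaler0 addr0.
  by rewrite scalerDr !bsgnZ addbC.
rewrite linearD linearZ /= hA hE arc_sum_square // edge_sum_square // dE_dA // scaler0 addr0 add0r.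
(* The two mixed sums agree and carry the signs of [n.-1] and [n]. These are opposite unless [n] is
   0, where there are no arcs to sum over. *)
rewrite /n; case: W lg uV nd @n hA hE => [|x W] lg uV nd n hA hE; last first.
  by rewrite /= bsgnN subrr.
rewrite big1 ?scaler0 ?addr0 // => e _; case: ifP => // _.
by rewrite /arc_sum big_nil scaler0.
Qed.
End Mixed.

(** * Shuffles of labelled graphs *)

Lemma map_head_from (U : seq nat) x w : uniq U -> x \in U -> perm_eq w U ->
  ohead (from x w) = Some x.
Proof. by move=> uU xU p; rewrite fromE // (perm_mem p). Qed.

Section Cyc.
Context (R : realType) (V : lmodType R).
Implicit Types (U w : seq nat) (C : pred (seq nat)) (f : seq nat -> V).

Definition rot_invariant (T : Type) U (h : seq nat -> T) : Prop :=
  forall w w', perm_eq w U -> rotation w' w -> h w' = h w.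

(* Each cyclic arrangement is read from the first element of U. *)
Definition cyc U C f : V :=
  \sum_(w <- permutations U | (ohead w == ohead U) && C w) f w.

Lemma permutations_perm U U' : perm_eq U U' -> perm_eq (permutations U) (permutations U').
Proof.
move=> p; apply: uniq_perm; rewrite ?permutations_uniq // => w.
by rewrite !mem_permutations; apply/idP/idP => q; apply: perm_trans q _; rewrite // perm_sym.
Qed.

(** Turning a word to begin at [x] is a bijection from the arrangements read from [y] to those read
    from [x]; [C] does not notice the rotation, while [f] may. *)
Lemma sum_from U C f x y : uniq U -> x \in U -> y \in U -> rot_invariant U C ->
  \sum_(w <- permutations U | (ohead w == Some x) && C w) f w
  = \sum_(w <- permutations U | (ohead w == Some y) && C w) f (from x w).
Proof.
move=> uU xU yU rC; rewrite -!(big_filter _ (fun w => _ && _)).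
have p : perm_eq [seq w <- permutations U | (ohead w == Some x) && C w]
   (map (from x) [seq w <- permutations U | (ohead w == Some y) && C w]).
  apply: uniq_perm; first by rewrite filter_uniq ?permutations_uniq.
    rewrite map_inj_in_uniq ?filter_uniq ?permutations_uniq // => w w'.
    rewrite !mem_filter !mem_permutations => /andP [/andP [/eqP hw _] pw] /andP [/andP [/eqP hw' _] pw'] e.
    have uw : uniq w by rewrite (perm_uniq pw). have uw' : uniq w' by rewrite (perm_uniq pw').
    have r : rotation w w'.
      by rewrite -(rotation_eqr _ (from_rotation x w')) -e rotationC from_rotation.
    case: w hw pw e uw r => [|z w] //= [->] pw e uw r.
    case: w' hw' pw' e uw' r => [|z' w'] //= [->] pw' e uw' r.
    by rewrite (rotation_head uw' r).
  move=> w; rewrite mem_filter mem_permutations; apply/andP/mapP.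
    case=> /andP [/eqP hw Cw] pw; exists (from y w).
      rewrite mem_filter mem_permutations (perm_trans (perm_from _ _)) // andbT.
      by rewrite (map_head_from uU) // eqxx (rC w) // from_rotation.
    have uw : uniq w by rewrite (perm_uniq pw).
    rewrite from_from // ?(perm_mem pw) //.
    by case: w hw {pw Cw uw} => [|z w] //= [->]; rewrite /from /= eqxx rot0.
  case=> w'; rewrite mem_filter mem_permutations => /andP [/andP [hw' Cw'] pw'] ->.
  by rewrite (map_head_from uU) // eqxx (rC w') // ?from_rotation // (perm_trans (perm_from _ _)).
by rewrite (perm_big _ p) /= big_map.
Qed.

(** The order of [U] only determines the letter from which each circular word is read, and neither
    [C] nor [f] depends on that. *)
Lemma cyc_perm U U' C f : uniq U -> perm_eq U U' -> rot_invariant U C -> rot_invariant U f ->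
  cyc U C f = cyc U' C f.
Proof.
move=> uU p rC rf; rewrite /cyc -(perm_big _ (permutations_perm p)) /=.
case: U uU p rC rf => [|x U] uU p rC rf.
  by move: p; rewrite perm_sym => /perm_nilP ->.
case: U' p => [|y U'] p; first by move/perm_nilP: p.
rewrite (@sum_from _ C f x y) ?mem_head ?(perm_mem p) ?mem_head //.
rewrite big_seq_cond [RHS]big_seq_cond; apply: eq_bigr => w /andP [].
by rewrite mem_permutations => pw _; apply: rf => //; apply: from_rotation.
Qed.

Lemma eq_cyc U C C' f f' : (forall w, perm_eq w U -> C w = C' w) ->
  (forall w, perm_eq w U -> C w -> f w = f' w) -> cyc U C f = cyc U C' f'.
Proof.
move=> eC ef; rewrite /cyc big_seq_cond [RHS]big_seq_cond; apply: eq_big => w.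
  by rewrite mem_permutations; case: (boolP (perm_eq w U)) => //= pw; rewrite eC.
by rewrite mem_permutations => /andP [pw /andP [_ Cw]]; apply: ef.
Qed.

Lemma cyc_scale a U C f : a *: cyc U C f = cyc U C (fun w => a *: f w).
Proof. by rewrite /cyc scaler_sumr. Qed.

End Cyc.

(** The shuffle condition of [cyclic_shuffles] without its choice of a first letter, hence a
    property of circular words. *)
Definition restricts (s t w : seq nat) : bool :=
  rotation [seq x <- w | x \in s] s && rotation [seq x <- w | x \in t] t.

Lemma restricts_rot U s t : rot_invariant U (restricts s t).
Proof.
move=> w w' _ r; rewrite /restricts.
rewrite (rotation_eql s (rotation_filter (fun x => x \in s) r)).
by rewrite (rotation_eql t (rotation_filter (fun x => x \in t) r)).
Qed.

Lemma restrictsC s t w : restricts s t w = restricts t s w.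
Proof. by rewrite /restricts andbC. Qed.

Lemma restricts_eql s s' t w : rotation s' s -> restricts s' t w = restricts s t w.
Proof.
move=> r; rewrite /restricts (rotation_eqr _ r).
by rewrite (eq_filter (perm_mem (rotation_perm r))).
Qed.

Lemma sum_cyclic_shuffles (R : realType) (V : lmodType R) s t (f : seq nat -> V) :
  \sum_(w <- cyclic_shuffles s t) f w = cyc (s ++ t) (restricts s t) f.
Proof. by rewrite /cyclic_shuffles big_filter. Qed.

Section Inverse.
Context (h : nat -> nat) (U : seq nat).
Context (hi : {in U &, injective h}).

Definition inverse_on (y : nat) : nat := nth 0%N U (index y (map h U)).

Lemma inverse_onK : {in U, cancel h inverse_on}.
Proof.
move=> x xU; rewrite /inverse_on (index_map_in (D := [in U]) hi) // nth_index //.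
Qed.

Lemma map_inverse_on s : {subset s <= U} -> map inverse_on (map h s) = s.
Proof.
move=> sU; rewrite -map_comp -[RHS]map_id; apply/eq_in_map => x /sU xU /=.
exact: inverse_onK.
Qed.

Lemma inverse_on_map s : {subset s <= map h U} -> map h (map inverse_on s) = s.
Proof.
move=> sU; rewrite -map_comp -[RHS]map_id; apply/eq_in_map => y /sU /mapP [x xU ->] /=.
by rewrite inverse_onK.
Qed.

Lemma permutations_map : uniq U -> perm_eq (permutations (map h U)) (map (map h) (permutations U)).
Proof.
move=> uU; apply: uniq_perm; first exact: permutations_uniq.
  rewrite map_inj_in_uniq ?permutations_uniq // => w w'.
  rewrite !mem_permutations => pw pw' e.
  rewrite -(@map_inverse_on w) => [|x]; last by rewrite (perm_mem pw).
  by rewrite e map_inverse_on // => x; rewrite (perm_mem pw').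
move=> w; rewrite mem_permutations; apply/idP/mapP => [p|[w']]; last first.
  by rewrite mem_permutations => p ->; apply: perm_map.
exists (map inverse_on w); last by rewrite inverse_on_map // => y; rewrite (perm_mem p).
by rewrite mem_permutations -[X in perm_eq _ X](@map_inverse_on U) // perm_map.
Qed.

Lemma rotation_map_in s t : {subset s <= U} -> {subset t <= U} ->
  rotation (map h s) (map h t) = rotation s t.
Proof.
move=> sU tU; apply/idP/idP; last exact: rotation_map.
by move/(rotation_map inverse_on); rewrite !map_inverse_on.
Qed.

Lemma filter_map_in s w : {subset s <= U} -> {subset w <= U} ->
  [seq x <- map h w | x \in map h s] = map h [seq x <- w | x \in s].
Proof.
move=> sU wU; rewrite filter_map; congr map; apply: eq_in_filter => x /wU xU /=.
apply/mapP/idP => [[y ys e]|xs]; last by exists x.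
by rewrite (hi xU (sU y ys) e).
Qed.

Lemma restricts_map s t w : {subset s <= U} -> {subset t <= U} -> {subset w <= U} ->
  restricts (map h s) (map h t) (map h w) = restricts s t w.
Proof.
move=> sU tU wU; rewrite /restricts !filter_map_in // !rotation_map_in //.
all: by move=> x; rewrite mem_filter => /andP [_ /wU].
Qed.

Lemma cyc_map (R : realType) (V : lmodType R) C (f : seq nat -> V) : uniq U ->
  cyc (map h U) C f = cyc U (fun w => C (map h w)) (fun w => f (map h w)).
Proof.
move=> uU; rewrite /cyc (perm_big _ (permutations_map uU)) /= big_map.
rewrite big_seq_cond [RHS]big_seq_cond; apply: eq_bigl => w; rewrite mem_permutations.
case: (boolP (perm_eq w U)) => //= p; congr (_ && _).
case: w p => [|x w] p; case EU : U => [|y U'] //=.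
have xU : x \in U by rewrite -(perm_mem p) mem_head.
have yU : y \in U by rewrite EU mem_head.
apply/eqP/eqP => [[e]|[->] //]; congr Some; exact: hi.
Qed.
End Inverse.

(** * The product of labelled graphs *)

Section Shuffle.
Context (R : realType) (c : parity).
Local Notation cl := (graph_cls R c).

(* The grading of a graph is the number of its external vertices plus this one. *)
Definition nlabels (I : seq nat) (E : seq edge) : nat :=
  if is_odd c then size I else size E.

(** One sign with two origins: in the even case it is [lambda]; in the odd case [lambda] is 0 and
    the sign comes from regrouping W1 I1 W2 I2 as W1 W2 I1 I2. *)
Definition labelled_shuffle W1 I1 E1 W2 I2 E2 : graph_complex R c :=
  bsgn R (odd (nlabels I1 E1 * size W2)) *:
  cyc (W1 ++ W2) (restricts W1 W2)
    (fun w => bsgn R (perm_odd w (W1 ++ W2)) *: cl w (I1 ++ I2) (E1 ++ E2)).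

(** The sign and the class change by the same parity under a rotation, so the summand is a function
    of the circular word. *)
Lemma sh_summand_rot U V I E : uniq (U ++ I) -> perm_eq U V ->
  rot_invariant U (fun w => bsgn R (perm_odd w V) *: cl w I E).
Proof.
move=> uU pU w w' pw r; have uw : uniq (w ++ I) by rewrite (perm_uniq (perm_cat pw (perm_refl I))).
have uV : uniq V by move: uU; rewrite (perm_uniq (perm_cat pU (perm_refl I))) cat_uniq => /andP [].
rewrite (cl_rot R c E uw r) bsgnZ (perm_odd_trans uV (rotation_perm r) (perm_trans pw pU)).
by congr (bsgn R _ *: _); case: (perm_odd w' w); case: (perm_odd w V).
Qed.

Lemma sh_map (h : nat -> nat) W1 I1 E1 W2 I2 E2 :
  let V := (W1 ++ I1) ++ (W2 ++ I2) in {in V &, injective h} -> uniq V ->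
  all (ends_in (W1 ++ I1)) E1 -> all (ends_in (W2 ++ I2)) E2 ->
  labelled_shuffle (map h W1) (map h I1) (map (map_ends h) E1) (map h W2) (map h I2) (map (map_ends h) E2)
  = labelled_shuffle W1 I1 E1 W2 I2 E2.
Proof.
move=> V hi uV EV1 EV2; rewrite /labelled_shuffle /nlabels !size_map -!map_cat; congr (_ *: _).
have sU : {subset W1 ++ W2 <= V}.
  by move=> x; rewrite !mem_cat => /orP [->|->]; rewrite ?orbT.
have hiU : {in W1 ++ W2 &, injective h} by move=> x y /sU xV /sU yV; apply: hi.
have uU : uniq (W1 ++ W2).
  apply: subseq_uniq uV; apply: cat_subseq; apply: prefix_subseq => //.
rewrite cyc_map //; apply: eq_cyc => w pw.
  apply: (restricts_map hiU) => x; rewrite ?(perm_mem pw) // mem_cat => ->; rewrite ?orbT //.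
move=> _; rewrite perm_odd_map //; congr (_ *: _).
have sw : {subset w ++ (I1 ++ I2) <= V}.
  move=> x; rewrite mem_cat (perm_mem pw) !mem_cat.
  by case/orP => /orP [->|->]; rewrite ?orbT.
apply: cl_map; first by move=> x y /sw xV /sw yV; apply: hi.
have sub W I E : {subset W ++ I <= w ++ I1 ++ I2} -> all (ends_in (W ++ I)) E -> all (ends_in (w ++ I1 ++ I2)) E.
  by move=> s EV; apply/allP => e /(allP EV) /andP [te he]; rewrite /ends_in !s.
rewrite all_cat (sub W1 I1) ?(sub W2 I2) //; move=> x; rewrite !mem_cat (perm_mem pw) mem_cat;
by case/orP => ->; rewrite ?orbT.
Qed.
End Shuffle.

Section ShuffleGraphs.
Context (R : realType) (c : parity).
Local Notation cl := (graph_cls R c).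
Local Notation sh := (labelled_shuffle R c).
Local Notation other_labels := (nlabels c).

Lemma sh_numeric g1 g2 : is_graph g1 -> is_graph g2 ->
  shuffle_graphs R c g1 g2 =
  sh (ext_vertices g1) (int_vertices g1) (edges g1)
     (map (shift_label g1) (ext_vertices g2)) (map (shift_label g1) (int_vertices g2))
     (map (map_ends (shift_label g1)) (edges g2)).
Proof.
move=> gg1 gg2; rewrite /shuffle_graphs /both_ext sum_cyclic_shuffles.
set W1 := ext_vertices g1; set I1 := int_vertices g1; set E1 := edges g1.
set W2 := map _ (ext_vertices g2); set I2 := map _ (int_vertices g2); set E2 := map _ (edges g2).
have sW2 : size W2 = vext g2 by rewrite size_map size_iota.
have srt : sorted ltn ((W1 ++ I1) ++ (W2 ++ I2)).
  have -> : (W1 ++ I1) ++ (W2 ++ I2) = iota 1 (nvert g1 + nvert g2); last exact: iota_ltn_sorted.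
  rewrite /W1 /I1 /W2 /I2 -map_cat !ext_int_iota iotaD; congr (_ ++ _).
  by rewrite [(1 + _)%N]addnC iotaDl.
have uV : uniq ((W1 ++ I1) ++ (W2 ++ I2)) by move: srt; rewrite ltn_sorted_uniq_leq => /andP [].
have uU : uniq (W1 ++ W2).
  by apply: subseq_uniq uV; apply: cat_subseq; apply: prefix_subseq.
rewrite /labelled_shuffle.
rewrite [LHS]cyc_scale.
rewrite [RHS]cyc_scale.
apply: eq_cyc => [//|w pw _].
have sw : size w = (vext g1 + vext g2)%N.
  by rewrite (perm_size pw) size_cat sW2 size_iota.
have -> : cls R c (shuffle_graph g1 g2 w) = cl w (I1 ++ I2) (E1 ++ E2).
  rewrite /cl /std /shuffle_graph sw size_cat size_map !size_iota /both_int.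
  by congr (cls R c (PreDGraph _ _ _)).
rewrite !sgn_bsgn !bsgnZ; congr (bsgn R _ *: _); rewrite sW2 /other_labels.
have srtU : sorted ltn (W1 ++ W2).
  by apply: (subseq_sorted ltn_trans _ srt); apply: cat_subseq; apply: prefix_subseq.
have pI : perm_odd w (W1 ++ W2) = odd (inversions w).
  by apply: perm_odd_sorted => // x; rewrite (perm_mem pw).
rewrite /lambda /shuffle_exponent; case: c => /=; last by rewrite mulnC -/E1 pI.
rewrite /both_int -/I1 -/I2 -(perm_odd_sorted srt); last first.
  by move=> x; rewrite !mem_cat (perm_mem pw) mem_cat; do 4 case: (_ \in _).
have pV : perm_eq ((W1 ++ W2) ++ I1 ++ I2) ((W1 ++ I1) ++ W2 ++ I2).
  by rewrite -!catA perm_cat2l perm_catCA.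
have pw2 : perm_eq (w ++ I1 ++ I2) ((W1 ++ W2) ++ I1 ++ I2) by rewrite perm_cat2r.
rewrite (perm_odd_trans uV pw2 pV) addbC.
have uV2 : uniq ((W1 ++ W2) ++ I1 ++ I2) by rewrite (perm_uniq pV).
have -> : perm_odd (w ++ I1 ++ I2) ((W1 ++ W2) ++ I1 ++ I2) = perm_odd w (W1 ++ W2).
  by apply: (@perm_odd_cat _ [::] (I1 ++ I2)).
congr (_ (+) _).
(* After the shuffle of external vertices has been split off, only the exchange of the blocks [I1]
   and [W2] remains. *)
have -> : perm_odd ((W1 ++ W2) ++ I1 ++ I2) ((W1 ++ I1) ++ W2 ++ I2)
    = perm_odd (W2 ++ I1) (I1 ++ W2).
  have := @perm_odd_cat _ W1 I2 (W2 ++ I1) (I1 ++ W2); rewrite -!catA; apply.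
    by move: uV; rewrite -!catA.
  by rewrite perm_catC.
rewrite perm_odd_catC ?sW2 1?mulnC ?size_iota //.
by apply: subseq_uniq uV2; apply: cat_subseq; [apply: suffix_subseq|apply: prefix_subseq].
Qed.

Lemma shuffle_graphs_std W1 I1 E1 W2 I2 E2 : lgraph W1 I1 E1 -> lgraph W2 I2 E2 ->
  uniq ((W1 ++ I1) ++ (W2 ++ I2)) ->
  shuffle_graphs R c (std W1 I1 E1) (std W2 I2 E2) = sh W1 I1 E1 W2 I2 E2.
Proof.
move=> lg1 lg2 uV; rewrite (sh_numeric (lgraph_std lg1) (lgraph_std lg2)).
set V1 := W1 ++ I1 in uV; set V2 := W2 ++ I2 in uV.
have [m1 m2] := std_vertices (lgraph_uniq lg1).
have [m3 m4] := std_vertices (lgraph_uniq lg2).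
(* [h] gives the first graph its canonical labels and the second one its canonical labels raised by
   [k], which are the labels used by [shuffle_graph]. *)
pose k := size V1; pose h x := if x \in V1 then new_label V1 x else (k + new_label V2 x)%N.
have d21 x : x \in V2 -> x \in V1 = false.
  move=> x2; apply/negP => x1; move: uV; rewrite cat_uniq => /and3P [_ /hasPn /(_ x x2)].
  by rewrite /= x1.
have h1 s : {subset s <= V1} -> map h s = map (new_label V1) s.
  by move=> sV; apply/eq_in_map => x /sV xV; rewrite /h xV.
have h2 s : {subset s <= V2} -> map h s = map (addn k) (map (new_label V2) s).
  by move=> sV; rewrite -map_comp; apply/eq_in_map => x /sV xV; rewrite /h d21.
have hi : {in V1 ++ V2 &, injective h}.
  have hc z : z \in V1 ++ V2 -> z \notin V1 -> z \in V2.
    by rewrite mem_cat => /orP [->|].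
  move=> x y hx hy; rewrite /h; case: (boolP (x \in V1)) => [x1|/(hc x hx) x2];
    case: (boolP (y \in V1)) => [y1|/(hc y hy) y2].
  - exact: new_label_inj.
  - move=> e; have := x1; rewrite -new_label_range e -/k /new_label; clear; lia.
  - move=> e; have := y1; rewrite -new_label_range -e -/k /new_label; clear; lia.
  - by move/addnI => e; exact: (@new_label_inj V2 x y x2 y2 e).
have s1 : {subset W1 <= V1} by move=> x; rewrite mem_cat => ->.
have s2 : {subset I1 <= V1} by move=> x; rewrite mem_cat orbC => ->.
have s3 : {subset W2 <= V2} by move=> x; rewrite mem_cat => ->.
have s4 : {subset I2 <= V2} by move=> x; rewrite mem_cat orbC => ->.
rewrite -(@sh_map R c h W1 I1 E1 W2 I2 E2 hi uV (lgraph_ends lg1) (lgraph_ends lg2)).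
have ek : nvert (std W1 I1 E1) = k by rewrite /nvert /= /k size_cat.
rewrite (h1 _ s1) (h1 _ s2) (h2 _ s3) (h2 _ s4) m1 m2 m3 m4.
congr (labelled_shuffle R c _ _ _ _ _ _).
- apply/eq_in_map => e /(allP (lgraph_ends lg1)); rewrite /ends_in -/V1 => /andP [te he].
  by rewrite /map_ends /h te he.
- by rewrite /ext_vertices /=; apply: eq_map => x; rewrite /shift_label ek.
- by rewrite /int_vertices /=; apply: eq_map => x; rewrite /shift_label ek.
- rewrite /= -map_comp; apply/eq_in_map => e /(allP (lgraph_ends lg2)); rewrite /ends_in -/V2 => /andP [te he].
  by rewrite /= map_ends_comp /map_ends /h /= !d21 // /shift_label ek.
Qed.

(** A copy of [g] with raised labels, to be made disjoint from a given list [V] by taking for [k]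
    the largest label [bound V]. *)
Definition shifted (k : nat) (g : predgraph) :=
  (map (addn k) (ext_vertices g), map (addn k) (int_vertices g), map (map_ends (addn k)) (edges g)).

Lemma addn_inj (V : seq nat) k : {in V &, injective (addn k)}.
Proof. by move=> x y _ _; apply: addnI. Qed.

Lemma shifted_lgraph k g : is_graph g ->
  lgraph (shifted k g).1.1 (shifted k g).1.2 (shifted k g).2.
Proof. by move=> gg; apply: lgraph_map; [apply: addn_inj|apply: lgraph_self]. Qed.

Lemma shifted_std k g : is_graph g ->
  std (shifted k g).1.1 (shifted k g).1.2 (shifted k g).2 = g.
Proof.
move=> gg; rewrite /= std_map ?std_self //; first exact: addn_inj.
exact: lgraph_ends (lgraph_self gg).
Qed.

Definition bound (V : seq nat) : nat := \max_(x <- V) x.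

Lemma shifted_disjoint V g : uniq V ->
  uniq (V ++ ((shifted (bound V) g).1.1 ++ (shifted (bound V) g).1.2)).
Proof.
move=> uV; rewrite cat_uniq uV -map_cat ext_int_iota map_inj_uniq ?iota_uniq ?andbT /=; last exact: addnI.
apply/hasPn => _ /mapP [y yi ->]; apply/negP => h.
have : (bound V + y <= bound V)%N by apply: (@leq_bigmax_seq _ V xpredT id).
by move: yi; rewrite mem_iota; lia.
Qed.

Lemma degen_catl I1 I2 E1 E2 : degen I1 E1 -> degen (I1 ++ I2) (E1 ++ E2).
Proof.
case/orP => [nu|hl]; apply/orP; [left|right].
  by apply: contra nu; rewrite map_cat cat_uniq => /andP [].
rewrite has_cat; apply/orP; left; apply: sub_has hl => e /andP [-> te] /=.
by rewrite mem_cat te.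
Qed.

Lemma degen_cat_perm I1 I2 E1 E2 : degen (I1 ++ I2) (E1 ++ E2) = degen (I2 ++ I1) (E2 ++ E1).
Proof. by apply: degen_perm; rewrite perm_catC. Qed.

Lemma uniq_shuffle (W1 I1 W2 I2 w : seq nat) : uniq ((W1 ++ I1) ++ (W2 ++ I2)) ->
  perm_eq w (W1 ++ W2) -> uniq (w ++ (I1 ++ I2)).
Proof.
move=> uV pw; have p : perm_eq (w ++ I1 ++ I2) ((W1 ++ I1) ++ W2 ++ I2).
  have pw2 : perm_eq (w ++ I1 ++ I2) ((W1 ++ W2) ++ I1 ++ I2) by rewrite perm_cat2r.
  by apply: perm_trans pw2 _; rewrite -!catA perm_cat2l perm_catCA.
by rewrite (perm_uniq p).
Qed.

Lemma sh_degenl W1 I1 E1 W2 I2 E2 : uniq ((W1 ++ I1) ++ (W2 ++ I2)) ->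
  degen I1 E1 -> sh W1 I1 E1 W2 I2 E2 = 0.
Proof.
move=> uV dg; rewrite /labelled_shuffle /cyc big_seq_cond big1 ?scaler0 // => w /andP [].
rewrite mem_permutations => pw _; rewrite cl_degen ?scaler0 //; last exact: degen_catl.
exact: uniq_shuffle uV pw.
Qed.

Lemma uniq_right (s t : seq nat) : uniq (s ++ t) -> uniq t.
Proof. by rewrite cat_uniq => /and3P []. Qed.

Lemma uniq_swap (V1 V2 : seq nat) : uniq (V1 ++ V2) -> uniq (V2 ++ V1).
Proof. by rewrite uniq_catC. Qed.

Lemma uniq_ext (W1 I1 W2 I2 : seq nat) : uniq ((W1 ++ I1) ++ (W2 ++ I2)) -> uniq (W1 ++ W2).
Proof. by apply: subseq_uniq; apply: cat_subseq; apply: prefix_subseq. Qed.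

(** Write w for the numbers of external vertices and n for [nlabels]. Exchanging the blocks costs w1
    w2 + n1 n2, from the external vertices and from the internal ones or the edges. The prefactors
    contribute n1 w2 + n2 w1, which completes the product of the gradings. *)
Lemma labelled_shuffleC W1 I1 E1 W2 I2 E2 : uniq ((W1 ++ I1) ++ (W2 ++ I2)) ->
  sh W1 I1 E1 W2 I2 E2 =
  bsgn R (odd ((size W1 + other_labels I1 E1) * (size W2 + other_labels I2 E2)))
    *: sh W2 I2 E2 W1 I1 E1.
Proof.
move=> uV; have uV' := uniq_swap uV; have uU := uniq_ext uV; have uU' := uniq_ext uV'.
have pU : perm_eq (W2 ++ W1) (W1 ++ W2) by rewrite perm_catC.
have pU' : perm_eq (W1 ++ W2) (W2 ++ W1) by rewrite perm_catC.
have uUI := uniq_shuffle uV' (perm_refl _).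
pose k := odd (size W1 * size W2) (+) odd (other_labels I1 E1 * other_labels I2 E2).
pose f21 w := bsgn R (perm_odd w (W2 ++ W1)) *: cl w (I2 ++ I1) (E2 ++ E1).
have key : cyc (W1 ++ W2) (restricts W1 W2)
    (fun w => bsgn R (perm_odd w (W1 ++ W2)) *: cl w (I1 ++ I2) (E1 ++ E2))
    = bsgn R k *: cyc (W2 ++ W1) (restricts W2 W1) f21.
  have rf : rot_invariant (W2 ++ W1) f21 := sh_summand_rot R c _ uUI (perm_refl _).
  rewrite (cyc_perm uU' pU (@restricts_rot _ _ _) rf) cyc_scale.
  apply: eq_cyc => [w _|w pw _]; first exact: restrictsC.
  rewrite /f21 bsgnZ; have uw := uniq_shuffle uV pw.
  have pw' := perm_trans pw pU'.
  have uw' := uniq_shuffle uV' pw'.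
  have [dg|nd] := boolP (degen (I1 ++ I2) (E1 ++ E2)).
    have dg' : degen (I2 ++ I1) (E2 ++ E1) by rewrite degen_cat_perm.
    by rewrite (cl_degen R c uw dg) (cl_degen R c uw' dg') !scaler0.
  have uE := degen_uniq nd.
  have pI : perm_eq (I1 ++ I2) (I2 ++ I1) by rewrite perm_catC.
  have pE : perm_eq (E1 ++ E2) (E2 ++ E1) by rewrite perm_catC.
  have uI : uniq (I1 ++ I2) := uniq_right uw.
  rewrite (cl_int R c _ uw' pI) (cl_edge R c uw' pE) !bsgnZ.
  rewrite (perm_odd_catC uI) (perm_odd_catC uE).
  rewrite (perm_odd_trans uU pw' pU) (perm_odd_catC uU') /k /other_labels mulnC.
  congr (bsgn R _ *: _); move: (perm_odd w _) (odd (size W1 * size W2)) => b1 b2.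
  rewrite /is_even; case: (is_odd c) => /=; move: (odd _) => b3; by case: b1; case: b2; case: b3.
rewrite /labelled_shuffle key !bsgnZ; congr (bsgn R _ *: _); rewrite /k.
rewrite !oddM !oddD; move: (odd (size W1)) (odd (size W2)) (odd (other_labels I1 E1)) (odd (other_labels I2 E2)).
by do 4 case.
Qed.

Lemma sh_rotl W1 I1 E1 W2 I2 E2 W' : uniq ((W1 ++ I1) ++ (W2 ++ I2)) -> rotation W' W1 ->
  sh W' I1 E1 W2 I2 E2 = bsgn R (perm_odd W' W1) *: sh W1 I1 E1 W2 I2 E2.
Proof.
move=> uV r; have pW := rotation_perm r; have uU := uniq_ext uV.
have pU : perm_eq (W' ++ W2) (W1 ++ W2) by rewrite perm_cat2r.
have uU' : uniq (W' ++ W2) by rewrite (perm_uniq pU).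
have uVI : uniq ((W' ++ W2) ++ (I1 ++ I2)) := uniq_shuffle uV pU.
have rf := sh_summand_rot R c (E1 ++ E2) uVI (perm_refl _).
rewrite /labelled_shuffle (cyc_perm uU' pU (@restricts_rot _ _ _) rf) !bsgnZ addbC -bsgnZ; congr (_ *: _).
rewrite cyc_scale; apply: eq_cyc => [w _|w pw _]; first exact: restricts_eql.
rewrite bsgnZ; congr (bsgn R _ *: _).
have pU2 : perm_eq (W1 ++ W2) (W' ++ W2) by rewrite perm_sym.
rewrite (perm_odd_trans uU' pw pU2) (perm_oddC uU pU2).
rewrite (@perm_odd_cat _ [::] W2 W' W1 uU pW); exact: addbC.
Qed.

Lemma sh_intl W1 I1 E1 W2 I2 E2 I' : uniq ((W1 ++ I1) ++ (W2 ++ I2)) -> perm_eq I' I1 ->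
  sh W1 I' E1 W2 I2 E2 = bsgn R (is_odd c && perm_odd I' I1) *: sh W1 I1 E1 W2 I2 E2.
Proof.
move=> uV pI; rewrite /labelled_shuffle /other_labels (perm_size pI) bsgnZ addbC -bsgnZ; congr (_ *: _).
rewrite cyc_scale; apply: eq_cyc => [//|w pw _].
have uw := uniq_shuffle uV pw; have pI2 : perm_eq (I' ++ I2) (I1 ++ I2) by rewrite perm_cat2r.
have uI : uniq (I1 ++ I2) := uniq_right uw.
rewrite (cl_int R c _ uw pI2) !bsgnZ (@perm_odd_cat _ [::] I2 I' I1 uI pI).
by rewrite addbC.
Qed.

Lemma sh_edgel W1 I1 E1 W2 I2 E2 E' : uniq ((W1 ++ I1) ++ (W2 ++ I2)) -> perm_eq E' E1 ->
  sh W1 I1 E' W2 I2 E2 = bsgn R (is_even c && perm_odd E' E1) *: sh W1 I1 E1 W2 I2 E2.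
Proof.
move=> uV pE; rewrite /labelled_shuffle /other_labels (perm_size pE) bsgnZ addbC -bsgnZ; congr (_ *: _).
rewrite cyc_scale; apply: eq_cyc => [//|w pw _].
have uw := uniq_shuffle uV pw; have pE2 : perm_eq (E' ++ E2) (E1 ++ E2) by rewrite perm_cat2r.
have [dg|nd] := boolP (degen (I1 ++ I2) (E1 ++ E2)).
  have dg' : degen (I1 ++ I2) (E' ++ E2) by rewrite (degen_perm (perm_refl _) pE2).
  by rewrite (cl_degen R c uw dg) (cl_degen R c uw dg') !scaler0.
rewrite (cl_edge R c uw pE2) !bsgnZ (@perm_odd_cat _ [::] E2 E' E1 (degen_uniq nd) pE).
by rewrite addbC.
Qed.

Lemma sh_revl W1 I1 e E1 W2 I2 E2 : uniq ((W1 ++ I1) ++ (W2 ++ I2)) -> flipped e ==> is_loop e ->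
  sh W1 I1 (reverse e :: E1) W2 I2 E2 = bsgn R (is_odd c) *: sh W1 I1 (e :: E1) W2 I2 E2.
Proof.
move=> uV fe; rewrite /labelled_shuffle bsgnZ addbC -bsgnZ; congr (_ *: _).
rewrite cyc_scale; apply: eq_cyc => [//|w pw _].
have uw := uniq_shuffle uV pw; rewrite !cat_cons (@cl_rev0 R c _ _ _ _ uw fe) !bsgnZ.
by rewrite addbC.
Qed.

Lemma uniq_catl (T : eqType) (V V' U : seq T) : perm_eq V' V -> uniq (V ++ U) -> uniq (V' ++ U).
Proof. by move=> p; rewrite (perm_uniq (perm_cat p (perm_refl U))). Qed.

Lemma shuffle_graphs_alternatingl g2 : is_graph g2 ->
  alternating c (fun g => shuffle_graphs R c g g2).
Proof.
move=> gg2.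
have key W I E (k := bound (W ++ I)) : lgraph W I E ->
    uniq ((W ++ I) ++ ((shifted k g2).1.1 ++ (shifted k g2).1.2)).
  by move=> lg; apply: shifted_disjoint; apply: lgraph_uniq lg.
have K W I E k : lgraph W I E -> uniq ((W ++ I) ++ ((shifted k g2).1.1 ++ (shifted k g2).1.2)) ->
    shuffle_graphs R c (std W I E) g2 = sh W I E (shifted k g2).1.1 (shifted k g2).1.2 (shifted k g2).2.
  move=> lg u; rewrite -[in LHS](shifted_std k gg2); apply: shuffle_graphs_std => //.
  exact: shifted_lgraph.
apply: alternating_front.
- move=> W I E W' lg r; have u := key W I E lg; have pW := rotation_perm r.
  have lg' : lgraph W' I E by rewrite (lgraph_perm pW (perm_refl _) (perm_refl _)).
  have u' := uniq_catl (perm_cat pW (perm_refl I)) u.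
  by rewrite (K _ _ _ _ lg u) (K _ _ _ _ lg' u') (sh_rotl _ _ u r).
- move=> W I E I' lg pI; have u := key W I E lg.
  have lg' : lgraph W I' E by rewrite (lgraph_perm (perm_refl _) pI (perm_refl _)).
  have u' := uniq_catl (perm_cat (perm_refl W) pI) u.
  by rewrite (K _ _ _ _ lg u) (K _ _ _ _ lg' u') (sh_intl _ _ u pI).
- move=> W I E E' lg nd pE; have u := key W I E lg.
  have lg' : lgraph W I E' by rewrite (lgraph_perm (perm_refl _) (perm_refl _) pE).
  by rewrite (K _ _ _ _ lg u) (K _ _ _ _ lg' u) (sh_edgel _ u pE).
- move=> W I e E lg; have u := key W I (e :: E) lg.
  have fe : flipped e ==> is_loop e by case/andP: lg => _ /and4P [_ /andP []].
  have lg' : lgraph W I (reverse e :: E) by apply: (@lgraph_reverse W I [::] E e).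
  by rewrite (K _ _ _ _ lg u) (K _ _ _ _ lg' u) (sh_revl _ _ u fe).
- move=> W I E lg dg; have u := key W I E lg.
  by rewrite (K _ _ _ _ lg u) (sh_degenl _ u dg).
Qed.

Definition gr_odd (g : predgraph) : bool :=
  odd (vext g) (+) (if is_odd c then odd (vint g) else odd (nedge g)).

Lemma shuffle_graphsC g1 g2 : is_graph g1 -> is_graph g2 ->
  shuffle_graphs R c g1 g2 = bsgn R (gr_odd g1 && gr_odd g2) *: shuffle_graphs R c g2 g1.
Proof.
move=> gg1 gg2; pose V := ext_vertices g1 ++ int_vertices g1; pose k := bound V.
have lg1 := lgraph_self gg1; have lg2 := shifted_lgraph k gg2.
have u := @shifted_disjoint V g2 (lgraph_uniq lg1).
have h1 := shuffle_graphs_std lg1 lg2 u; have h2 := shuffle_graphs_std lg2 lg1 (uniq_swap u).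
rewrite (std_self gg1) (shifted_std k gg2) in h1 h2.
rewrite h1 h2 (labelled_shuffleC _ _ u); congr (bsgn R _ *: _).
rewrite /other_labels /gr_odd /nedge /= !size_map !size_iota oddM !oddD.
by case: (is_odd c).
Qed.

Lemma gr_odd_perm W I E W' I' E' : size W' = size W -> size I' = size I -> size E' = size E ->
  gr_odd (std W' I' E') = gr_odd (std W I E).
Proof. by rewrite /gr_odd /nedge /= !size_map => -> -> ->. Qed.

(** The parity of the grading is unchanged by all the relations. Applied with commutativity, this
    transfers the alternating property from the left to the right argument of the product. *)
Lemma alternating_sign (M : lmodType R) (F G : predgraph -> M) (b : bool) :
  alternating c F -> (forall g, is_graph g -> G g = bsgn R (b && gr_odd g) *: F g) -> alternating c G.
Proof.
case=> h1 h2 h3 h4 h5 eG; split.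
- move=> W I E W' lg r; have pW := rotation_perm r.
  have lg' : lgraph W' I E by rewrite (lgraph_perm pW (perm_refl _) (perm_refl _)).
  rewrite !eG ?lgraph_std // (h1 _ _ _ _ lg r) (gr_odd_perm (W := W) (I := I) (E := E)) ?(perm_size pW) //.
  by rewrite !bsgnZ addbC.
- move=> W I E I' lg pI.
  have lg' : lgraph W I' E by rewrite (lgraph_perm (perm_refl _) pI (perm_refl _)).
  rewrite !eG ?lgraph_std // (h2 _ _ _ _ lg pI) (gr_odd_perm (W := W) (I := I) (E := E)) ?(perm_size pI) //.
  by rewrite !bsgnZ addbC.
- move=> W I E E' lg nd pE.
  have lg' : lgraph W I E' by rewrite (lgraph_perm (perm_refl _) (perm_refl _) pE).
  rewrite !eG ?lgraph_std // (h3 _ _ _ _ lg nd pE) (gr_odd_perm (W := W) (I := I) (E := E)) ?(perm_size pE) //.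
  by rewrite !bsgnZ addbC.
- move=> W I E1 e E2 lg; have lg' := lgraph_reverse lg.
  rewrite !eG ?lgraph_std // (h4 _ _ _ _ _ lg) (gr_odd_perm (W := W) (I := I) (E := E1 ++ e :: E2)) ?size_cat //.
  by rewrite !bsgnZ addbC.
- by move=> W I E lg dg; rewrite eG ?lgraph_std // h5 // scaler0.
Qed.

Lemma shuffle_graphs_alternatingr g1 : is_graph g1 ->
  alternating c (fun g => shuffle_graphs R c g1 g).
Proof.
move=> gg1; apply: (alternating_sign (b := gr_odd g1) (shuffle_graphs_alternatingl gg1)).
by move=> g gg; apply: shuffle_graphsC.
Qed.

(** * Bilinear extension of the product *)

Let B (v u : {malg R[dgraph]}) : graph_complex R c :=
  lextend (fun g1 : dgraph => lextend (fun g2 : dgraph => shuffle_graphs R c (val g1) (val g2)) u) v.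

Lemma lextend_span (M : lmodType R) (f : dgraph -> M) u v :
  (forall r, graph_rel c r -> lextend f r = 0) ->
  u - v \in span (@graph_rel R c) -> lextend f u = lextend f v.
Proof.
move=> kf /spanP [s [sr e]]; apply/eqP; rewrite -subr_eq0 -linearB e /=.
by rewrite linear_sum big_seq big1 // => x /sr /kf xr; rewrite linearZ /= xr scaler0.
Qed.

Lemma lextend_exchange (f : dgraph -> dgraph -> graph_complex R c) v u :
  lextend (fun g1 => lextend (f g1) u) v = lextend (fun g2 => lextend (f^~ g2) v) u.
Proof.
rewrite /lextend.
transitivity (\sum_(k <- msupp v) \sum_(j <- msupp u) v@_k *: (u@_j *: f k j)).
  by apply: eq_bigr => k _; rewrite scaler_sumr.
rewrite exchange_big /=; apply: eq_bigr => j _; rewrite scaler_sumr.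
by apply: eq_bigr => k _; rewrite !scalerA mulrC.
Qed.

(** The chosen representatives are replaced one argument at a time, each time because the product is
    alternating in that argument. *)
Lemma shuffle_pi v u : shuffle R c (quot_pi (@graph_rel R c) v) (quot_pi (@graph_rel R c) u) = B v u.
Proof.
rewrite /shuffle -/(B _ _).
have sp w : quot_repr (quot_pi (@graph_rel R c) w) - w \in span (@graph_rel R c).
  by apply/quot_piP; rewrite quot_reprK.
transitivity (B (quot_repr (quot_pi (@graph_rel R c) v)) u).
  rewrite /B /lextend; apply: eq_bigr => k _; congr (_ *: _).
  apply: lextend_span (sp u).
  exact: alternating_kills (shuffle_graphs_alternatingr (valP k)).
rewrite /B; apply: lextend_span (sp v) => r rr.
rewrite lextend_exchange /lextend big1 // => k _.
have := alternating_kills (shuffle_graphs_alternatingl (valP k)) rr.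
by rewrite /lextend => ->; rewrite scaler0.
Qed.

Lemma shuffle_linearl y : linear ((shuffle R c)^~ y).
Proof.
move=> a x x'; rewrite -(quot_reprK x) -(quot_reprK x') -(quot_reprK y).
rewrite -linearZ -linearD !shuffle_pi /B.
by rewrite linearP.
Qed.

Lemma shuffle_linearr x : linear (shuffle R c x).
Proof.
move=> a y y'; rewrite -(quot_reprK x) -(quot_reprK y) -(quot_reprK y').
rewrite -linearZ -linearD !shuffle_pi.
have e w : B (quot_repr x) w = lextend (fun g2 : dgraph =>
    lextend (fun g1 : dgraph => shuffle_graphs R c (val g1) (val g2)) (quot_repr x)) w.
  exact: lextend_exchange.
by rewrite !e linearP.
Qed.

Lemma shuffle_cls g1 g2 : is_graph g1 -> is_graph g2 ->
  shuffle R c (cls R c g1) (cls R c g2) = shuffle_graphs R c g1 g2.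
Proof.
move=> gg1 gg2; rewrite /cls shuffle_pi.
rewrite /B (lextend_gen (fun h => lextend (fun g : dgraph => shuffle_graphs R c h (val g)) (gen R g2)) gg1).
exact: (lextend_gen (fun g => shuffle_graphs R c g1 g) gg2).
Qed.

Lemma shuffle_cl W1 I1 E1 W2 I2 E2 : lgraph W1 I1 E1 -> lgraph W2 I2 E2 ->
  uniq ((W1 ++ I1) ++ (W2 ++ I2)) ->
  shuffle R c (cl W1 I1 E1) (cl W2 I2 E2) = sh W1 I1 E1 W2 I2 E2.
Proof.
move=> lg1 lg2 u; rewrite /graph_cls (shuffle_cls (lgraph_std lg1) (lgraph_std lg2)).
exact: shuffle_graphs_std.
Qed.
End ShuffleGraphs.

(** * The Leibniz rule *)

Lemma disjoint_notin (V1 V2 : seq nat) x : uniq (V1 ++ V2) -> x \in V1 -> x \notin V2.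
Proof.
rewrite cat_uniq => /and3P [_ /hasPn h _] x1; apply/negP => /h /=.
by rewrite x1.
Qed.

Lemma edge_valence_cat E1 E2 x :
  edge_valence (E1 ++ E2) x = (edge_valence E1 x + edge_valence E2 x)%N.
Proof. by rewrite /edge_valence !count_cat addnACA. Qed.

Lemma lgraph_shuffle W1 I1 E1 W2 I2 E2 w : lgraph W1 I1 E1 -> lgraph W2 I2 E2 ->
  uniq ((W1 ++ I1) ++ (W2 ++ I2)) -> perm_eq w (W1 ++ W2) ->
  lgraph w (I1 ++ I2) (E1 ++ E2).
Proof.
move=> /andP [_ /and4P [EV1 f1 vW1 vI1]] /andP [_ /and4P [EV2 f2 vW2 vI2]] uV pw.
apply/andP; split; first exact: uniq_shuffle uV pw.
have sub (W I : seq nat) E : {subset W ++ I <= w ++ I1 ++ I2} -> all (ends_in (W ++ I)) E -> all (ends_in (w ++ I1 ++ I2)) E.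
  by move=> s EV; apply/allP => e /(allP EV) /andP [te he]; rewrite /ends_in !s.
have s1 : {subset W1 ++ I1 <= w ++ I1 ++ I2}.
  by move=> x; rewrite !mem_cat (perm_mem pw) mem_cat => /orP [->|->]; rewrite ?orbT.
have s2 : {subset W2 ++ I2 <= w ++ I1 ++ I2}.
  by move=> x; rewrite !mem_cat (perm_mem pw) mem_cat => /orP [->|->]; rewrite ?orbT.
apply/and4P; split.
- by rewrite all_cat (sub _ _ _ s1 EV1) (sub _ _ _ s2 EV2).
- by rewrite all_cat f1 f2.
- rewrite (perm_all _ pw) all_cat; apply/andP; split; apply/allP => x xW; rewrite edge_valence_cat.
    exact: leq_trans (allP vW1 x xW) (leq_addr _ _).
  exact: leq_trans (allP vW2 x xW) (leq_addl _ _).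
- rewrite all_cat; apply/andP; split; apply/allP => x xI; rewrite edge_valence_cat.
    exact: leq_trans (allP vI1 x xI) (leq_addr _ _).
  exact: leq_trans (allP vI2 x xI) (leq_addl _ _).
Qed.

Lemma degen_shuffle W1 I1 E1 W2 I2 E2 : lgraph W1 I1 E1 -> lgraph W2 I2 E2 ->
  uniq ((W1 ++ I1) ++ (W2 ++ I2)) -> ~~ degen I1 E1 -> ~~ degen I2 E2 ->
  ~~ degen (I1 ++ I2) (E1 ++ E2).
Proof.
move=> lg1 lg2 uV /norP [u1 l1] /norP [u2 l2]; rewrite !negbK in u1 u2.
have EV1 := lgraph_ends lg1; have EV2 := lgraph_ends lg2.
have no e1 e2 : e1 \in E1 -> e2 \in E2 -> ~~ parallel e1 e2.
  move=> /(allP EV1) /andP [t1 _] /(allP EV2) /andP [t2 h2]; apply/negP.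
  have := disjoint_notin uV t1.
  by move=> nt /orP [] /andP [/eqP e _]; move: nt; rewrite e ?t2 ?h2.
rewrite /degen negb_or negbK map_cat cat_uniq u1 u2 andbT /=; apply/andP; split.
  apply/hasPn => _ /mapP [e2 e2E ->]; apply/negP => /mapP [e1 e1E /eqP].
  by rewrite eq_sym ends_eq; apply/negP; apply: no.
rewrite has_cat negb_or; apply/andP; split; apply/hasPn => e eE; apply/negP => /andP [le].
  rewrite mem_cat => /orP [tI|tI]; first by move/hasPn: l1 => /(_ e eE); rewrite le tI.
  have /andP [te _] := allP EV1 e eE.
  by have := disjoint_notin uV te; rewrite mem_cat tI orbT.
rewrite mem_cat => /orP [tI|tI]; last by move/hasPn: l2 => /(_ e eE); rewrite le tI.
have /andP [te _] := allP EV2 e eE.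
have tI' : tail e \in W1 ++ I1 by rewrite mem_cat tI orbT.
by have := disjoint_notin uV tI'; rewrite te.
Qed.

Section SumHeads.
Context (R : realType) (V : lmodType R).

Lemma sum_heads (U : seq nat) (C : pred (seq nat)) (f : seq nat -> V) : uniq U -> f [::] = 0 ->
  \sum_(v <- permutations U | C v) f v =
  \sum_(x <- U) \sum_(v <- permutations U | (ohead v == Some x) && C v) f v.
Proof.
move=> uU f0; 
transitivity (\sum_(v <- permutations U) \sum_(x <- U) if (ohead v == Some x) && C v then f v else 0).
  rewrite big_mkcond !big_seq; apply: eq_bigr => v; rewrite mem_permutations => pv.
  case: ifP => Cv; last by rewrite big1 // => x _; rewrite andbF.
  case: v pv Cv => [|x v] pv Cv; first by rewrite big1.
  have xU : x \in U by rewrite -(perm_mem pv) mem_head.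
  rewrite (bigD1_seq x) //= eqxx big1 ?addr0 // => z zx.
  by case: eqP => // -[e]; rewrite e eqxx in zx.
rewrite exchange_big /=; apply: eq_bigr => x _.
by rewrite [RHS]big_mkcond.
Qed.

Lemma sum_swap_heads (U : seq nat) (H : seq nat -> V) (sw := fun v : seq nat => if v is x :: y :: w then y :: x :: w else v) :
  uniq U -> \sum_(v <- permutations U) H (sw v) = \sum_(v <- permutations U) H v.
Proof.
move=> uU; have swK : involutive sw by case=> [|x [|y w]].
rewrite -(big_map sw predT H); apply: perm_big; apply: uniq_perm.
- by rewrite map_inj_uniq ?permutations_uniq //; apply: inv_inj.
- exact: permutations_uniq.
have psw v : perm_eq (sw v) v by case: v => [|x [|y w]] //=; apply: (perm_adjacent [::]).
move=> v; apply/mapP/idP => [[w]|]; rewrite !mem_permutations.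
  by move=> pw ->; apply: perm_trans pw.
move=> pv; exists (sw v); last by rewrite swK.
by rewrite mem_permutations; apply: perm_trans pv.
Qed.
End SumHeads.

Section Leibniz.
Context (R : realType) (c : parity).
Local Notation cl := (graph_cls R c).
Local Notation other_labels := (nlabels c).

(* The contraction of the arc between the first two letters of v. *)
Definition arc_word (U I : seq nat) (E : seq edge) (A B : seq nat) (v : seq nat) : graph_complex R c :=
  if v is x :: y :: w then
    if (x \in A) && (y \in B) then
      bsgn R (perm_odd v U) *: cl (x :: w) I (map (merge_ends x y) E)
    else 0
  else 0.

(** A circular word with a marked arc is the same thing as a linear word, read from the origin of
    that arc. *)
Lemma cyc_arc_sum U I E (C : pred (seq nat)) : uniq (U ++ I) -> rot_invariant U C ->
  cyc U C (fun w => bsgn R (perm_odd w U) *: arc_sum R c w I E)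
  = \sum_(v <- permutations U | C v) arc_word U I E U U v.
Proof.
move=> uV rC; have uU : uniq U by move: uV; rewrite cat_uniq => /andP [].
rewrite sum_heads //.
transitivity (\sum_(x <- U) cyc U C (fun w => arc_word U I E U U (from x w))).
  rewrite /cyc exchange_big /=; rewrite big_seq_cond [RHS]big_seq_cond; apply: eq_bigr => w /andP [].
  rewrite mem_permutations => pw _; rewrite /arc_sum (perm_big _ pw) /= scaler_sumr !big_seq.
  apply: eq_bigr => x xU; have xw : x \in w by rewrite (perm_mem pw).
  rewrite /arc_contraction fromE //; case aE : (after x w) => [|y u]; first by rewrite scaler0.
  have pxu : perm_eq (x :: y :: u) w by rewrite -aE perm_after.
  have yU : y \in U by rewrite -(perm_mem pw) -(perm_mem pxu) !inE eqxx orbT.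
  by rewrite /arc_word xU yU bsgnZ (perm_odd_trans uU pxu pw) addbC.
rewrite !big_seq; apply: eq_bigr => x xU; case: U uU uV rC xU => [//|h U] uU uV rC xU.
by rewrite (sum_from _ uU xU (mem_head h U) rC).
Qed.

(** No edge joins the two factors, so merging [x] and [y] creates no loop, and the two sides differ
    only in the name of the merged vertex. *)
Lemma arc_word_swap W1 I1 E1 W2 I2 E2 x y w : lgraph W1 I1 E1 -> lgraph W2 I2 E2 ->
  uniq ((W1 ++ I1) ++ (W2 ++ I2)) -> perm_eq (x :: y :: w) (W1 ++ W2) ->
  x \in W1 -> y \in W2 ->
  cl (x :: w) (I1 ++ I2) (map (merge_ends x y) (E1 ++ E2))
  = cl (y :: w) (I1 ++ I2) (map (merge_ends y x) (E1 ++ E2)).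
Proof.
move=> lg1 lg2 uV pw x1 y2; have lg := lgraph_shuffle lg1 lg2 uV pw.
have p2 : perm_eq (y :: x :: w) (W1 ++ W2) by apply: perm_trans pw; apply: (perm_adjacent [::]).
have lg' := lgraph_shuffle lg1 lg2 uV p2.
have lgm := lgraph_merge lg'; have u' := lgraph_uniq lg'.
have xn : x \notin (y :: w) ++ (I1 ++ I2).
  by move: u'; rewrite /= inE negb_or eq_sym => /andP [/andP [h _] /andP [h2 _]]; rewrite inE negb_or h h2.
have yn : y \notin w /\ y \notin I1 ++ I2.
  by move: u'; rewrite /= inE mem_cat !negb_or => /andP [/and3P []].
rewrite -[RHS](@cl_map R c (subst y x) _ _ _ (subst_inj xn) (lgraph_ends lgm)).
have -> : map (subst y x) (y :: w) = x :: w.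
  by rewrite /= (map_subst_id x (proj1 yn)) /subst eqxx.
rewrite (map_subst_id x (proj2 yn)).
congr (graph_cls R c _ _ _); rewrite -map_comp; apply/eq_in_map => e eE /=.
have x1V : x \in W1 ++ I1 by rewrite mem_cat x1.
have y2V : y \in W2 ++ I2 by rewrite mem_cat y2.
have xn2 := disjoint_notin uV x1V.
have yn1 : y \notin W1 ++ I1 by apply: contraL y2V => /(disjoint_notin uV).
have nj : ~~ joins x y e.
  apply/negP => /joinsP j; move: eE; rewrite mem_cat => /orP [/(allP (lgraph_ends lg1))|/(allP (lgraph_ends lg2))] /andP [te he].
    by move: yn1; case: j => -[e1 e2]; rewrite -?e1 -?e2 ?te ?he.
  by move: xn2; case: j => -[e1 e2]; rewrite -?e1 -?e2 ?te ?he.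
rewrite !merge_not_joins //; last by rewrite joins_sym.
by rewrite map_ends_comp; congr (_, _, _); rewrite /= substK.
Qed.

Lemma filter_swap (p : pred nat) x y w : ~~ (p x && p y) -> filter p (x :: y :: w) = filter p (y :: x :: w).
Proof. by move=> /=; case: (p x); case: (p y). Qed.

(** Exchanging the first two letters matches the arcs from [W1] to [W2] with those from [W2] to
    [W1]. It does not affect the restrictions to the factors and reverses the sign. *)
Lemma arc_word_mixed W1 I1 E1 W2 I2 E2 (U := W1 ++ W2) (I := I1 ++ I2) (E := E1 ++ E2) :
  lgraph W1 I1 E1 -> lgraph W2 I2 E2 -> uniq ((W1 ++ I1) ++ (W2 ++ I2)) ->
  \sum_(v <- permutations U | restricts W1 W2 v)
    (arc_word U I E W1 W2 v + arc_word U I E W2 W1 v) = 0.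
Proof.
move=> lg1 lg2 uV; have uU : uniq U := uniq_ext uV.
rewrite big_split /=; apply/eqP; rewrite addr_eq0; apply/eqP.
rewrite big_mkcond [X in _ = - X]big_mkcond /= -sum_swap_heads // -sumrN !big_seq.
apply: eq_bigr => -[|x [|y w]]; rewrite mem_permutations => pv; try by rewrite if_same oppr0.
have ux : uniq (x :: y :: w) by rewrite (perm_uniq pv).
have xy : x != y by apply: (@uniq_adjacent _ [::] x y w).
have d x' : x' \in W1 -> x' \notin W2 by apply: disjoint_notin.
have [/andP [y1 x2]|nxy] := boolP ((y \in W1) && (x \in W2)); last first.
  rewrite /arc_word (negbTE nxy) if_same; move: nxy; rewrite andbC => /negbTE ->.
  by rewrite if_same oppr0.
have x1 : x \notin W1 by apply: contraL x2; apply: d.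
have y2 : y \notin W2 by apply: d.
have -> : restricts W1 W2 (y :: x :: w) = restricts W1 W2 (x :: y :: w).
  rewrite /restricts !(filter_swap (x := y) (y := x)) //.
    by rewrite (negbTE y2).
  by rewrite (negbTE x1) andbF.
rewrite /arc_word y1 x2 /=; case: ifP => _; last by rewrite oppr0.
have pv' : perm_eq (y :: x :: w) U by apply: perm_trans pv; apply: (perm_adjacent [::]).
rewrite (arc_word_swap lg1 lg2 uV pv' y1 x2) -bsgnN; congr (bsgn R _ *: _).
exact: perm_odd_two.
Qed.

Lemma arc_word_split W1 W2 I E v : uniq (W1 ++ W2) -> perm_eq v (W1 ++ W2) ->
  arc_word (W1 ++ W2) I E (W1 ++ W2) (W1 ++ W2) v =
  arc_word (W1 ++ W2) I E W1 W1 v + arc_word (W1 ++ W2) I E W2 W2 v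
  + (arc_word (W1 ++ W2) I E W1 W2 v + arc_word (W1 ++ W2) I E W2 W1 v).
Proof.
move=> uU; case: v => [|x [|y w]] pv; rewrite ?addr0 // /arc_word.
have xU : x \in W1 ++ W2 by rewrite -(perm_mem pv) mem_head.
have yU : y \in W1 ++ W2 by rewrite -(perm_mem pv) !inE eqxx orbT.
rewrite xU yU /=; move: xU yU; rewrite !mem_cat.
have [x1|x1] := boolP (x \in W1); have [y1|y1] := boolP (y \in W1) => /= x2 y2;
  rewrite ?(negbTE (disjoint_notin uU x1)) ?(negbTE (disjoint_notin uU y1)) ?x2 ?y2 /= ?addr0 ?add0r //.
Qed.
End Leibniz.

Lemma uniq_second (T : eqType) (x y : T) w : uniq (x :: y :: w) -> y \notin w.
Proof. by rewrite !cons_uniq => /and3P [_ ? _]. Qed.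

Lemma map_merge_id x y V E : all (ends_in V) E -> x \notin V -> y \notin V ->
  map (merge_ends x y) E = E.
Proof.
move=> EV xV yV; rewrite -[RHS]map_id; apply/eq_in_map => e /(allP EV) /andP [te he].
have nj : ~~ joins x y e.
  by apply/negP => /joinsP [] [e1 e2]; move: te xV; [rewrite e1 => ->|move: he; rewrite e2 => -> _].
rewrite merge_not_joins // /map_ends /subst.
case: eqP => [e1|_]; first by move: yV; rewrite -e1 te.
case: eqP => [e1|_]; first by move: yV; rewrite -e1 he.
by rewrite -edge_eta.
Qed.

Lemma ctr_id a t V E : all (ends_in V) E -> a \notin V -> contract a t E = E.
Proof.
move=> EV aV; rewrite /contract -[RHS]map_id; apply/eq_in_map => e /(allP EV) /andP [te he].
rewrite /map_ends /subst.
case: eqP => [e1|_]; first by move: aV; rewrite -e1 te.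
case: eqP => [e1|_]; first by move: aV; rewrite -e1 he.
by rewrite -edge_eta.
Qed.

Section LeibnizMain.
Context (R : realType) (c : parity).
Local Notation cl := (graph_cls R c).
Local Notation other_labels := (nlabels c).
Local Notation sh := (labelled_shuffle R c).
Local Notation arc_word := (arc_word R c).

(** If the first two letters [x], [y] of a shuffle lie in [W1], then [y] follows [x] on the circle
    of [W1]. Deleting [y] yields precisely the shuffles of the contracted circle with [W2]. *)
Lemma arc_word_left W1 I1 E1 W2 I2 E2 (U := W1 ++ W2) (I := I1 ++ I2) :
  lgraph W1 I1 E1 -> lgraph W2 I2 E2 -> uniq ((W1 ++ I1) ++ (W2 ++ I2)) ->
  \sum_(v <- permutations U | restricts W1 W2 v) arc_word U I (E1 ++ E2) W1 W1 v
  = \sum_(x <- W1) (if after x W1 is y :: u then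
      bsgn R (perm_odd (from x W1) W1) *: cyc ((x :: u) ++ W2) (restricts (x :: u) W2)
        (fun w => bsgn R (perm_odd w ((x :: u) ++ W2)) *: cl w I (map (merge_ends x y) E1 ++ E2))
      else 0).
Proof.
move=> lg1 lg2 uV; have uU : uniq U := uniq_ext uV.
have uW1 : uniq W1 by move: uU; rewrite cat_uniq => /andP [].
rewrite sum_heads // big_cat /= [X in _ + X]big_seq [X in _ + X]big1 ?addr0; last first.
  move=> x x2; have x1 : x \notin W1 by apply: contraL x2; apply: disjoint_notin.
  apply: big1 => -[|z [|y w]] //= /andP [/eqP [->] _].
  by rewrite (negbTE x1).
rewrite !big_seq; apply: eq_bigr => x x1.
have rfx := fromE x1; have pW := perm_after x1.
case aE : (after x W1) rfx pW => [|y u] rfx pW.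
  rewrite big_seq_cond big1 // => -[|z [|y w]] //= /andP [pv /andP [/eqP [ez] _]].
  move: pv; rewrite mem_permutations ez => pv.
  have ux : uniq (x :: y :: w) by rewrite (perm_uniq pv).
  have yn : y \notin W1.
    by rewrite -(perm_mem pW) inE; apply: contraTneq ux => -> /=; rewrite mem_head.
  by rewrite (negbTE yn) andbF.
have uxyu : uniq (x :: y :: u) by rewrite (perm_uniq pW).
have y1 : y \in W1 by rewrite -(perm_mem pW) !inE eqxx orbT.
have y2 : y \notin W2 by apply: (disjoint_notin uU y1).
have x2 : x \notin W2 by apply: (disjoint_notin uU x1).
have xy : x != y by apply: (@uniq_adjacent _ [::] x y u).
(* [psi] reinserts [y] after the first letter; it is a bijection from the shuffles [B] of the
   contracted circle onto the words [A] that begin with [x], [y]. *)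
pose psi (w : seq nat) := if w is z :: w' then z :: y :: w' else w.
pose A := [seq v <- permutations U | [&& ohead v == Some x, restricts W1 W2 v & ohead (behead v) == Some y]].
pose B := [seq w <- permutations ((x :: u) ++ W2) | (ohead w == ohead ((x :: u) ++ W2)) && restricts (x :: u) W2 w].
have uB : uniq B by rewrite filter_uniq ?permutations_uniq.
have pU : perm_eq (x :: y :: u ++ W2) U by rewrite -!cat_cons perm_cat2r.
have fW (w : seq nat) : y \notin w -> [seq z <- w | z \in W1] = [seq z <- w | z \in x :: u].
  move=> yw; apply: eq_in_filter => z zw; rewrite -(perm_mem pW) !inE.
  by have [e|_] := eqVneq z y; [rewrite -e zw in yw|].
have rx1 : rotation (x :: y :: u) W1 by rewrite -rfx from_rotation.
have pAB : perm_eq A (map psi B).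
  apply: uniq_perm; first by rewrite filter_uniq ?permutations_uniq.
    rewrite map_inj_in_uniq // => -[|z w] [|z' w']; rewrite /B !mem_filter //= => _ _.
    by case=> -> ->.
  move=> v; rewrite mem_filter mem_permutations; apply/andP/mapP.
    case: v => [|z [|z' w]]; [by case|by case=> /and3P []|].
    case=> /and3P [/eqP [ez] Cv /eqP [ez']] pv.
    rewrite {}ez {}ez' {z z'} in Cv pv *.
    have ux : uniq (x :: y :: w) by rewrite (perm_uniq pv).
    have yw : y \notin w := uniq_second ux.
    have pw : perm_eq w (u ++ W2) by rewrite -(perm_cons y) -(perm_cons x); apply: perm_trans pv _; rewrite perm_sym.
    exists (x :: w) => //; rewrite mem_filter mem_permutations /= eqxx perm_cons pw andbT /=.
    move: Cv; rewrite /restricts /= x1 y1 (negbTE x2) (negbTE y2) mem_head fW // => /andP [r1 ->].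
    rewrite andbT; have := from_head uW1 r1; rewrite rfx => -[<-].
    exact: rotation_refl.
  case=> w; rewrite mem_filter mem_permutations => /andP [/andP [hw Cw] pw] ->.
  case: w hw Cw pw => [//|z w] /= /eqP [->] Cw pw {z}.
  have pw' : perm_eq w (u ++ W2) by move: pw; rewrite perm_cons.
  have pv : perm_eq (x :: y :: w) U by apply: perm_trans pU; rewrite !perm_cons.
  have ux : uniq (x :: y :: w) by rewrite (perm_uniq pv).
  have yw : y \notin w := uniq_second ux.
  split => //; rewrite !eqxx andbT /=; move: Cw.
  rewrite /restricts /= x1 y1 (negbTE x2) (negbTE y2) mem_head -fW // => /andP [r1 ->].
  rewrite andbT; have uxu : uniq (x :: u).
    by move: uxyu; rewrite (perm_uniq (perm_adjacent [::] x y u)) => /andP [].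
  by rewrite (rotation_head uxu r1).
transitivity (\sum_(v <- A) arc_word U I (E1 ++ E2) W1 W1 v).
  rewrite /A big_filter big_seq_cond [RHS]big_seq_cond.
  rewrite big_mkcond [RHS]big_mkcond; apply: eq_bigr => v _; rewrite mem_permutations.
  have [pv|//] := boolP (perm_eq v U); case: v pv => [|z [|z' w]] pv //=.
    by rewrite !if_same.
  have [ez|//] := boolP (Some z == Some x); move/eqP: ez => [ez].
  have [Cv|//] := boolP (restricts W1 W2 _); rewrite /=.
  (* The restriction to [W1] begins with [x] and is a rotation of [W1], so its second letter is
     [y]. *)
  case: eqP => // nz; case: ifP => // /andP [z1 z1']; exfalso; apply: nz.
  move: Cv; rewrite /restricts /= ez x1 z1' => /andP [r1 _].
  by have := from_head uW1 r1; rewrite rfx => -[->].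
rewrite (perm_big _ pAB) /= big_map /B big_filter cyc_scale /cyc.
rewrite big_seq_cond [RHS]big_seq_cond; apply: eq_bigr => w /andP [].
rewrite mem_permutations => pw /andP [hw Cw].
case: w hw Cw pw => [//|z w] /= /eqP [->] Cw pw {z}.
have pw' : perm_eq w (u ++ W2) by move: pw; rewrite perm_cons.
have uxuW : uniq (x :: y :: u ++ W2) by rewrite (perm_uniq pU).
have uyuW : uniq (y :: u ++ W2) by move: uxuW => /andP [].
have uxu : uniq (x :: u ++ W2).
  by move: uxuW; rewrite (perm_uniq (perm_adjacent [::] x y (u ++ W2))) => /andP [].
rewrite x1 y1 /= bsgnZ map_cat.
have -> : map (merge_ends x y) E2 = E2.
  apply: (map_merge_id (lgraph_ends lg2)); apply: (disjoint_notin uV); rewrite mem_cat ?x1 ?y1 //.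
congr (bsgn R _ *: _).
have pw2 : perm_eq (x :: y :: w) (x :: y :: u ++ W2) by rewrite !perm_cons.
rewrite (perm_odd_trans uU pw2 pU).
have pyw : perm_eq (y :: w) (y :: u ++ W2) by rewrite perm_cons.
rewrite (perm_odd_cons uxuW pyw) (perm_odd_cons uyuW pw') (perm_odd_cons uxu pw').
have -> : perm_odd (x :: y :: u ++ W2) U = perm_odd (x :: y :: u) W1.
  exact: (@perm_odd_cat _ [::] W2 (x :: y :: u) W1).
by rewrite rfx addbC.
Qed.

(** Exchanging the factors reduces arcs of [W2] to [arc_word_left]; the sign is that of
    [labelled_shuffleC] without its prefactors. *)
Lemma arc_word_right W1 I1 E1 W2 I2 E2 :
  lgraph W1 I1 E1 -> lgraph W2 I2 E2 -> uniq ((W1 ++ I1) ++ (W2 ++ I2)) ->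
  ~~ degen (I1 ++ I2) (E1 ++ E2) ->
  \sum_(v <- permutations (W1 ++ W2) | restricts W1 W2 v)
     arc_word (W1 ++ W2) (I1 ++ I2) (E1 ++ E2) W2 W2 v
  = bsgn R (odd (size W1 * size W2) (+) odd (other_labels I1 E1 * other_labels I2 E2)) *:
    \sum_(v <- permutations (W2 ++ W1) | restricts W2 W1 v)
     arc_word (W2 ++ W1) (I2 ++ I1) (E2 ++ E1) W2 W2 v.
Proof.
move=> lg1 lg2 uV nd; have uU := uniq_ext uV; have uE := degen_uniq nd.
have uV' := uniq_swap uV; have uU' := uniq_ext uV'.
have pU : perm_eq (W2 ++ W1) (W1 ++ W2) by rewrite perm_catC.
have pU' : perm_eq (W1 ++ W2) (W2 ++ W1) by rewrite perm_catC.
rewrite (perm_big _ (permutations_perm pU')) /= scaler_sumr.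
rewrite big_seq_cond [RHS]big_seq_cond; apply: eq_big => v; first by rewrite restrictsC.
rewrite mem_permutations => /andP [pv' _]; have pv := perm_trans pv' pU.
case: v pv pv' => [|x [|y w]] pv pv'; rewrite /arc_word ?scaler0 //.
case: ifP => _; last by rewrite scaler0.
have uw : uniq ((x :: y :: w) ++ (I1 ++ I2)) := uniq_shuffle uV pv.
have uw' : uniq ((x :: y :: w) ++ (I2 ++ I1)) := uniq_shuffle uV' pv'.
have ux' : uniq ((x :: w) ++ (I2 ++ I1)).
  by apply: subseq_uniq uw'; apply: cat_subseq => //; rewrite /= eqxx; apply: subseq_cons.
have pI : perm_eq (I1 ++ I2) (I2 ++ I1) by rewrite perm_catC.
have pE : perm_eq (E1 ++ E2) (E2 ++ E1) by rewrite perm_catC.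
have uE' : uniq (E2 ++ E1) by rewrite uniq_catC.
have uI := uniq_right uw.
rewrite (cl_int R c _ ux' pI) (cl_edge_map R c _ ux' uE' pE) !bsgnZ.
rewrite (perm_odd_catC uI) (perm_odd_catC uE).
rewrite (perm_odd_trans uU pv' pU) (perm_odd_catC uU') mulnC.
congr (bsgn R _ *: _); move: (perm_odd _ _) (odd (size W1 * size W2)) => b1 b2.
rewrite /nlabels /is_even; case: (is_odd c) => /=; move: (odd _) => b3; by case: b1; case: b2; case: b3.
Qed.

(** The ends of [e] are labels of the first factor, so its contraction leaves [E2] unchanged, and
    its position in the concatenated lists is that in [I1] and [E1]. *)
Lemma cyc_edges W1 I1 E1 W2 I2 E2 :
  lgraph W1 I1 E1 -> lgraph W2 I2 E2 -> uniq ((W1 ++ I1) ++ (W2 ++ I2)) ->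
  ~~ degen (I1 ++ I2) (E1 ++ E2) -> ~~ degen I1 E1 ->
  cyc (W1 ++ W2) (restricts W1 W2) (fun w => bsgn R (perm_odd w (W1 ++ W2)) *:
    \sum_(e <- E1) edge_term R c w (I1 ++ I2) (E1 ++ E2) e)
  = \sum_(e <- E1) (if regular I1 e then edge_sign R c I1 E1 e *:
      cyc (W1 ++ W2) (restricts W1 W2) (fun w => bsgn R (perm_odd w (W1 ++ W2)) *:
        cl w (rem (contracted I1 e) I1 ++ I2)
           (contract (contracted I1 e) (target I1 e) (rem e E1) ++ E2)) else 0).
Proof.
move=> lg1 lg2 uV nd nd1; have uE := degen_uniq nd.
transitivity (\sum_(e <- E1) cyc (W1 ++ W2) (restricts W1 W2)
  (fun w => bsgn R (perm_odd w (W1 ++ W2)) *: edge_term R c w (I1 ++ I2) (E1 ++ E2) e)).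
  by rewrite /cyc exchange_big /=; apply: eq_bigr => w _; rewrite scaler_sumr.
rewrite !big_seq; apply: eq_bigr => e eE.
have /andP [te he] := allP (lgraph_ends lg1) e eE.
have nt := disjoint_notin uV te; have nh := disjoint_notin uV he.
have rI : (tail e \in I1 ++ I2) || (head e \in I1 ++ I2) = regular I1 e.
  move: nt nh; rewrite !mem_cat !negb_or => /andP [_ /negbTE ->] /andP [_ /negbTE ->].
  by rewrite !orbF.
case: ifPn => [re|nre]; last first.
  rewrite /cyc big1 // => w _; rewrite edge_term0 ?scaler0 //.
  by rewrite rI.
set a := contracted I1 e; set t := target I1 e.
have aI : a \in I1 := contracted_in re.
have pI : perm_eq (a :: rem a I1) I1 by rewrite perm_sym perm_to_rem.
have pE : perm_eq (e :: rem e E1) E1 by rewrite perm_sym perm_to_rem.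
have pI2 : perm_eq (a :: rem a I1 ++ I2) (I1 ++ I2) by rewrite -cat_cons perm_cat2r.
have pE2 : perm_eq (e :: rem e E1 ++ E2) (E1 ++ E2) by rewrite -cat_cons perm_cat2r.
rewrite cyc_scale; apply: eq_cyc => [//|w pw _].
have lg := lgraph_shuffle lg1 lg2 uV pw.
have uI : uniq (I1 ++ I2) := uniq_right (lgraph_uniq lg).
have uI1 : uniq I1 by move: uI; rewrite cat_uniq => /andP [].
rewrite (edge_term_front R c lg nd (oriented_contracted I1 e) pI2 pE2) -/a -/t.
have -> : contract a t (rem e E1 ++ E2) = contract a t (rem e E1) ++ E2.
  rewrite {1}/contract map_cat -/(contract a t _); congr (_ ++ _).
  apply: (ctr_id t (lgraph_ends lg2)); apply: (disjoint_notin uV).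
  by rewrite mem_cat aI orbT.
have -> : perm_odd (a :: rem a I1 ++ I2) (I1 ++ I2) = perm_odd (a :: rem a I1) I1.
  exact: (@perm_odd_cat _ [::] I2 (a :: rem a I1) I1).
have -> : perm_odd (e :: rem e E1 ++ E2) (E1 ++ E2) = perm_odd (e :: rem e E1) E1.
  exact: (@perm_odd_cat _ [::] E2 (e :: rem e E1) E1).
rewrite (perm_odd_rem uI1 aI) (perm_odd_rem (degen_uniq nd1) eE) !bsgnZ /edge_sign -/a.
by rewrite addbC.
Qed.

Lemma cyc_edges_right W1 I1 E1 W2 I2 E2 :
  lgraph W1 I1 E1 -> lgraph W2 I2 E2 -> uniq ((W1 ++ I1) ++ (W2 ++ I2)) ->
  ~~ degen (I1 ++ I2) (E1 ++ E2) ->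
  cyc (W1 ++ W2) (restricts W1 W2) (fun w => bsgn R (perm_odd w (W1 ++ W2)) *:
    \sum_(e <- E2) edge_term R c w (I1 ++ I2) (E1 ++ E2) e)
  = bsgn R (odd (size W1 * size W2) (+) odd (other_labels I1 E1 * other_labels I2 E2)) *:
   cyc (W2 ++ W1) (restricts W2 W1) (fun w => bsgn R (perm_odd w (W2 ++ W1)) *:
    \sum_(e <- E2) edge_term R c w (I2 ++ I1) (E2 ++ E1) e).
Proof.
move=> lg1 lg2 uV nd; have uU := uniq_ext uV; have uE := degen_uniq nd.
have uV' := uniq_swap uV; have uU' := uniq_ext uV'.
have pU : perm_eq (W2 ++ W1) (W1 ++ W2) by rewrite perm_catC.
have pU' : perm_eq (W1 ++ W2) (W2 ++ W1) by rewrite perm_catC.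
have pI : perm_eq (I1 ++ I2) (I2 ++ I1) by rewrite perm_catC.
have pE : perm_eq (E1 ++ E2) (E2 ++ E1) by rewrite perm_catC.
have nd' : ~~ degen (I2 ++ I1) (E2 ++ E1) by rewrite degen_cat_perm.
have uUI' : uniq ((W2 ++ W1) ++ (I2 ++ I1)) := uniq_shuffle uV' (perm_refl _).
set f := fun w : seq nat => _.
have rf : rot_invariant (W2 ++ W1) (fun w => bsgn R (perm_odd w (W2 ++ W1)) *:
    \sum_(e <- E2) edge_term R c w (I2 ++ I1) (E2 ++ E1) e).
  move=> w w' pw r; have uw : uniq (w ++ (I2 ++ I1)) := uniq_shuffle uV' pw.
  rewrite (perm_odd_trans uU' (rotation_perm r) pw) !scaler_sumr.
  apply: eq_bigr => e _; rewrite (edge_term_rot R c _ e uw r) !bsgnZ.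
  by congr (bsgn R _ *: _); case: (perm_odd w' w); case: (perm_odd w _).
rewrite (cyc_perm uU' pU (@restricts_rot _ _ _) rf) cyc_scale.
apply: eq_cyc => [w _|w pw _]; first exact: restrictsC.
have pw' := perm_trans pw pU'.
rewrite /f !scaler_sumr !big_seq; apply: eq_bigr => e eE.
have lg' := lgraph_shuffle lg2 lg1 uV' pw'.
have lg : lgraph w (I2 ++ I1) (E1 ++ E2) by rewrite (lgraph_perm (perm_refl _) (perm_refl _) pE).
have ndm : ~~ degen (I2 ++ I1) (E1 ++ E2) by rewrite (degen_perm (perm_refl _) pE).
have eE1 : e \in E1 ++ E2 by rewrite mem_cat eE orbT.
have eE2 : e \in E2 ++ E1 by rewrite mem_cat eE.
rewrite (edge_term_int R c lg ndm eE1 pI) (edge_term_edge R c lg' nd' eE2 pE) !bsgnZ.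
have uI : uniq (I1 ++ I2) by rewrite uniq_catC; exact: uniq_right (lgraph_uniq lg').
rewrite (perm_odd_catC uI) (perm_odd_catC uE).
rewrite (perm_odd_trans uU pw' pU) (perm_odd_catC uU') mulnC.
congr (bsgn R _ *: _); move: (perm_odd _ _) (odd (size W1 * size W2)) => b1 b2.
rewrite /nlabels /is_even; case: (is_odd c) => /=; move: (odd _) => b3; by case: b1; case: b2; case: b3.
Qed.

Lemma shuffleDl x x' y : shuffle R c (x + x') y = shuffle R c x y + shuffle R c x' y.
Proof. by have := @shuffle_linearl R c y 1 x x'; rewrite !scale1r. Qed.

Lemma shuffle0l y : shuffle R c 0 y = 0.
Proof.
by have := shuffleDl 0 0 y; rewrite addr0 => /eqP; rewrite -subr_eq subrr eq_sym => /eqP.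
Qed.

Lemma shuffleZl a x y : shuffle R c (a *: x) y = a *: shuffle R c x y.
Proof. by have := @shuffle_linearl R c y a x 0; rewrite !addr0 shuffle0l addr0. Qed.

Lemma shuffle_suml (J : Type) (r : seq J) (F : J -> graph_complex R c) y :
  shuffle R c (\sum_(j <- r) F j) y = \sum_(j <- r) shuffle R c (F j) y.
Proof.
elim: r => [|j r IH]; first by rewrite !big_nil shuffle0l.
by rewrite !big_cons shuffleDl IH.
Qed.

(** An arc contraction lowers [size W1], absent from the prefactor. An edge contraction lowers
    [nlabels] by one in both cases, so the prefactor changes by [size W2], turning the sign
    [size W1] into [size W1 + size W2]. *)
Lemma shuffle_labelled_d W1 I1 E1 W2 I2 E2 :
  lgraph W1 I1 E1 -> lgraph W2 I2 E2 -> uniq ((W1 ++ I1) ++ (W2 ++ I2)) ->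
  ~~ degen (I1 ++ I2) (E1 ++ E2) -> ~~ degen I1 E1 ->
  shuffle R c (labelled_d R c W1 I1 E1) (cl W2 I2 E2)
  = bsgn R (odd (other_labels I1 E1 * size W2)) *:
    (\sum_(v <- permutations (W1 ++ W2) | restricts W1 W2 v)
       arc_word (W1 ++ W2) (I1 ++ I2) (E1 ++ E2) W1 W1 v
     + bsgn R (odd (size W1 + size W2)) *:
       cyc (W1 ++ W2) (restricts W1 W2) (fun w => bsgn R (perm_odd w (W1 ++ W2)) *:
         \sum_(e <- E1) edge_term R c w (I1 ++ I2) (E1 ++ E2) e)).
Proof.
move=> lg1 lg2 uV nd nd1; rewrite /labelled_d (negbTE nd1).
rewrite shuffleDl shuffleZl scalerDr; congr (_ + _).
  rewrite (arc_word_left lg1 lg2 uV) /arc_sum shuffle_suml scaler_sumr !big_seq.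
  apply: eq_bigr => x x1; rewrite /arc_contraction.
  case aE : (after x W1) => [|y u]; first by rewrite shuffle0l scaler0.
  have pW : perm_eq (x :: y :: u) W1 by rewrite -aE perm_after.
  have lgm : lgraph (x :: u) I1 (map (merge_ends x y) E1).
    by apply: lgraph_merge; rewrite (lgraph_perm pW (perm_refl _) (perm_refl _)).
  have um : uniq (((x :: u) ++ I1) ++ (W2 ++ I2)).
    apply: subseq_uniq (_ : uniq (((x :: y :: u) ++ I1) ++ (W2 ++ I2))); last first.
      by rewrite (perm_uniq (perm_cat (perm_cat pW (perm_refl I1)) (perm_refl _))).
    by apply: cat_subseq => //; apply: cat_subseq => //; rewrite /= eqxx; apply: subseq_cons.
  rewrite shuffleZl (shuffle_cl R c lgm lg2 um).
  by rewrite /labelled_shuffle /nlabels size_map bsgnZ addbC -bsgnZ.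
rewrite (cyc_edges lg1 lg2 uV nd nd1) /edge_sum shuffle_suml !scaler_sumr !big_seq.
apply: eq_bigr => e eE; case: (boolP (regular I1 e)) => [re|nre]; last first.
  by rewrite edge_term0 // shuffle0l !scaler0.
have aI := contracted_in re; have o := oriented_contracted I1 e.
have at_ := oriented_neq nd1 eE o aI.
have pI : perm_eq (contracted I1 e :: rem (contracted I1 e) I1) I1 by rewrite perm_sym perm_to_rem.
have pE : perm_eq (e :: rem e E1) E1 by rewrite perm_sym perm_to_rem.
have lgc : lgraph W1 (rem (contracted I1 e) I1) (contract (contracted I1 e) (target I1 e) (rem e E1)).
  by apply: lgraph_ctr o at_; rewrite (lgraph_perm (perm_refl W1) pI pE).
have um : uniq ((W1 ++ rem (contracted I1 e) I1) ++ (W2 ++ I2)).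
  by apply: subseq_uniq uV; apply: cat_subseq => //; apply: cat_subseq => //; apply: rem_subseq.
rewrite (edge_termE R c _ _ re) shuffleZl (shuffle_cl R c lgc lg2 um).
rewrite /labelled_shuffle /edge_sign !bsgnZ; congr (bsgn R _ *: _).
rewrite /nlabels /contract size_map !size_rem // !oddM !oddD.
have s1 : odd (size I1) = ~~ odd (size I1).-1 by rewrite -(perm_size pI).
have s2 : odd (size E1) = ~~ odd (size E1).-1 by rewrite -(perm_size pE).
case: (is_odd c); [rewrite s1|rewrite s2]; move: (_ && _ (+) _) (odd (size W1)) (odd (size W2)) (odd _.-1);
by do 4 case.
Qed.

Lemma leibniz_signs (V : lmodType R) (A1 A2 X1 X2 : V) (s1 s2 k g : bool) (n n1 n2 : nat) :
  n = n1 -> n = n2 -> g (+) s2 = s1 (+) k ->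
  bsgn R s1 *: (A1 + bsgn R k *: A2 + bsgn R (odd n) *: (X1 + bsgn R k *: X2))
  = bsgn R s1 *: (A1 + bsgn R (odd n1) *: X1)
  + bsgn R g *: (bsgn R s2 *: (A2 + bsgn R (odd n2) *: X2)).
Proof.
move=> <- <- e; rewrite bsgnZ e -bsgnZ -scalerDr; congr (_ *: _).
rewrite !scalerDr !bsgnZ addrACA; congr (_ + (_ + bsgn R _ *: _)); exact: addbC.
Qed.

(** In the second term the differentiated factor is also put first, so that [shuffle_labelled_d]
    serves for both; the sign is the one of commuting the two graphs. *)
Lemma leibniz_cl W1 I1 E1 W2 I2 E2 :
  lgraph W1 I1 E1 -> lgraph W2 I2 E2 -> uniq ((W1 ++ I1) ++ (W2 ++ I2)) ->
  coboundary R c (sh W1 I1 E1 W2 I2 E2) =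
  shuffle R c (labelled_d R c W1 I1 E1) (cl W2 I2 E2)
  + bsgn R (odd ((size W1 + other_labels I1 E1) * (size W2 + other_labels I2 E2)))
     *: shuffle R c (labelled_d R c W2 I2 E2) (cl W1 I1 E1).
Proof.
move=> lg1 lg2 uV; have uV' := uniq_swap uV.
have zr x W I E : lgraph W I E -> degen I E -> shuffle R c x (cl W I E) = 0.
  move=> lg dg; rewrite (cl_degen R c (lgraph_uniq lg) dg).
  have := @shuffle_linearr R c x 1 0 0; rewrite !scale1r addr0 => /eqP.
  by rewrite -subr_eq subrr eq_sym => /eqP.
(* If a factor is degenerate, its class and its coboundary vanish, and so do all three products. *)
have [d1|n1] := boolP (degen I1 E1).
  by rewrite (sh_degenl R c _ uV d1) linear0 (zr _ W1 I1 E1) // scaler0 addr0 /labelled_d d1 shuffle0l.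
have [d2|n2] := boolP (degen I2 E2).
  rewrite (labelled_shuffleC R c _ _ uV) (sh_degenl R c _ uV' d2) scaler0 linear0.
  by rewrite (zr _ W2 I2 E2) // add0r /labelled_d d2 shuffle0l scaler0.
have nd := degen_shuffle lg1 lg2 uV n1 n2.
have nd' : ~~ degen (I2 ++ I1) (E2 ++ E1) by rewrite degen_cat_perm.
rewrite (shuffle_labelled_d lg1 lg2 uV nd n1) (shuffle_labelled_d lg2 lg1 uV' nd' n2).
pose U := W1 ++ W2; pose I := I1 ++ I2; pose E := E1 ++ E2.
pose e1 w := bsgn R (perm_odd w U) *: \sum_(e <- E1) edge_term R c w I E e.
pose e2 w := bsgn R (perm_odd w U) *: \sum_(e <- E2) edge_term R c w I E e.
have uU : uniq U := uniq_ext uV.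
have uUI : uniq (U ++ I) := uniq_shuffle uV (perm_refl U).
have -> : coboundary R c (sh W1 I1 E1 W2 I2 E2) = bsgn R (odd (other_labels I1 E1 * size W2)) *:
   (cyc U (restricts W1 W2) (fun w => bsgn R (perm_odd w U) *: arc_sum R c w I E)
    + bsgn R (odd (size U)) *: (cyc U (restricts W1 W2) e1 + cyc U (restricts W1 W2) e2)).
  rewrite /labelled_shuffle linearZ /=; congr (_ *: _); rewrite /cyc linear_sum -big_split /= scaler_sumr -big_split /=.
  rewrite big_seq_cond [RHS]big_seq_cond; apply: eq_bigr => w /andP []; rewrite mem_permutations => pw _.
  rewrite linearZ /= coboundary_cl; last exact: lgraph_shuffle lg1 lg2 uV pw.
  rewrite /labelled_d (negbTE nd) (perm_size pw) scalerDr; congr (_ + _).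
  by rewrite /e1 /e2 -scalerDr -big_cat /= !bsgnZ addbC.
have -> : cyc U (restricts W1 W2) (fun w => bsgn R (perm_odd w U) *: arc_sum R c w I E)
   = \sum_(v <- permutations U | restricts W1 W2 v) arc_word U I E W1 W1 v
   + \sum_(v <- permutations U | restricts W1 W2 v) arc_word U I E W2 W2 v.
  rewrite cyc_arc_sum //; last exact: restricts_rot.
  have mix : \sum_(v <- permutations U | restricts W1 W2 v)
    (arc_word U I E W1 W2 v + arc_word U I E W2 W1 v) = 0 := arc_word_mixed R c lg1 lg2 uV.
  transitivity (\sum_(v <- permutations U | restricts W1 W2 v)
      (arc_word U I E W1 W1 v + arc_word U I E W2 W2 v
       + (arc_word U I E W1 W2 v + arc_word U I E W2 W1 v))).
    rewrite big_seq_cond [RHS]big_seq_cond; apply: eq_bigr => v /andP []; rewrite mem_permutations => pv _.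
    exact: arc_word_split.
  by rewrite big_split /= mix addr0 big_split.
have -> : cyc U (restricts W1 W2) e2 = _ := cyc_edges_right lg1 lg2 uV nd.
rewrite (arc_word_right lg1 lg2 uV nd) -/U -/I -/E.
have eS : odd ((size W1 + other_labels I1 E1) * (size W2 + other_labels I2 E2)) (+) odd (other_labels I2 E2 * size W1)
  = odd (other_labels I1 E1 * size W2) (+) (odd (size W1 * size W2) (+) odd (other_labels I1 E1 * other_labels I2 E2)).
  rewrite !oddM !oddD; move: (odd (size W1)) (odd (size W2)) (odd (other_labels I1 E1)) (odd (other_labels I2 E2)).
  by do 4 case.
apply: leibniz_signs eS; first by rewrite /U size_cat.
by rewrite /U size_cat addnC.
Qed.
End LeibnizMain.

(** * Associativity and unit *)

Section Nested.
Context (R : realType) (V : lmodType R).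

(** A word [w] restricting to [Wa] and [Wb] is counted once: among the rotations of its restriction
    to [Wa ++ Wb], exactly one is listed by [cyclic_shuffles], namely the one with the prescribed
    first letter. *)
Lemma nested_shuffles (U Wa Wb : seq nat) (D : pred (seq nat)) (F : seq nat -> V) :
  uniq U -> uniq (Wa ++ Wb) -> {subset Wa ++ Wb <= U} ->
  \sum_(u <- cyclic_shuffles Wa Wb)
    cyc U (fun w => rotation [seq x <- w | x \in u] u && D w) F
  = cyc U (fun w => restricts Wa Wb w && D w) F.
Proof.
move=> uU uab sab; rewrite /cyc.
have uCS : uniq (cyclic_shuffles Wa Wb) by rewrite filter_uniq ?permutations_uniq.
transitivity (\sum_(w <- permutations U) \sum_(u <- cyclic_shuffles Wa Wb)
   if (ohead w == ohead U) && (rotation [seq x <- w | x \in u] u && D w) then F w else 0).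
  rewrite exchange_big /=; apply: eq_bigr => u _; exact: big_mkcond.
rewrite [RHS]big_mkcond !big_seq; apply: eq_bigr => w; rewrite mem_permutations => pw.
case: (boolP (ohead w == ohead U)) => [_|_] /=; last by rewrite big1.
have [Dw|nD] := boolP (D w); last first.
  by rewrite andbF big1 // => u _; rewrite andbF.
pose fw := [seq x <- w | x \in Wa ++ Wb].
have uw : uniq w by rewrite (perm_uniq pw).
have pfw : perm_eq fw (Wa ++ Wb).
  apply: uniq_perm; rewrite ?filter_uniq // => x; rewrite mem_filter (perm_mem pw).
  by case: (boolP (x \in _)) => // /sab ->.
have fa (W : seq nat) : {subset W <= Wa ++ Wb} -> [seq x <- fw | x \in W] = [seq x <- w | x \in W].
  move=> sW; rewrite /fw -filter_predI; apply: eq_filter => x /=.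
  by case: (boolP (x \in W)) => // /sW ->.
have sa : {subset Wa <= Wa ++ Wb} by move=> x; rewrite mem_cat => ->.
have sb' : {subset Wb <= Wa ++ Wb} by move=> x; rewrite mem_cat orbC => ->.
have CSP u : u \in cyclic_shuffles Wa Wb ->
    [/\ perm_eq u (Wa ++ Wb), ohead u = ohead (Wa ++ Wb) & restricts Wa Wb u].
  by rewrite mem_filter mem_permutations => /andP [/andP [/eqP -> Cu] ->].
have fu u : u \in cyclic_shuffles Wa Wb -> [seq x <- w | x \in u] = fw.
  by case/CSP => pu _ _; apply: eq_filter => x; rewrite (perm_mem pu).
have res u : u \in cyclic_shuffles Wa Wb -> rotation fw u -> restricts Wa Wb w.
  move=> /CSP [pu _ Cu] r; move: Cu; rewrite /restricts.
  rewrite -(rotation_eql _ (rotation_filter (fun x => x \in Wa) r)).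
  by rewrite -(rotation_eql _ (rotation_filter (fun x => x \in Wb) r)) !fa.
rewrite andbT; case: (boolP (restricts Wa Wb w)) => [Cw|nC]; last first.
  rewrite big_seq big1 // => u uCSu; rewrite fu //; case: ifP => // /andP [r _].
  by rewrite (res u) in nC.
(* The listed representative: the restriction of [w] turned to begin with the head of [Wa ++ Wb]. *)
pose u0 := if Wa ++ Wb is h :: _ then from h fw else fw.
have r0 : rotation u0 fw.
  by rewrite /u0; case: (Wa ++ Wb) => [|h t]; rewrite ?rotation_refl ?from_rotation.
have u0CS : u0 \in cyclic_shuffles Wa Wb.
  rewrite mem_filter mem_permutations (perm_trans (rotation_perm r0) pfw) andbT.
  have Ca : restricts Wa Wb u0.
    rewrite /restricts (rotation_eql _ (rotation_filter (fun x => x \in Wa) r0)).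
    by rewrite (rotation_eql _ (rotation_filter (fun x => x \in Wb) r0)) !fa.
  apply/andP; split; last exact: Ca.
  rewrite /u0.
  move: pfw; case: (Wa ++ Wb) => [|h t] pfw; first by move/perm_nilP: pfw => ->.
  by rewrite fromE ?(perm_mem pfw) ?mem_head.
rewrite (bigD1_seq u0) //= fu // rotationC r0 /= big_seq_cond big1 ?addr0 // => u /andP [uC ne].
rewrite fu //; case: ifP => // r; case/eqP: ne.
have [pu hu _] := CSP u uC; have uu : uniq u by rewrite (perm_uniq pu).
rewrite andbT in r; have r1 : rotation u u0 by rewrite (rotation_eqr _ r0) rotationC.
have [_ h0 _] := CSP u0 u0CS.
have uu0 : uniq u0 by rewrite -(perm_uniq (rotation_perm r1)).
move: hu; rewrite -h0; case: u r1 {pu uC r} uu => [|x u] r1 uu.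
  by case: u0 {r0 u0CS h0 uu0} r1 => // z t /rotation_perm /perm_size.
case: u0 {r0 u0CS h0} uu0 r1 => [|z t] uu0 r1 //= [e]; rewrite e in r1 *.
by rewrite (rotation_head uu0 r1).
Qed.
End Nested.

Section Associativity.
Context (R : realType) (c : parity).
Local Notation cl := (graph_cls R c).
Local Notation other_labels := (nlabels c).
Local Notation sh := (labelled_shuffle R c).

Lemma shuffle0r x : shuffle R c x 0 = 0.
Proof.
have := @shuffle_linearr R c x 1 0 0; rewrite !scale1r addr0 => /eqP.
by rewrite -subr_eq subrr eq_sym => /eqP.
Qed.

Lemma shuffleDr x y y' : shuffle R c x (y + y') = shuffle R c x y + shuffle R c x y'.
Proof. by have := @shuffle_linearr R c x 1 y y'; rewrite !scale1r. Qed.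

Lemma shuffleZr x a y : shuffle R c x (a *: y) = a *: shuffle R c x y.
Proof. by have := @shuffle_linearr R c x a y 0; rewrite !addr0 shuffle0r addr0. Qed.

Lemma shuffle_sumr (J : Type) (r : seq J) (F : J -> graph_complex R c) x :
  shuffle R c x (\sum_(j <- r) F j) = \sum_(j <- r) shuffle R c x (F j).
Proof.
elim: r => [|j r IH]; first by rewrite !big_nil shuffle0r.
by rewrite !big_cons shuffleDr IH.
Qed.

Lemma other_labels_cat I1 E1 I2 E2 :
  other_labels (I1 ++ I2) (E1 ++ E2) = (other_labels I1 E1 + other_labels I2 E2)%N.
Proof. by rewrite /nlabels !size_cat; case: (is_odd c). Qed.

Lemma sh_sum W1 I1 E1 W2 I2 E2 :
  sh W1 I1 E1 W2 I2 E2 = bsgn R (odd (other_labels I1 E1 * size W2)) *: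
   \sum_(u <- cyclic_shuffles W1 W2) bsgn R (perm_odd u (W1 ++ W2)) *: cl u (I1 ++ I2) (E1 ++ E2).
Proof. by rewrite sum_cyclic_shuffles. Qed.

Context (W1 I1 : seq nat) (E1 : seq edge) (W2 I2 : seq nat) (E2 : seq edge).
Context (W3 I3 : seq nat) (E3 : seq edge).
Context (lg1 : lgraph W1 I1 E1) (lg2 : lgraph W2 I2 E2) (lg3 : lgraph W3 I3 E3).
Context (uV : uniq ((W1 ++ I1) ++ (W2 ++ I2) ++ (W3 ++ I3))).

Let U := W1 ++ W2 ++ W3.
Let F w := bsgn R (perm_odd w U) *: cl w (I1 ++ I2 ++ I3) (E1 ++ E2 ++ E3).
Let rot3 w := [&& rotation [seq x <- w | x \in W1] W1,
  rotation [seq x <- w | x \in W2] W2 & rotation [seq x <- w | x \in W3] W3].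

Let u12 : uniq ((W1 ++ I1) ++ (W2 ++ I2)).
Proof. by have := uV; rewrite catA cat_uniq => /andP []. Qed.

Let u23 : uniq ((W2 ++ I2) ++ (W3 ++ I3)).
Proof. by apply: subseq_uniq uV; apply: suffix_subseq. Qed.

Let uU : uniq U.
Proof.
have s (W I : seq nat) : subseq W (W ++ I) := prefix_subseq W I.
exact: subseq_uniq (cat_subseq (s W1 I1) (cat_subseq (s W2 I2) (s W3 I3))) uV.
Qed.

Let F_rot : rot_invariant U F.
Proof.
have p : perm_eq ((W2 ++ W3) ++ I2 ++ I3) ((W2 ++ I2) ++ W3 ++ I3).
  by rewrite -!catA perm_cat2l perm_catCA.
have u : uniq ((W1 ++ I1) ++ ((W2 ++ W3) ++ (I2 ++ I3))).
  by rewrite (perm_uniq (perm_cat (perm_refl (W1 ++ I1)) p)).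
exact: sh_summand_rot (uniq_shuffle u (perm_refl _)) (perm_refl _).
Qed.

(** The exponent is n1 w2 + n1 w3 + n2 w3, with n for [nlabels] and w for numbers of external
    vertices. The other bracketing leads to the same exponent and the same sum. *)
Lemma shuffle_shuffle_left :
  shuffle R c (sh W1 I1 E1 W2 I2 E2) (cl W3 I3 E3)
  = bsgn R (odd (other_labels I1 E1 * size W2) (+) odd ((other_labels I1 E1 + other_labels I2 E2) * size W3))
    *: cyc U rot3 F.
Proof.
rewrite sh_sum shuffleZl -bsgnZ; congr (_ *: _); rewrite shuffle_suml.
have u12' : uniq (W1 ++ W2) := uniq_ext u12.
transitivity (bsgn R (odd ((other_labels I1 E1 + other_labels I2 E2) * size W3)) *:
  \sum_(u <- cyclic_shuffles W1 W2) cyc U (fun w => rotation [seq x <- w | x \in u] u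
     && rotation [seq x <- w | x \in W3] W3) F); last first.
  congr (_ *: _); rewrite nested_shuffles //.
    apply: eq_cyc => // w _; exact: esym (andbA _ _ _).
  by move=> x; rewrite /U !mem_cat => /orP [->|->]; rewrite ?orbT.
rewrite scaler_sumr !big_seq; apply: eq_bigr => u.
rewrite mem_filter mem_permutations => /andP [_ pu].
have lgu := lgraph_shuffle lg1 lg2 u12 pu.
have pu3 : perm_eq (u ++ W3) U by rewrite /U catA perm_cat2r.
have uu3 : uniq (u ++ W3) by rewrite (perm_uniq pu3).
have uu : uniq ((u ++ (I1 ++ I2)) ++ (W3 ++ I3)).
  have p : perm_eq (u ++ I1 ++ I2) ((W1 ++ I1) ++ (W2 ++ I2)).
    have pw2 : perm_eq (u ++ I1 ++ I2) ((W1 ++ W2) ++ I1 ++ I2) by rewrite perm_cat2r.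
    by apply: perm_trans pw2 _; rewrite -!catA perm_cat2l perm_catCA.
  by have := uV; rewrite catA -(perm_uniq (perm_cat p (perm_refl (W3 ++ I3)))).
rewrite shuffleZl (shuffle_cl R c lgu lg3 uu) /labelled_shuffle other_labels_cat bsgnZ addbC -bsgnZ.
congr (_ *: _); rewrite -!catA.
have uUI := uniq_shuffle uu (perm_refl _).
have rf := sh_summand_rot R c (E1 ++ E2 ++ E3) uUI (perm_refl _).
rewrite -!catA in rf.
rewrite (cyc_perm uu3 pu3 (@restricts_rot _ _ _) rf) cyc_scale.
apply: eq_cyc => // w pw _; rewrite /F bsgnZ; congr (bsgn R _ *: _).
have pw' : perm_eq w (u ++ W3) by apply: perm_trans pw _; rewrite perm_sym.
rewrite (perm_odd_trans uU pw' pu3) addbC; congr (_ (+) _).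
have uU' : uniq ((W1 ++ W2) ++ W3) by rewrite -catA.
by rewrite /U catA (@perm_odd_cat _ [::] W3 u (W1 ++ W2) uU' pu).
Qed.

Lemma shuffle_shuffle_right :
  shuffle R c (cl W1 I1 E1) (sh W2 I2 E2 W3 I3 E3)
  = bsgn R (odd (other_labels I2 E2 * size W3) (+) odd (other_labels I1 E1 * (size W2 + size W3)))
    *: cyc U rot3 F.
Proof.
rewrite sh_sum shuffleZr -bsgnZ; congr (_ *: _); rewrite shuffle_sumr.
have u23' : uniq (W2 ++ W3) := uniq_ext u23.
transitivity (bsgn R (odd (other_labels I1 E1 * (size W2 + size W3))) *:
  \sum_(u <- cyclic_shuffles W2 W3) cyc U (fun w => rotation [seq x <- w | x \in u] u
     && rotation [seq x <- w | x \in W1] W1) F); last first.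
  congr (_ *: _); rewrite nested_shuffles //.
    apply: eq_cyc => // w _; exact: andbC.
  by move=> x; rewrite /U !mem_cat => ->; rewrite orbT.
rewrite scaler_sumr !big_seq; apply: eq_bigr => u.
rewrite mem_filter mem_permutations => /andP [_ pu].
have lgu := lgraph_shuffle lg2 lg3 u23 pu.
have pu3 : perm_eq (W1 ++ u) U by rewrite /U perm_cat2l.
have uu3 : uniq (W1 ++ u) by rewrite (perm_uniq pu3).
have uu : uniq ((W1 ++ I1) ++ (u ++ (I2 ++ I3))).
  have p : perm_eq (u ++ I2 ++ I3) ((W2 ++ I2) ++ (W3 ++ I3)).
    have pw2 : perm_eq (u ++ I2 ++ I3) ((W2 ++ W3) ++ I2 ++ I3) by rewrite perm_cat2r.
    by apply: perm_trans pw2 _; rewrite -!catA perm_cat2l perm_catCA.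
  by rewrite (perm_uniq (perm_cat (perm_refl _) p)).
rewrite shuffleZr (shuffle_cl R c lg1 lgu uu) /labelled_shuffle (perm_size pu) size_cat bsgnZ addbC -bsgnZ.
congr (_ *: _).
have uUI := uniq_shuffle uu (perm_refl _).
have rf := sh_summand_rot R c (E1 ++ E2 ++ E3) uUI (perm_refl _).
rewrite (cyc_perm uu3 pu3 (@restricts_rot _ _ _) rf) cyc_scale.
apply: eq_cyc => [w _|w pw _]; first by rewrite restrictsC.
rewrite /F bsgnZ; congr (bsgn R _ *: _).
have pw' : perm_eq w (W1 ++ u) by apply: perm_trans pw _; rewrite perm_sym.
rewrite (perm_odd_trans uU pw' pu3) addbC; congr (_ (+) _).
have := @perm_odd_cat _ W1 [::] u (W2 ++ W3); rewrite !cats0 => <- //.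
Qed.

Lemma shuffle_cl_assoc :
  shuffle R c (cl W1 I1 E1) (shuffle R c (cl W2 I2 E2) (cl W3 I3 E3))
  = shuffle R c (shuffle R c (cl W1 I1 E1) (cl W2 I2 E2)) (cl W3 I3 E3).
Proof.
rewrite (shuffle_cl R c lg2 lg3 u23) (shuffle_cl R c lg1 lg2 u12).
rewrite shuffle_shuffle_left shuffle_shuffle_right; congr (bsgn R _ *: _).
rewrite !oddM !oddD; move: (odd (size W2)) (odd (size W3)) (odd (other_labels I1 E1)) (odd (other_labels I2 E2)).
by do 4 case.
Qed.
End Associativity.

Section Unit.
Context (R : realType) (c : parity).

(** The only circular arrangement of [W] alone, read from its first letter, is [W]; hence a product
    with the empty graph has a single term. *)
Lemma head_restricts (W w : seq nat) : uniq W -> perm_eq w W ->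
  (ohead w == ohead W) && restricts [::] W w = (w == W).
Proof.
move=> uW pw; have fw : [seq x <- w | x \in W] = w.
  by apply/all_filterP/allP => x; rewrite (perm_mem pw).
have f0 : [seq x <- w | x \in [::]] = [::] :> seq nat by rewrite (eq_filter (a2 := pred0)) ?filter_pred0.
rewrite /restricts fw f0 rotation_refl /=; apply/andP/eqP => [[/eqP hw r]|->]; last first.
  by rewrite eqxx rotation_refl.
case: w W uW {pw fw f0} hw r => [|z w] [|z' W] uW //= [e] r.
by rewrite e in r *; rewrite (rotation_head uW r).
Qed.

Lemma sh_unit W I E : uniq W -> labelled_shuffle R c [::] [::] [::] W I E = graph_cls R c W I E.
Proof.
move=> uW; rewrite /labelled_shuffle /nlabels if_same mul0n bsgn0 scale1r /cyc !cat0s.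
transitivity (\sum_(w <- permutations W) if w == W then graph_cls R c w I E else 0).
  rewrite big_mkcond !big_seq; apply: eq_bigr => w; rewrite mem_permutations => pw.
  rewrite head_restricts //; case: eqP => // ->.
  by rewrite perm_oddss // bsgn0 scale1r.
rewrite (bigD1_seq W) ?mem_permutations ?permutations_uniq //= eqxx big1 ?addr0 //.
by move=> w /negbTE ->.
Qed.

Lemma empty_graph_ok : is_graph empty_graph. Proof. by []. Qed.

Lemma shuffle_graphs_unit g : is_graph g -> shuffle_graphs R c empty_graph g = cls R c g.
Proof.
move=> gg; have lg := lgraph_self gg; have lg0 : lgraph [::] [::] [::] by [].
have := @shuffle_graphs_std R c [::] [::] [::] _ _ _ lg0 lg (uniq_ext_int g).
rewrite (std_self gg) => e; apply: (etrans e); rewrite (sh_unit _ _ (iota_uniq _ _)).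
by rewrite /graph_cls (std_self gg).
Qed.

Lemma shuffle_graphs_unitr g : is_graph g -> shuffle_graphs R c g empty_graph = cls R c g.
Proof.
move=> gg; rewrite (shuffle_graphsC R c gg empty_graph_ok) shuffle_graphs_unit //.
by rewrite /gr_odd /= if_same andbF bsgn0 scale1r.
Qed.
End Unit.

(** * Gradings *)

Section Gradings.
Context (R : realType) (c : parity).
Local Notation D := (graph_complex R c).
Local Notation qpi := (quot_pi (graph_rel c)).

Lemma quot_pi_sum (v : {malg R[dgraph]}) :
  qpi v = \sum_(k <- msupp v) v@_k *: cls R c (val k).
Proof.
rewrite {1}[v]monalgE linear_sum; apply: eq_bigr => k _ /=.
rewrite /cls /gen valK -linearZ; congr quot_pi; apply/malgP => h.
by rewrite mcoeffZ !mcoeffU mulr_natr.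
Qed.

Lemma graph_span_linear Q a x y : graph_span Q x -> graph_span Q y ->
  graph_span Q (a *: x + y : D).
Proof.
case=> u Qu -> [v Qv ->]; exists (a *: u + v); last by rewrite linearP.
move=> g; rewrite -mcoeff_neq0 mcoeffD mcoeffZ => h.
have [gu|gu] := boolP (g \in msupp u); first exact: Qu.
apply: Qv; rewrite -mcoeff_neq0; apply: contraNneq h => ->.
by rewrite (mcoeff_outdom gu) mulr0 addr0.
Qed.

Lemma graph_span0 Q : graph_span Q (0 : D).
Proof. by exists 0; rewrite ?linear0 // => g; rewrite msupp0. Qed.

Lemma graph_span_sum Q (I : eqType) (r : seq I) (P : pred I) (F : I -> D) :
  (forall i, i \in r -> P i -> graph_span Q (F i)) ->
  graph_span Q (\sum_(i <- r | P i) F i).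
Proof.
move=> QF; rewrite big_seq_cond; elim/big_ind: _ => [|x y Qx Qy|i /andP [ri Pi]].
- exact: graph_span0.
- by rewrite -[x]scale1r; apply: graph_span_linear.
- exact: QF.
Qed.

Lemma graph_spanZ Q a x : graph_span Q x -> graph_span Q (a *: x : D).
Proof. by move=> Qx; rewrite -[_ *: _]addr0; apply/graph_span_linear/graph_span0. Qed.

Lemma graph_spanD Q x y : graph_span Q x -> graph_span Q y -> graph_span Q (x + y : D).
Proof. by move=> Qx Qy; rewrite -[x]scale1r; apply: graph_span_linear. Qed.

Lemma graph_span_cls Q g : (is_graph g -> Q g) -> graph_span Q (cls R c g).
Proof.
move=> Qg; have [gg|ng] := boolP (is_graph g); last first.
  by rewrite cls_not_graph //; apply: graph_span0.
exists (gen R g) => // h; rewrite /gen insubT /= => /(fsubsetP (msuppU_le)).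
by rewrite inE => /eqP ->; apply: Qg.
Qed.

Lemma graph_span_ind Q (P : D -> Prop) : P 0 ->
  (forall a x y, P x -> P y -> P (a *: x + y)) ->
  (forall g, is_graph g -> Q g -> P (cls R c g)) ->
  forall x, graph_span Q x -> P x.
Proof.
move=> P0 PD Pc x [v Qv ->]; rewrite quot_pi_sum big_seq.
elim/big_rec: _ => [//|g y gv Py]; apply: PD => //.
by apply: Pc; [exact: valP | exact: Qv].
Qed.

Lemma graph_complex_ind (P : D -> Prop) : P 0 ->
  (forall a x y, P x -> P y -> P (a *: x + y)) ->
  (forall g, is_graph g -> P (cls R c g)) -> forall x, P x.
Proof.
move=> P0 PD Pc x; apply: (graph_span_ind (Q := fun _ => True)) => //.
  by move=> g gg _; apply: Pc.
by exists (quot_repr x); rewrite ?quot_reprK.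
Qed.

(** * Projections onto homogeneous parts *)

Section Key.
Context (J : eqType) (key : nat -> nat -> nat -> J).
Local Notation kg g := (key (vext g) (vint g) (nedge g)).
Context (Q : J -> predgraph -> Prop).
Context (QP : forall j g, is_graph g -> Q j g <-> kg g = j).

Definition component_graph j (g : predgraph) : D := if kg g == j then cls R c g else 0.

(** [key] depends only on the numbers of external vertices, internal vertices and edges, which all
    relations preserve. *)
Lemma component_alternating j : alternating c (component_graph j).
Proof.
have [aR aI aE aV aD] := cls_alternating R c.
have key_std W I E W' I' E' : perm_eq W' W -> perm_eq I' I -> size E' = size E ->
    kg (std W' I' E') = kg (std W I E).
  by move=> pW pI pE; rewrite /std /nedge /= !size_map (perm_size pW) (perm_size pI) pE.
split.
- move=> W I E W' lg r; rewrite /component_graph.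
  rewrite (key_std W I E W' I E (rotation_perm r) (perm_refl I) erefl).
  by case: (_ == j); rewrite ?scaler0 // (aR W I E).
- move=> W I E I' lg pI; rewrite /component_graph.
  rewrite (key_std W I E W I' E (perm_refl W) pI erefl).
  by case: (_ == j); rewrite ?scaler0 // (aI W I E).
- move=> W I E E' lg nd pE; rewrite /component_graph.
  rewrite (key_std W I E W I E' (perm_refl W) (perm_refl I) (perm_size pE)).
  by case: (_ == j); rewrite ?scaler0 // (aE W I E).
- move=> W I E1 e E2 lg; rewrite /component_graph.
  rewrite (key_std W I (E1 ++ e :: E2) W I _ (perm_refl W) (perm_refl I)); last by rewrite !size_cat.
  by case: (_ == j); rewrite ?scaler0 // (aV W I E1 e E2).
- by move=> W I E lg dg; rewrite /component_graph aD // if_same.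
Qed.

Definition component j : {linear D -> D} := induced (component_graph j).

Lemma component_cls j g : is_graph g -> component j (cls R c g) = component_graph j g.
Proof. by move=> gg; rewrite /component /= induced_cls //; apply: component_alternating. Qed.

Lemma component_span j x : graph_span (Q j) (component j x).
Proof.
elim/graph_complex_ind: x => [|a x y Qx Qy|g gg].
- by rewrite linear0; apply: graph_span0.
- by rewrite linearP; apply: graph_span_linear.
- rewrite component_cls // /component_graph; case: eqP => [kj|_]; last exact: graph_span0.
  by apply: graph_span_cls => _; apply/QP.
Qed.

Lemma component_of_span i j x : graph_span (Q i) x ->
  component j x = if i == j then x else 0.
Proof.
elim/graph_span_ind => [|a u v|g gg].
- by rewrite linear0 if_same.
- by rewrite linearP /= => -> ->; case: (i == j) => //; rewrite scaler0 addr0.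
- by move=> Qg; rewrite component_cls // /component_graph; have /QP -> := Qg.
Qed.

(** The quantification over all lists containing [s] lets the finite supports of two elements be
    merged in a linear combination. *)
Lemma component_generate x : exists s : seq J, forall s', uniq s' -> {subset s <= s'} ->
  x = \sum_(j <- s') component j x.
Proof.
elim/graph_complex_ind: x => [|a x y [s Hs] [t Ht]|g gg].
- by exists [::] => s' _ _; rewrite big1 // => j _; rewrite linear0.
- exists (s ++ t) => s' us' st.
  have ss : {subset s <= s'} by move=> k ks; apply: st; rewrite mem_cat ks.
  have ts : {subset t <= s'} by move=> k kt; apply: st; rewrite mem_cat kt orbT.
  rewrite {1}(Hs s' us' ss) {1}(Ht s' us' ts) scaler_sumr -big_split.
  by apply: eq_bigr => j _; rewrite linearP.
- exists [:: kg g] => s' us' ss; have ks : kg g \in s' by apply: ss; rewrite mem_head.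
  rewrite (bigD1_seq (kg g)) //= component_cls // /component_graph eqxx.
  rewrite big1 ?addr0 // => j nj; rewrite component_cls // /component_graph.
  by rewrite ifN // eq_sym.
Qed.

Lemma direct_sum_key : direct_sum (fun j => @graph_span R c (Q j)).
Proof.
split.
- by move=> j; apply: graph_span0.
- by move=> j a x y; apply: graph_span_linear.
- move=> x; have [s Hs] := component_generate x.
  exists (undup s), (fun j => component j x); split; first exact: undup_uniq.
    by move=> j; apply: component_span.
  by apply: Hs; rewrite ?undup_uniq // => j; rewrite mem_undup.
- move=> s f us Qf s0 i si; have := congr1 (component i) s0.
  rewrite linear0 linear_sum (bigD1_seq i) //= (component_of_span _ (Qf i)) eqxx.
  rewrite big1 ?addr0 // => j ji; by rewrite (component_of_span _ (Qf j)) ifN.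
Qed.
End Key.

Lemma graded_direct_sum : direct_sum (graded_part R c).
Proof.
pose key (a b e : nat) : int := match c with Odd => (a + b)%N%:Z | Even => e%:Z + a%:Z end.
apply: (@direct_sum_key int key (fun n g => grading c g = n)) => j g _.
by rewrite /key /grading /nvert; case: (c).
Qed.

Lemma sum_count (T : Type) (f : T -> nat) (V : seq nat) (E : seq T) : uniq V ->
  all (fun e => f e \in V) E -> (\sum_(i <- V) count (fun e => f e == i) E)%N = size E.
Proof.
move=> uV; elim: E => [_|e E IH /= /andP [eV EV]]; first by rewrite big1.
rewrite big_split /= IH // -add1n; congr addn.
by rewrite (bigD1_seq (f e)) //= eqxx big1 ?addn0 // => i; rewrite eq_sym => /negbTE ->.
Qed.

(** The valences add up to twice the number of edges; external vertices have valence at least 1,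
    internal ones at least 3. *)
Lemma graph_size_bound g : is_graph g -> (vext g + 3 * vint g <= 2 * nedge g)%N.
Proof.
move=> gg; have := uniq_ext_int g; set V := _ ++ _ => uV.
have /allP ends := lgraph_ends (lgraph_self gg).
have -> : (2 * nedge g = \sum_(i <- V) valence g i)%N.
  rewrite /valence big_split /= !sum_count //.
  - by rewrite /nedge; lia.
  - by apply/allP => e /ends /andP [].
  - by apply/allP => e /ends /andP [].
case/and3P: gg => _ /allP ge /allP gi; rewrite /V big_cat /=.
apply: leq_add.
  rewrite -[X in (X <= _)%N](size_iota 1) -sum1_size !big_seq; exact: leq_sum.
rewrite -[X in (_ * X <= _)%N](size_iota (vext g).+1) -sum1_size big_distrr /= !big_seq.
exact: leq_sum.
Qed.

Lemma bigraded_direct_sum : direct_sum (bigraded_part R c).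
Proof.
(* By [graph_size_bound] the order and the degree of a graph are non-negative, so the truncated
   subtractions are exact. *)
pose key (a b e : nat) : nat * nat := (e - b, 2 * e - a - 3 * b)%N.
apply: (@direct_sum_key _ key
  (fun km g => order g = km.1%:Z /\ degree g = km.2%:Z)) => -[k m] g gg /=.
have := graph_size_bound gg; rewrite /key /order /degree => b.
split=> [[o d]|[<- <-]]; last by split; lia.
by congr pair; lia.
Qed.
End Gradings.

(** * The differential graded algebra *)

Lemma exprN1z (R : realType) (z : int) : (-1 : R) ^ z = bsgn R (odd `|z|%N).
Proof.
case: z => n; first by rewrite -exprnP /bsgn signr_odd.
by rewrite NegzE -exprz_inv invrN1 -exprnP abszN /bsgn signr_odd.
Qed.

Section BilinearLeibniz.
Context (R : realType) (A : lmodType R) (m : A -> A -> A) (d : {linear A -> A}).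
Context (ml : forall y, linear (m^~ y)) (mr : forall x, linear (m x)).

Lemma bilinear0l y : m 0 y = 0.
Proof. by have /eqP := ml y 1 0 0; rewrite !scale1r addr0 -subr_eq subrr eq_sym => /eqP. Qed.

Lemma bilinear0r x : m x 0 = 0.
Proof. by have /eqP := mr x 1 0 0; rewrite !scale1r addr0 -subr_eq subrr eq_sym => /eqP. Qed.

Definition leibniz_rule (e : R) x y := d (m x y) = m (d x) y + e *: m x (d y).

Lemma leibniz_rule_linearl e y a u v : leibniz_rule e u y -> leibniz_rule e v y ->
  leibniz_rule e (a *: u + v) y.
Proof.
rewrite /leibniz_rule => Hu Hv; rewrite ml !linearP /= ml ml Hu Hv.
by rewrite !scalerDr !scalerA addrACA [a * _]mulrC.
Qed.

Lemma leibniz_rule_linearr e x a u v : leibniz_rule e x u -> leibniz_rule e x v ->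
  leibniz_rule e x (a *: u + v).
Proof.
rewrite /leibniz_rule => Hu Hv; rewrite mr !linearP /= mr mr Hu Hv.
by rewrite !scalerDr !scalerA addrACA [a * _]mulrC.
Qed.

Lemma leibniz_rule0l e y : leibniz_rule e 0 y.
Proof. by rewrite /leibniz_rule linear0 !bilinear0l linear0 scaler0 addr0. Qed.

Lemma leibniz_rule0r e x : leibniz_rule e x 0.
Proof. by rewrite /leibniz_rule linear0 !bilinear0r linear0 scaler0 addr0. Qed.

(** Passes from the symmetric form, where the differentiated factor always comes first, to the
    Leibniz rule. *)
Lemma leibniz_rule_comm e1 e2 x y : d (m x y) = m (d x) y + e1 *: m (d y) x ->
  m (d y) x = e2 *: m x (d y) -> leibniz_rule (e1 * e2) x y.
Proof. by rewrite /leibniz_rule => -> ->; rewrite scalerA. Qed.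
End BilinearLeibniz.

Section Algebra.
Context (R : realType) (c : parity).
Local Notation D := (graph_complex R c).
Local Notation d := (coboundary R c).
Local Notation "x \labelled_shuffle y" := (shuffle R c x y) (at level 40).

Lemma nedge_contract g k : (0 < k <= nedge g)%N ->
  nedge (contract_edge k g) = (nedge g).-1.
Proof.
move=> /andP [k0 kg]; rewrite /nedge /contract_edge /= size_map size_cat size_drop size_take_min.
by move: k0 kg; rewrite /nedge; lia.
Qed.

(** All gradings are functions of three numbers. An arc contraction removes one external vertex; an
    edge contraction removes one internal vertex and one edge. *)
Lemma coboundary_span (Q Q' : predgraph -> Prop) x :
  (forall g h, is_graph g -> Q g -> (0 < vext g)%N ->
     vext h = (vext g).-1 -> vint h = vint g -> nedge h = nedge g -> Q' h) ->
  (forall g h, is_graph g -> Q g -> (0 < vint g)%N -> (0 < nedge g)%N ->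
     vext h = vext g -> vint h = (vint g).-1 -> nedge h = (nedge g).-1 -> Q' h) ->
  graph_span Q x -> graph_span Q' (d x).
Proof.
move=> Qa Qe; elim/graph_span_ind => [|a u v|g gg Qg].
- by rewrite linear0; apply: graph_span0.
- by rewrite linearP; apply: graph_span_linear.
rewrite coboundary_cls // /coboundary_graph; case: (degenerate g); first exact: graph_span0.
apply: graph_spanD.
  apply: graph_span_sum => -[i j]; rewrite /arcs; case: (ltnP 1 (vext g)) => // v1 _ _.
  apply: graph_spanZ; apply: graph_span_cls => _.
  by apply: (Qa g) => //; [exact: ltnW | rewrite /nedge /= size_map].
apply: graph_span_sum => k; rewrite mem_index_iota ltnS => kg rk.
apply: graph_spanZ; apply: graph_span_cls => _.
have v0 : (0 < vint g)%N.
  by move: rk; rewrite /regular_edge /is_internal /int_vertices; case: (vint g).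
apply: (Qe g) => //; last exact: nedge_contract.
by case/andP: kg => k0; apply: leq_trans.
Qed.

Lemma shuffle_span (Q1 Q2 Q : predgraph -> Prop) x y :
  (forall g1 g2 h, is_graph g1 -> is_graph g2 -> Q1 g1 -> Q2 g2 ->
     vext h = (vext g1 + vext g2)%N -> vint h = (vint g1 + vint g2)%N ->
     nedge h = (nedge g1 + nedge g2)%N -> Q h) ->
  graph_span Q1 x -> graph_span Q2 y -> graph_span Q (x \labelled_shuffle y).
Proof.
move=> QQ Qx Qy; elim/graph_span_ind: Qx => [|a u v Qu Qv|g1 gg1 Qg1].
- by rewrite shuffle0l; apply: graph_span0.
- by rewrite shuffleDl shuffleZl; apply: graph_span_linear.
elim/graph_span_ind: Qy => [|a u v Qu Qv|g2 gg2 Qg2].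
- by rewrite shuffle0r; apply: graph_span0.
- by rewrite shuffleDr shuffleZr; apply: graph_span_linear.
rewrite shuffle_cls // /shuffle_graphs; apply: graph_spanZ; apply: graph_span_sum => w _ _.
apply: graph_spanZ; apply: graph_span_cls => _; apply: (QQ g1 g2) => //.
by rewrite /nedge /shuffle_graph /= size_map size_cat size_map.
Qed.

Lemma bigraded_coboundary k m x :
  bigraded_part R c (k, m) x -> bigraded_part R c (k, m.+1) (d x).
Proof.
apply: coboundary_span => g h gg /= [o e].
  by rewrite /order /degree => v0 -> -> ->; move: o e; rewrite /order /degree; split; lia.
by rewrite /order /degree => v0 e0 -> -> ->; move: o e; rewrite /order /degree; split; lia.
Qed.

Lemma graded_coboundary i x : graded_part R c i x -> graded_part R c (i - 1) (d x).
Proof.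
apply: coboundary_span => g h gg; rewrite /grading /nvert.
  by move=> <- v0 -> -> ->; case: (c); lia.
by move=> <- v0 e0 -> -> ->; case: (c); lia.
Qed.

Lemma graded_shuffle i j x y : graded_part R c i x -> graded_part R c j y ->
  graded_part R c (i + j) (x \labelled_shuffle y).
Proof.
apply: shuffle_span => g1 g2 h _ _; rewrite /grading /nvert => <- <- -> -> ->.
by case: (c); lia.
Qed.

Lemma grading_gr_odd g : odd `|grading c g|%N = gr_odd c g.
Proof.
rewrite /grading /gr_odd /nvert; case: (c); first by rewrite /= oddD.
by rewrite -PoszD absz_nat oddD addbC.
Qed.

Lemma shuffle_comm i j x y : graded_part R c i x -> graded_part R c j y ->
  x \labelled_shuffle y = (-1) ^ (i * j) *: (y \labelled_shuffle x).
Proof.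
rewrite exprN1z abszM oddM => gx gy.
elim/graph_span_ind: gx => [|a u v Qu Qv|g1 gg1 <-].
- by rewrite shuffle0l shuffle0r scaler0.
- by rewrite shuffleDl shuffleZl Qu Qv shuffleDr shuffleZr scalerDr !scalerA [a * _]mulrC.
elim/graph_span_ind: gy => [|a u v Qu Qv|g2 gg2 <-].
- by rewrite shuffle0l shuffle0r scaler0.
- by rewrite shuffleDr shuffleZr Qu Qv shuffleDl shuffleZl scalerDr !scalerA [a * _]mulrC.
by rewrite (shuffle_cls R c gg1 gg2) (shuffle_cls R c gg2 gg1) shuffle_graphsC // !grading_gr_odd.
Qed.

Lemma bilinear_assoc (m : D -> D -> D) :
  (forall y, linear (m^~ y)) -> (forall x, linear (m x)) ->
  (forall g1 g2 g3, is_graph g1 -> is_graph g2 -> is_graph g3 ->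
     m (cls R c g1) (m (cls R c g2) (cls R c g3)) = m (m (cls R c g1) (cls R c g2)) (cls R c g3)) ->
  associative m.
Proof.
move=> ml mr mA.
move=> x y z; elim/graph_complex_ind: x => [|a u v Hu Hv|g1 gg1].
- by rewrite !(bilinear0l ml).
- by rewrite !ml Hu Hv.
elim/graph_complex_ind: y => [|a u v Hu Hv|g2 gg2].
- by rewrite (bilinear0l ml) (bilinear0r mr) (bilinear0l ml).
- by rewrite ml !mr ml Hu Hv.
elim/graph_complex_ind: z => [|a u v Hu Hv|g3 gg3]; last exact: mA.
- by rewrite !(bilinear0r mr).
- by rewrite !mr Hu Hv.
Qed.

Lemma shuffle_assoc : associative (shuffle R c).
Proof.
apply: bilinear_assoc => [y|x|g1 g2 g3 gg1 gg2 gg3].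
- exact: shuffle_linearl.
- exact: shuffle_linearr.
have lg1 := lgraph_self gg1; set V1 := ext_vertices g1 ++ int_vertices g1.
set b2 := bound V1; have u2 := shifted_disjoint g2 (uniq_ext_int g1).
set V2 := V1 ++ (shifted b2 g2).1.1 ++ (shifted b2 g2).1.2.
have u3 := shifted_disjoint g3 u2; rewrite -/V1 -/b2 -/V2 in u3.
have lg2 := shifted_lgraph b2 gg2; have lg3 := shifted_lgraph (bound V2) gg3.
have u123 : uniq (V1 ++ ((shifted b2 g2).1.1 ++ (shifted b2 g2).1.2)
    ++ ((shifted (bound V2) g3).1.1 ++ (shifted (bound V2) g3).1.2)) by rewrite catA.
have := shuffle_cl_assoc R c lg1 lg2 lg3 u123.
by rewrite /graph_cls (std_self gg1) (shifted_std b2 gg2) (shifted_std _ gg3).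
Qed.

Lemma coboundary_square x : d (d x) = 0.
Proof.
elim/graph_complex_ind: x => [|a u v Hu Hv|g gg]; first by rewrite !linear0.
  by rewrite !linearP /= Hu Hv scaler0 addr0.
have lg := lgraph_self gg; rewrite -(std_self gg) -/(graph_cls R c _ _ _) (coboundary_cl R c lg).
exact: coboundary_labelled_d.
Qed.

Lemma coboundary_shuffle i x y : graded_part R c i x ->
  d (x \labelled_shuffle y) = d x \labelled_shuffle y + (-1) ^ i *: (x \labelled_shuffle d y).
Proof.
move=> gx; have sl := @shuffle_linearl R c; have sr := @shuffle_linearr R c.
change (leibniz_rule (shuffle R c) (coboundary R c : {linear D -> D}) ((-1) ^ i) x y).
elim/graph_span_ind: gx => [|a u v|g1 gg1 <-].
- exact: (leibniz_rule0l _ sl).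
- exact: (leibniz_rule_linearl sl).
elim/graph_complex_ind: y => [|a u v|g2 gg2].
- exact: (leibniz_rule0r _ sr).
- exact: (leibniz_rule_linearr sr).
have lg1 := lgraph_self gg1; set V1 := ext_vertices g1 ++ int_vertices g1.
set b2 := bound V1; have u2 := shifted_disjoint g2 (uniq_ext_int g1).
have lg2 := shifted_lgraph b2 gg2.
have := leibniz_cl R c lg1 lg2 u2; rewrite -(shuffle_cl R c lg1 lg2 u2).
rewrite -(coboundary_cl R c lg1) -(coboundary_cl R c lg2) /graph_cls (std_self gg1) (shifted_std b2 gg2).
move=> e.
have s1 : graded_part R c (grading c g1) (cls R c g1) by apply: graph_span_cls.
have s2 : graded_part R c (grading c g2) (cls R c g2) by apply: graph_span_cls.
(* With a and b the gradings of [g1] and [g2], moving the coboundary of [g2] behind [g1] costs (b -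
   1) a. Added to the sign a b of [leibniz_cl], this leaves the parity of a. *)
have cm := shuffle_comm (graded_coboundary s2) s1.
have := leibniz_rule_comm (d := coboundary R c : {linear D -> D}) e cm; congr (leibniz_rule _ _ _ _ _).
have -> : odd ((size (ext_vertices g1) + nlabels c (int_vertices g1) (edges g1)) *
   (size (shifted b2 g2).1.1 + nlabels c (shifted b2 g2).1.2 (shifted b2 g2).2))
   = odd `|(grading c g1 * grading c g2)%R|%N.
  rewrite abszM !oddM !grading_gr_odd /gr_odd !oddD /nlabels /= !size_map !size_iota.
  by case: (is_odd c).
rewrite !exprN1z bsgnM; congr (bsgn R _); move: (grading c g1) (grading c g2) => a b.
have -> : odd `|((b - 1) * a)%R|%N = ~~ odd `|b|%N && odd `|a|%N.
  by rewrite abszM oddM; congr andb; clear; lia.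
by rewrite abszM oddM; case: (odd _); case: (odd _).
Qed.

Lemma graded_algebra :
  graded_commutative_algebra (graded_part R c) (shuffle R c).
Proof.
split.
- exact: graded_direct_sum.
- exact: shuffle_linearl.
- exact: shuffle_linearr.
- exact: graded_shuffle.
- exact: shuffle_assoc.
- exact: shuffle_comm.
Qed.

Lemma dg_algebra :
  dg_commutative_algebra (graded_part R c) (shuffle R c) (coboundary R c : {linear D -> D}).
Proof.
split.
- exact: graded_algebra.
- exact: graded_coboundary.
- exact: coboundary_square.
- exact: coboundary_shuffle.
Qed.

Lemma unit_class_unit : algebra_unit (graded_part R c) (shuffle R c) (unit_class R c).
Proof.
split.
- by apply: graph_span_cls => _; case: (c).
- move=> x; elim/graph_complex_ind: x => [|a u v Hu Hv|g gg].
  + exact: shuffle0r.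
  + by rewrite shuffleDr shuffleZr Hu Hv.
  + by rewrite /unit_class shuffle_cls // shuffle_graphs_unit.
- move=> x; elim/graph_complex_ind: x => [|a u v Hu Hv|g gg].
  + exact: shuffle0l.
  + by rewrite shuffleDl shuffleZl Hu Hv.
  + by rewrite /unit_class shuffle_cls // shuffle_graphs_unitr.
Qed.

Lemma coboundary_unit : d (unit_class R c) = 0.
Proof.
rewrite /unit_class coboundary_cls // /coboundary_graph /= big_nil big_geq ?addr0 //.
Qed.
End Algebra.

(** * Cohomology *)

(** The two decompositions are extended by 0 to the union of their index lists, where independence
    applies to their difference [h]. *)
Lemma direct_sum_unique (R : realType) (A : lmodType R) (I : eqType) (gr : I -> A -> Prop)
    (s t : seq I) (f g : I -> A) :
  direct_sum gr -> uniq s -> uniq t -> (forall i, gr i (f i)) -> (forall i, gr i (g i)) ->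
  \sum_(i <- s) f i = \sum_(i <- t) g i ->
  {in s, forall i, f i = if i \in t then g i else 0}.
Proof.
case=> g0 gL _ gI us ut gf gg e i si; apply/eqP; rewrite -subr_eq0; apply/eqP.
pose h i := (if i \in s then f i else 0) - (if i \in t then g i else 0).
have extend (r : seq I) (F : I -> A) : {subset r <= s ++ t} -> uniq r ->
    \sum_(i <- undup (s ++ t)) (if i \in r then F i else 0) = \sum_(i <- r) F i.
  move=> sr ur; rewrite -big_mkcond -big_filter; apply: perm_big; apply: uniq_perm => //.
    by rewrite filter_uniq ?undup_uniq.
  by move=> k; rewrite mem_filter mem_undup; case: (boolP (k \in r)) => // /sr ->.
suff: h i = 0 by rewrite /h si.
apply: (gI (undup (s ++ t))); rewrite ?undup_uniq ?mem_undup ?mem_cat ?si //.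
  move=> k; rewrite /h -scaleN1r addrC; apply: gL; last by case: ifP.
  by case: ifP.
rewrite big_split /= sumrN !extend // ?e ?subrr // => k; rewrite mem_cat => ->; by rewrite ?orbT.
Qed.

Section CohomologyAlgebra.
Context (R : realType) (A : lmodType R) (gr : int -> A -> Prop) (mul : A -> A -> A).
Context (d : {linear A -> A}) (H : dg_commutative_algebra gr mul d).
Local Notation gca := (dgca_gca H).
Local Notation dsA := (gca_graded gca).

Lemma mul0l y : mul 0 y = 0.
Proof. exact: (bilinear0l (gca_linear_l gca)). Qed.

Lemma mul0r x : mul x 0 = 0.
Proof. exact: (bilinear0r (gca_linear_r gca)). Qed.

Lemma mulDl x x' y : mul (x + x') y = mul x y + mul x' y.
Proof. by have := gca_linear_l gca y 1 x x'; rewrite !scale1r. Qed.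

Lemma mulDr x y y' : mul x (y + y') = mul x y + mul x y'.
Proof. by have := gca_linear_r gca x 1 y y'; rewrite !scale1r. Qed.

Lemma mulZl a x y : mul (a *: x) y = a *: mul x y.
Proof. by have := gca_linear_l gca y a x 0; rewrite !addr0 mul0l addr0. Qed.

Lemma mul_suml (I : Type) (r : seq I) (F : I -> A) y :
  mul (\sum_(k <- r) F k) y = \sum_(k <- r) mul (F k) y.
Proof. by elim/big_rec2: _ => [|k u v _ <-]; rewrite ?mul0l ?mulDl. Qed.

(** The elements [d (f i)] lie in the distinct degrees [i - 1], so a vanishing sum forces each of
    them to vanish. *)
Lemma component_cocycle (s : seq int) (f : int -> A) : uniq s -> (forall i, gr i (f i)) ->
  d (\sum_(i <- s) f i) = 0 -> {in s, forall i, d (f i) = 0}.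
Proof.
move=> us gf; rewrite linear_sum => d0 i si.
have gi : uniq [seq k - 1 | k <- s] by rewrite map_inj_uniq //; apply: addIr.
have gd k : gr k (d (f (k + 1))).
  by have := dgca_degree H (gf (k + 1)); rewrite addrK.
have := ds_independent dsA gi gd; rewrite big_map.
under eq_bigr do rewrite subrK.
by move=> /(_ d0 (i - 1)); rewrite subrK => -> //; apply/mapP; exists i.
Qed.

(** [x'] is the image of [x] under the grading involution, which multiplies the component of degree
    [i] by (-1)^i. *)
Lemma leibniz_inhomogeneous x : exists x', forall y, d (mul x y) = mul (d x) y + mul x' (d y).
Proof.
have [s [f [us gf ->]]] := ds_generate dsA x.
exists (\sum_(i <- s) (-1) ^ i *: f i) => y.
rewrite !mul_suml !linear_sum mul_suml -big_split; apply: eq_bigr => i _.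
by rewrite (dgca_leibniz H _ (gf i)) mulZl.
Qed.

(** The primitive is the product of [w] with the grading involution applied to [x]; each homogeneous
    component of [x] is a cocycle, so the other Leibniz term is 0. *)
Lemma cocycle_mul_coboundary x w : d x = 0 -> exists u, mul x (d w) = d u.
Proof.
have [s [f [us gf ->]]] := ds_generate dsA x => d0.
have df := component_cocycle us gf d0.
exists (\sum_(i <- s) (-1) ^ i *: mul (f i) w).
rewrite mul_suml linear_sum !big_seq; apply: eq_bigr => i si.
rewrite linearZ /= (dgca_leibniz H _ (gf i)) df // mul0l add0r scalerA.
by rewrite exprN1z bsgnM addbb bsgn0 scale1r.
Qed.

Lemma mul_cocycle (x y : cocycle d) : mul (val x) (val y) \in is_cocycle d.
Proof.
have [x' e] := leibniz_inhomogeneous (val x); rewrite unfold_in; apply/eqP; rewrite e.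
have /eqP -> := valP x; have /eqP -> := valP y.
by rewrite mul0l mul0r addr0.
Qed.

Definition cocycle_mul (x y : cocycle d) : cocycle d :=
  exist (is_cocycle d) (mul (val x) (val y)) (mul_cocycle x y).

Lemma coh_class_linear a (x y : cocycle d) :
  coh_class (a *: x + y) = a *: coh_class x + coh_class y.
Proof. exact: (linearP (quot_pi (is_coboundary (d := d)))). Qed.

Lemma coh_class_eq (x y : cocycle d) :
  coh_class x = coh_class y <-> exists w, val x = val y + d w.
Proof.
split=> [/quot_piP /spanP [s [Gs e]]|[w e]]; last first.
  apply/quot_piP/spanP; exists [:: (1, x - y)]; rewrite big_seq1 scale1r; split => // u.
  by rewrite inE => /eqP -> /=; exists w; rewrite raddfB /= e addrAC subrr add0r.
suff [w dw] : exists w, val (x - y) = d w.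
  by exists w; rewrite -dw raddfB /= addrC subrK.
rewrite e; elim: s Gs {e} => [|[a u] s IH] Gs; first by exists 0; rewrite big_nil !linear0.
have [w dw] : is_coboundary u by apply: (Gs (a, u)); rewrite mem_head.
have [|w' dw'] := IH; first by move=> v vs; apply: Gs; rewrite inE vs orbT.
by exists (a *: w + w'); rewrite big_cons !linearP /= -dw -dw'.
Qed.

(** The representatives are changed one after the other: [d w1] times the cocycle [y'] is the
    coboundary of [mul w1 y'], and [x] times [d w2] is a coboundary by [cocycle_mul_coboundary]. *)
Lemma coh_mul_class x y :
  coh_mul (d := d) mul (coh_class x) (coh_class y) = coh_class (cocycle_mul x y).
Proof.
rewrite /coh_mul; set x' := coh_repr _; set y' := coh_repr _.
have -> : insubd (0 : cocycle d) (mul (val x') (val y')) = cocycle_mul x' y'.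
  by apply: val_inj; rewrite insubdK // mul_cocycle.
have /coh_class_eq [w1 e1] : coh_class x' = coh_class x by exact: quot_reprK.
have /coh_class_eq [w2 e2] : coh_class y' = coh_class y by exact: quot_reprK.
have [u1 eu1] : exists u, mul (d w1) (val y') = d u.
  have [w' e] := leibniz_inhomogeneous w1; exists (mul w1 (val y')).
  by rewrite e; have /eqP -> := valP y'; rewrite mul0r addr0.
have [u2 eu2] := cocycle_mul_coboundary w2 (eqP (valP x)).
apply/coh_class_eq; exists (u1 + u2).
by rewrite /= e1 mulDl eu1 e2 mulDr eu2 linearD /= addrAC addrA.
Qed.

Lemma coh_ind (P : cohomology d -> Prop) : (forall x, P (coh_class x)) -> forall h, P h.
Proof. by move=> Pc h; rewrite -(quot_reprK h); apply: Pc. Qed.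

Lemma coh_class0 : coh_class (0 : cocycle d) = 0.
Proof. exact: (linear0 (quot_pi (is_coboundary (d := d)))). Qed.

Lemma coh_class_sum (I : Type) (r : seq I) (F : I -> cocycle d) :
  coh_class (\sum_(k <- r) F k) = \sum_(k <- r) coh_class (F k).
Proof. exact: (linear_sum (quot_pi (is_coboundary (d := d)))). Qed.

Lemma coh_direct_sum : direct_sum (coh_gr d gr).
Proof.
split.
- by move=> i; exists 0; [exact: ds_zero dsA i | rewrite coh_class0].
- move=> i a _ _ [x gx ->] [y gy ->]; exists (a *: x + y); last by rewrite coh_class_linear.
  by rewrite linearP /=; apply: ds_linear dsA _ _ _ _ gx gy.
- elim/coh_ind => x; have [s [f [us gf e]]] := ds_generate dsA (val x).
  have df : {in s, forall i, d (f i) = 0}.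
    by apply: component_cocycle us gf _; rewrite -e; apply/eqP/(valP x).
  (* Outside [s] the element [f i] need not be a cocycle; [insubd] replaces it by 0 there, and such
     indices do not enter the sum. *)
  exists s, (fun i => coh_class (insubd (0 : cocycle d) (f i))); split => //.
    move=> i; exists (insubd (0 : cocycle d) (f i)) => //; rewrite val_insubd.
    by case: ifP => // _; apply: ds_zero dsA i.
  rewrite -coh_class_sum; congr coh_class; apply: val_inj; rewrite e raddf_sum !big_seq.
  by apply: eq_bigr => i si /=; rewrite insubdK // unfold_in df.
- move=> s F us gF; have /choice [z zF] : forall i, exists z : cocycle d, gr i (val z) /\ F i = coh_class z.
    by move=> i; have [z gz e] := gF i; exists z.
  have gz i : gr i (val (z i)) by case: (zF i).
  under eq_bigr do rewrite (zF _).2.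
  rewrite -coh_class_sum -coh_class0 => /coh_class_eq [w].
  rewrite raddf_sum raddf0 add0r => e i si; rewrite (zF i).2; apply/coh_class_eq.
  (* The sum of the cocycles is [d w]. Comparing components, [z i] is the coboundary of the
     component of [w] in degree [i + 1], or 0 if [w] has none. *)
  have [t [g [ut gg ew]]] := ds_generate dsA w.
  have ut' : uniq [seq k - 1 | k <- t] by rewrite map_inj_uniq //; apply: addIr.
  have gd k : gr k (d (g (k + 1))).
    by have := dgca_degree H (gg (k + 1)); rewrite addrK.
  have e' : \sum_(k <- s) val (z k) = \sum_(k <- [seq k - 1 | k <- t]) d (g (k + 1)).
    by rewrite e ew linear_sum big_map; apply: eq_bigr => k _; rewrite subrK.
  have /= -> // := direct_sum_unique dsA us ut' gz gd e'.
    by case: (_ \in _); [exists (g (i + 1)) | exists 0]; rewrite ?linear0; symmetry; apply: add0r.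
Qed.

Lemma coh_algebra : graded_commutative_algebra (coh_gr d gr) (coh_mul (d := d) mul).
Proof.
split; first exact: coh_direct_sum.
- elim/coh_ind => y a; elim/coh_ind => x; elim/coh_ind => x'.
  rewrite -coh_class_linear !coh_mul_class -coh_class_linear; congr coh_class.
  by apply: val_inj; rewrite /= (gca_linear_l gca).
- elim/coh_ind => y a; elim/coh_ind => x; elim/coh_ind => x'.
  rewrite -coh_class_linear !coh_mul_class -coh_class_linear; congr coh_class.
  by apply: val_inj; rewrite /= (gca_linear_r gca).
- move=> i j _ _ [x gx ->] [y gy ->]; rewrite coh_mul_class; exists (cocycle_mul x y) => //.
  exact: gca_degree gca _ _ _ _ gx gy.
- elim/coh_ind => x; elim/coh_ind => y; elim/coh_ind => z; rewrite !coh_mul_class.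
  by congr coh_class; apply: val_inj; rewrite /= (gca_assoc gca).
- move=> i j _ _ [x gx ->] [y gy ->]; rewrite !coh_mul_class.
  (* The zero class is added to give the right side the shape required by [coh_class_linear]. *)
  rewrite -[RHS]addr0 -coh_class0 -coh_class_linear; congr coh_class; apply: val_inj.
  by rewrite /= addr0 (gca_comm gca gx gy).
Qed.

Lemma coh_unit one (z : cocycle d) : algebra_unit gr mul one -> val z = one ->
  algebra_unit (coh_gr d gr) (coh_mul (d := d) mul) (coh_class z).
Proof.
case=> g1 m1 mr1 e; split.
- by exists z; rewrite ?e.
- by elim/coh_ind => x; rewrite coh_mul_class; congr coh_class; apply: val_inj; rewrite /= e m1.
- by elim/coh_ind => x; rewrite coh_mul_class; congr coh_class; apply: val_inj; rewrite /= e mr1.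
Qed.
End CohomologyAlgebra.

Theorem mainTheorem6 (R : realType) (c : parity) :
  let D := graph_complex R c in
  let delta : {linear D -> D} := coboundary R c in
  let mul : D -> D -> D := shuffle R c in
  let one : D := unit_class R c in
  let coh_part := coh_gr delta (graded_part R c) in
  [/\ (forall g : dgraph,
         delta (cls R c (val g)) = coboundary_graph R c (val g)),
      (forall g1 g2 : dgraph,
         mul (cls R c (val g1)) (cls R c (val g2))
         = shuffle_graphs R c (val g1) (val g2)),
      direct_sum (bigraded_part R c)
    & forall (k m : nat) (x : D), bigraded_part R c (k, m) x ->
         bigraded_part R c (k, m.+1) (delta x)] /\
  [/\ dg_commutative_algebra (graded_part R c) mul delta,
      algebra_unit (graded_part R c) mul one,
      (forall x y : cocycle delta, exists2 z : cocycle delta,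
         val z = mul (val x) (val y)
         & coh_mul mul (coh_class x) (coh_class y) = coh_class z),
      graded_commutative_algebra coh_part (coh_mul (d := delta) mul)
    & exists2 z : cocycle delta, val z = one
         & algebra_unit coh_part (coh_mul mul) (coh_class z)].
Proof.
move=> D delta mul one coh_part.
have H : dg_commutative_algebra (graded_part R c) mul delta by exact: dg_algebra.
have U : algebra_unit (graded_part R c) mul one by exact: unit_class_unit.
have one_cocycle : is_cocycle delta one by apply/eqP; exact: coboundary_unit.
split; split.
- by move=> g; exact: (coboundary_cls R c (valP g)).
- by move=> g1 g2; exact: (shuffle_cls R c (valP g1) (valP g2)).
- exact: bigraded_direct_sum.
- exact: bigraded_coboundary.
- exact: H.
- exact: U.
- by move=> x y; exists (cocycle_mul H x y); last exact: coh_mul_class.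
- exact: coh_algebra.
- exists (exist (is_cocycle delta) one one_cocycle); first by [].
  exact: (coh_unit H U).
Qed.
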